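(* Let $n\ge2$ and $d\ge1$ be integers, and let $\epsilon_0=\epsilon_0(n,d,C_M,C_P)>0$ be the smallness constant of the parameterization theorem recalled in the context. Then there exists an $n$-Ahlfors regular $n$-rectifiable set $M\subset B_2(0)\subset\mathbb R^{n+d}$ that is not Reifenberg flat and that satisfies all the hypotheses of that theorem. That is: $0\in M$; and there are constants $C_M\ge 1$, $C_P$ and $\lambda\ge1$ such that, with $\mu=\mathcal H^n$ restricted to $M$, (a) $M$ is closed and $C_M^{-1}r^n\le\mu(B_r(x))\le C_Mr^n$ for all $x\in M$, $0<r\le1$; (b) for all $x\in M$, $r>0$ and every Lipschitz function $f:\mathbb R^{n+d}\to\mathbb R$, $$\frac{1}{\mu(B_r(x))}\int_{B_{r}(x)} | f(y) - f_{x,r} | \, d \mu(y) \leq C_{P} \, r \left(\frac{1}{\mu(B_{\lambda r}(x))}\int_{B_{\lambda r}(x)}|\nabla^{M}f(y)|^{2} \, d \mu(y) \right)^{1/2};$$ (c) for all $x\in M\cap B_1(0)$, $$\int_{0}^{1} \left(\frac{1}{\mu(B_r(x))}\int_{B_{r}(x)} |\pi_{T_{y}M} - A_{x,r}|^{2} \, d \mu(y) \right) \frac{dr}{r} < \epsilon_{0}(n,d,C_M,C_P)^{2}.$$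
   Context: $B_r(x)$ is the open Euclidean ball in $\mathbb{R}^{n+d}$, $d(\cdot,\cdot)$ the distance from a point to a set, $\mathcal H^n$ is $n$-dimensional Hausdorff measure, and $f_{x,r}=\frac1{\mu(B_r(x))}\int_{B_r(x)}f\,d\mu$. A closed set satisfying (a) is called $n$-Ahlfors regular. An $\mathcal H^n$-measurable set $M$ is ($n$-)rectifiable if $M \subset M_0 \cup \bigcup_{i\ge1} f_i(A_i)$ with $\mathcal H^n(M_0)=0$, $A_i\subset\mathbb R^n$ and $f_i:A_i\to\mathbb R^{n+d}$ Lipschitz. The approximate tangent space $T_xM$ is the (unique, if it exists) $n$-dimensional linear subspace $P$ such that $\lim_{h\to0}h^{-n}\int_M f(h^{-1}(y-x))\,d\mathcal H^n(y)=\int_P f\,d\mathcal H^n$ for all $f\in C^1_c(\mathbb R^{n+d},\mathbb R)$; it exists $\mathcal H^n$-a.e. on a rectifiable set. For $f:\mathbb R^{n+d}\to\mathbb R$ Lipschitz, $\nabla^Mf(y)=\nabla(f|_L)(y)$ with $L=y+T_yM$; it exists at $\mathcal{H}^n$-a.e. $y\in M$. $\pi_{T_yM}$ is the orthogonal projection onto $T_yM$, identified with its matrix $(a_{ij}(y))_{ij}$ in the standard basis; $A_{x,r}=((a_{ij})_{x,r})_{ij}$ is the entrywise $\mu$-average over $B_r(x)$; $|\cdot|$ on matrices is the Frobenius norm. An $n$-dimensional set $E\subset\mathbb R^{n+d}$ is $\epsilon$-Reifenberg flat ($\epsilon>0$) if for every $x\in E$ and $0<r\le 10^{-4}$ there is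 an $n$-dimensional affine subspace $P(x,r)$ containing $x$ with $d(y,P(x,r))\le\epsilon r$ for all $y\in E\cap B_r(x)$ and $d(y,E)\le\epsilon r$ for all $y\in P(x,r)\cap B_r(x)$. Every set is 1-Reifenberg flat, so the notion is meaningful only for small $\epsilon$; ''not Reifenberg flat'' means that there is $\epsilon_*>0$ such that $E$ is not $\epsilon$-Reifenberg flat for any $0<\epsilon\le\epsilon_*$. Parameterization theorem (defining $\epsilon_0$): there are $\epsilon_0(n,d,C_M,C_P)>0$, $\theta_0(\lambda)\in(0,1)$, $K(n,d,C_M,C_P)$, $C_0(n,d,C_M,C_P)$ such that whenever a rectifiable set $M\subset B_2(0)\subset \mathbb{R}^{n+d}$ containing the origin satisfies (a), (b) and (c), there are an onto $K$-bi-Lipschitz map $g:\mathbb R^{n+d}\to\mathbb R^{n+d}$ (i.e. $K^{-1}|x-y|\le|g(x)-g(y)|\le K|x-y|$) and an $n$-dimensional plane $\Sigma_0$ with $g(z)=z$ when $d(z,\Sigma_0)\ge2$, $|g(z)-z|\le C_0\epsilon_0$ for all $z$, $g(\Sigma_0)$ a $C_0\epsilon_0$-Reifenberg flat set, and $M\cap B_{\theta_0}(0)\subset g(\Sigma_0)$. Here $\epsilon_0(n,d,C_M,C_P)$ is a fixed choice of such a constant. *)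

(* Defs.v *)
From HB Require Import structures.
From mathcomp Require Import all_boot all_order all_algebra.
From mathcomp Require Import all_classical all_reals all_analysis.

Set Implicit Arguments.
Unset Strict Implicit.
Unset Printing Implicit Defensive.

Import Order.TTheory GRing.Theory Num.Theory.
Import numFieldNormedType.Exports.

Local Open Scope classical_set_scope.
Local Open Scope ring_scope.

(* The library's norm on matrices is the sup norm.  It induces the same topology
   as the Euclidean norm below (so [closed], [compact], [differentiable] can be
   used as they are), but all metric notions must go through [enorm].  On row
   vectors [enorm] is the Euclidean norm, on square matrices the Frobenius one. *)
Definition enorm (R : realType) (p q : nat) (A : 'M[R]_(p, q)) : R :=
  Num.sqrt (\sum_i \sum_j A i j ^+ 2).

Definition dot (R : realType) (m : nat) (u v : 'rV[R]_m) : R := (u *m v^T) 0 0.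

Definition eball (R : realType) (m : nat) (x : 'rV[R]_m) (r : R) :
  set 'rV[R]_m := [set y | enorm (y - x) < r].

Definition dist_set (R : realType) (m : nat) (x : 'rV[R]_m)
  (E : set 'rV[R]_m) : R := inf [set enorm (x - y) | y in E].

(* Volume of the unit ball of R^n, by omega_(n+2) = 2 pi / (n+2) * omega_n. *)
Fixpoint unit_ball_volume (R : realType) (n : nat) : R :=
  match n with
  | 0 => 1
  | 1 => 2
  | k.+2 => 2 * pi / k.+2%:R * unit_ball_volume R k
  end.

Section Hausdorff.
Context {R : realType} {m : nat}.
Local Open Scope ereal_scope.
Implicit Types (A U : set 'rV[R]_m) (n : nat) (delta : R).

(* The point 0 only matters for the empty set, which gets diameter 0. *)
Definition ediam U : \bar R :=
  ereal_sup ([set (enorm (x - y))%:E | x in U & y in U] `|` [set 0]).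

(* The empty set is singled out because of 0 ^ 0 = 1 when n = 0. *)
Definition hausdorff_gauge n U : \bar R :=
  if U == set0 then 0
  else (unit_ball_volume R n / 2 ^+ n)%:E * ediam U ^+ n.

Definition hausdorff_delta n delta A : \bar R :=
  ereal_inf [set \sum_(k <oo) hausdorff_gauge n (U k) | U in
    [set U : (set 'rV[R]_m)^nat |
       A `<=` \bigcup_k U k /\ forall k, ediam (U k) <= delta%:E]].

Definition hausdorff n A : \bar R :=
  ereal_sup [set hausdorff_delta n delta A | delta in [set delta | (0 < delta)%R]].

Lemma unit_ball_volume_gt0 n : (0 < unit_ball_volume R n)%R.
Proof.
elim/ltn_ind: n => -[|[|n]] IH //=.
by rewrite mulr_gt0 ?IH// divr_gt0 ?mulr_gt0 ?pi_gt0.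
Qed.

Lemma ediam_ge0 U : 0 <= ediam U.
Proof. by apply: ereal_sup_ubound; right. Qed.

Lemma ediam0 : ediam set0 = 0.
Proof.
apply/eqP; rewrite eq_le ediam_ge0 andbT.
by apply: ge_ereal_sup => _ [[? []]|->].
Qed.

Lemma hausdorff_gauge_ge0 n U : 0 <= hausdorff_gauge n U.
Proof.
rewrite /hausdorff_gauge; case: ifP => // _.
rewrite mule_ge0 ?expe_ge0 ?ediam_ge0// lee_fin divr_ge0 ?exprn_ge0//.
exact: ltW (unit_ball_volume_gt0 n).
Qed.

Lemma hausdorff_gauge0 n : hausdorff_gauge n set0 = 0.
Proof. by rewrite /hausdorff_gauge eqxx. Qed.

Lemma hausdorff_delta_ge0 n delta A : 0 <= hausdorff_delta n delta A.
Proof.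
apply: le_ereal_inf_tmp => _ [U _ <-].
by apply: nneseries_ge0 => k _ _; exact: hausdorff_gauge_ge0.
Qed.

Lemma hausdorff_delta0 n delta : (0 < delta)%R -> hausdorff_delta n delta set0 = 0.
Proof.
move=> d0; apply/eqP; rewrite eq_le hausdorff_delta_ge0 andbT.
apply: ereal_inf_lbound; exists (fun=> set0).
  by split=> // k; rewrite ediam0 lee_fin ltW.
by rewrite eseries0// => k _ _; rewrite hausdorff_gauge0.
Qed.

Lemma le_hausdorff_delta n delta A B :
  A `<=` B -> hausdorff_delta n delta A <= hausdorff_delta n delta B.
Proof.
move=> AB; apply/ereal_inf_le_tmp => _ [U [BU dU] <-].
by exists U => //; split => //; exact: subset_trans BU.
Qed.

Lemma hausdorff_delta_sigma_subadditive n delta :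
  sigma_subadditive (hausdorff_delta n delta).
Proof.
move=> A; set mu := hausdorff_delta n delta.
have mu_ge0 := hausdorff_delta_ge0 n delta : forall B, 0 <= mu B.
have [[i ioo]|] := pselect (exists i, mu (A i) = +oo).
  rewrite (eseries_pinfty _ _ ioo) ?leey// => k _.
  by rewrite -ltNye (lt_le_trans _ (mu_ge0 _)).
rewrite -forallNE => Aoo.
suff add2e (e : {posnum R}) :
    mu (\bigcup_k A k) <= \sum_(i <oo) mu (A i) + e%:num%:E.
  by apply/lee_addgt0Pr => _/posnumP[].
rewrite (le_trans _ (epsilon_trick _ _ _))//.
pose P k (B : (set 'rV[R]_m)^nat) :=
  (A k `<=` \bigcup_j B j /\ forall j, ediam (B j) <= delta%:E) /\
  \sum_(j <oo) hausdorff_gauge n (B j) <= mu (A k) + (e%:num / (2 ^ k.+1)%:R)%:E.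
have [G PG] : {G : ((set 'rV[R]_m)^nat)^nat & forall k, P k (G k)}.
  apply: (@choice _ _ P) => k; rewrite /P /mu /hausdorff_delta.
  set S := (X in ereal_inf X); move infS : (ereal_inf S) => iS.
  case: iS infS => [r Sr|Soo|Soo].
  - have en1 : (0 < e%:num / (2 ^ k.+1)%:R)%R by [].
    have /(lb_ereal_inf_adherent en1) : ereal_inf S \is a fin_num by rewrite Sr.
    move=> [x [B AB xS]]; rewrite -xS => muBx.
    by exists B; split => //; rewrite -Sr; exact/ltW.
  - by have := Aoo k; rewrite /mu /hausdorff_delta -/S Soo.
  - by have := mu_ge0 (A k); rewrite /mu /hausdorff_delta -/S Soo.
pose g := hausdorff_gauge n.
have g_ge0 x : 0 <= (g \o uncurry G) x by exact: hausdorff_gauge_ge0.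
apply: (@le_trans _ _ (\esum_(i in setT) (g \o uncurry G) i)).
  apply: ereal_inf_lbound => /=.
  have /card_esym/ppcard_eqP[f] := card_nat2.
  exists (uncurry G \o f).
    split => [t [i _ Ait]|k /=]; last first.
      by rewrite /uncurry; case: (f k) => a b; exact: (PG a).1.2.
    have [j _ Gt] := (PG i).1.1 t Ait.
    by exists (f^-1%FUN (i, j)) => //=; rewrite invK ?inE.
  rewrite -(esum_pred_image (g \o uncurry G) _ xpredT) ?[fun=> _]set_true//.
  by rewrite image_eq.
rewrite (_ : esum _ _ = \sum_(i <oo) \sum_(j <oo ) g (G i j)); last first.
  pose J : nat -> set (nat * nat) := fun i => [set (i, j) | j in setT].
  rewrite (_ : setT = \bigcup_k J k); last first.
    by rewrite predeqE => -[a b]; split => // _; exists a => //; exists b.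
  rewrite esum_bigcupT /=; last 2 first.
    - apply/trivIsetP => i j _ _ ij.
      rewrite predeqE => -[x y] /=; split => //= -[] [_] _ [<-{x} _].
      by move=> [z _] [ji _]; move: ij; rewrite ji eqxx.
    - by move=> /= [x y]; exact: hausdorff_gauge_ge0.
  rewrite -(image_id [set: nat]) -fun_true esum_pred_image//; last first.
    by move=> k _; apply: esum_ge0 => ? _; exact: g_ge0.
  apply: eq_eseriesr => /= j _.
  rewrite -(esum_pred_image (g \o uncurry G) (pair j) predT)//=; last first.
    by move=> ? ? _ _; exact: (@can_inj _ _ _ snd).
    by move=> k _; exact: hausdorff_gauge_ge0.
  by congr esum; rewrite predeqE => -[a b]; split; move=> [i _ <-]; exists i.
apply: lee_nneseries => [k _ _|k _].
- by apply: nneseries_ge0 => j *; exact: (g_ge0 (k, j)).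
- exact: (PG k).2.
Qed.

Lemma hausdorff0 n : hausdorff n set0 = 0.
Proof.
apply/eqP; rewrite eq_le; apply/andP; split.
  by apply: ge_ereal_sup => _ [d d0 <-]; rewrite hausdorff_delta0.
by apply: ereal_sup_ubound; exists 1%R => //=; rewrite hausdorff_delta0.
Qed.

Lemma hausdorff_ge0 n A : 0 <= hausdorff n A.
Proof.
apply: (le_trans (hausdorff_delta_ge0 n 1 A)).
by apply: ereal_sup_ubound; exists 1%R => //=.
Qed.

Lemma le_hausdorff n : {homo hausdorff n : A B / A `<=` B >-> A <= B}.
Proof.
move=> A B AB; apply: ge_ereal_sup => _ [d d0 <-].
apply: (le_trans (le_hausdorff_delta n d AB)).
by apply: ereal_sup_ubound; exists d.
Qed.

Lemma hausdorff_sigma_subadditive n : sigma_subadditive (hausdorff n).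
Proof.
move=> A; apply: ge_ereal_sup => _ [d d0 <-].
apply: (le_trans (hausdorff_delta_sigma_subadditive n d A)).
apply: lee_nneseries => [k _ _|k _]; first exact: hausdorff_delta_ge0.
by apply: ereal_sup_ubound; exists d.
Qed.

HB.instance Definition _ n := isOuterMeasure.Build R 'rV[R]_m (hausdorff n)
  (hausdorff0 n) (hausdorff_ge0 n) (@le_hausdorff n)
  (@hausdorff_sigma_subadditive n).

(* H^n as a measure on the sigma-algebra of all H^n-measurable sets. *)
Definition hausdorff_outer n : {outer_measure set 'rV[R]_m -> \bar R} :=
  hausdorff n.

Definition hausdorff_measure n :
  {measure set (caratheodory_type (hausdorff_outer n)) -> \bar R} :=
  (hausdorff_outer n : set (caratheodory_type (hausdorff_outer n)) -> \bar R).

End Hausdorff.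

Section SetsInEuclideanSpace.
Context {R : realType} {m : nat}.
Implicit Types (M E : set 'rV[R]_m) (x y z g : 'rV[R]_m) (n : nat).
Implicit Types (f : 'rV[R]_m -> R).

(* Linear subspaces are given as row spaces of square matrices. *)
Definition affine_plane x (P : 'M[R]_m) : set 'rV[R]_m :=
  [set y | (y - x <= P)%MS].

(* [kermx P^T] spans the orthogonal complement of P.  The matrix acts on row
   vectors from the right, which is immaterial as it is symmetric. *)
Definition orth_proj (P : 'M[R]_m) : 'M[R]_m := proj_mx P (kermx P^T).

(* mu (B_r(x)) and f_{x,r} for mu = H^n restricted to M. *)
Definition ball_mass n M x (r : R) : \bar R :=
  hausdorff_measure n (M `&` eball x r).

Definition avg n M x (r : R) f : R :=
  (fine (ball_mass n M x r))^-1 *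
  Rintegral (hausdorff_measure n) (M `&` eball x r) f.

Definition rectifiable n M : Prop :=
  (hausdorff n).-cara.-measurable M /\
  exists (M0 : set 'rV[R]_m) (A : nat -> set 'rV[R]_n)
         (f : nat -> 'rV[R]_n -> 'rV[R]_m),
    [/\ hausdorff n M0 = 0%E,
        forall i, exists L : R, forall u v, A i u -> A i v ->
          enorm (f i u - f i v) <= L * enorm (u - v) &
        M `<=` M0 `|` \bigcup_i (f i @` A i)].

Definition C1_compact_support f : Prop :=
  [/\ forall x, differentiable f x,
      forall v : 'rV[R]_m, continuous (fun x => 'D_v f x) &
      compact (closure [set x | f x != 0])].

Definition is_approx_tangent n M x (P : 'M[R]_m) : Prop :=
  \rank P = n /\
  forall f, C1_compact_support f ->
    (h ^- n * Rintegral (hausdorff_measure n) M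
                (fun y => f (h^-1 *: (y - x)))) @[h --> 0^'+]
    --> Rintegral (hausdorff_measure n) [set y | (y <= P)%MS] f.

(* T_xM; the zero subspace where the approximate tangent space does not exist. *)
Definition approx_tangent n M x : 'M[R]_m :=
  xget 0 [set P | is_approx_tangent n M x P].

(* g is the gradient at y of the restriction of f to the affine plane y + P. *)
Definition is_plane_gradient f (P : 'M[R]_m) y g : Prop :=
  (g <= P)%MS /\
  forall e : R, 0 < e -> exists2 delta : R, 0 < delta &
    forall v : 'rV[R]_m, (v <= P)%MS -> enorm v < delta ->
      `|f (y + v) - f y - dot g v| <= e * enorm v.

Definition tangential_gradient n M f y : 'rV[R]_m :=
  xget 0 [set g | is_plane_gradient f (approx_tangent n M y) y g].

Definition ahlfors_regular n M (CM : R) : Prop :=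
  closed M /\
  forall x (r : R), M x -> 0 < r <= 1 ->
    ((CM^-1 * r ^+ n)%:E <= ball_mass n M x r <= (CM * r ^+ n)%:E)%E.

Definition poincare_inequality n M (CP lambda : R) : Prop :=
  forall x (r : R) f, M x -> 0 < r ->
    (exists L : R, forall y z, `|f y - f z| <= L * enorm (y - z)) ->
    avg n M x r (fun y => `|f y - avg n M x r f|) <=
    CP * r * Num.sqrt
      (avg n M x (lambda * r)
         (fun y => enorm (tangential_gradient n M f y) ^+ 2)).

Definition tangent_proj n M y : 'M[R]_m := orth_proj (approx_tangent n M y).

(* A_{x,r} *)
Definition avg_tangent_proj n M x (r : R) : 'M[R]_m :=
  \matrix_(i, j) avg n M x r (fun y => tangent_proj n M y i j).

Definition carleson_condition n M (eps : R) : Prop :=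
  forall x, M x -> eball 0 1 x ->
    (\int[lebesgue_measure]_(r in `]0%R, 1%R[)
       (avg n M x r (fun y =>
          enorm (tangent_proj n M y - avg_tangent_proj n M x r) ^+ 2) / r)%:E
     < (eps ^+ 2)%:E)%E.

Definition parameterization_hypotheses n M (CM CP lambda eps : R) : Prop :=
  [/\ M `<=` eball 0 2, M 0 & rectifiable n M] /\
  [/\ ahlfors_regular n M CM,
      poincare_inequality n M CP lambda &
      carleson_condition n M eps].

Definition reifenberg_flat n (eps : R) E : Prop :=
  0 < eps /\
  forall x (r : R), E x -> 0 < r <= 10%:R ^- 4 ->
    exists P : 'M[R]_m,
      [/\ \rank P = n,
          forall y, E y -> eball x r y ->
            dist_set y (affine_plane x P) <= eps * r &
          forall y, affine_plane x P y -> eball x r y ->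
            dist_set y E <= eps * r].

Definition not_reifenberg_flat n E : Prop :=
  exists2 eps_max : R, 0 < eps_max &
    forall eps : R, 0 < eps <= eps_max -> ~ reifenberg_flat n eps E.

End SetsInEuclideanSpace.

(* [eps0] is an admissible choice of the smallness constant, as a function of
   C_M and C_P, in the parameterization theorem for n-dimensional sets in
   R^(n+d). *)
Definition parameterization_constant (R : realType) (n d : nat)
    (eps0 : R -> R -> R) : Prop :=
  (forall CM CP : R, 1 <= CM -> 0 < CP -> 0 < eps0 CM CP) /\
  exists (theta0 : R -> R) (K C0 : R -> R -> R),
    (forall lambda : R, 1 <= lambda -> 0 < theta0 lambda < 1) /\
    forall (M : set 'rV[R]_(n + d)) (CM CP lambda : R),
      1 <= CM -> 0 < CP -> 1 <= lambda ->
      parameterization_hypotheses n M CM CP lambda (eps0 CM CP) ->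
      exists (g : 'rV[R]_(n + d) -> 'rV[R]_(n + d))
             (p : 'rV[R]_(n + d)) (P : 'M[R]_(n + d)),
        let Sigma0 := affine_plane p P in
        [/\ \rank P = n,
            forall z, exists y, g y = z &
            forall y z, (K CM CP)^-1 * enorm (y - z) <= enorm (g y - g z)
                        <= K CM CP * enorm (y - z)] /\
        [/\ forall z, 2 <= dist_set z Sigma0 -> g z = z,
            forall z, enorm (g z - z) <= C0 CM CP * eps0 CM CP,
            reifenberg_flat n (C0 CM CP * eps0 CM CP) (g @` Sigma0) &
            M `&` eball 0 (theta0 lambda) `<=` g @` Sigma0].

(* Main.v *)
Require Import Defs.
From HB Require Import structures.
From mathcomp Require Import all_boot all_order all_algebra.
From mathcomp Require Import all_classical all_reals all_analysis.
From mathcomp Require Import measurable_realfun.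
From mathcomp Require Import ring lra.
Set Implicit Arguments.
Unset Strict Implicit.
Unset Printing Implicit Defensive.
Import Order.TTheory GRing.Theory Num.Theory.
Import numFieldNormedType.Exports.
Local Open Scope classical_set_scope.
Local Open Scope ring_scope.

(* The set is the flat closed unit disc M = D^n x {0}.

   Approximate tangent planes.  Blowing up at a point of the open disc gives the
   integral over R^n x {0}, so the approximate tangent space is the same plane at
   all interior points, and the bounding sphere is H^n-null.  Hence the Carleson
   integrand vanishes identically, and (c) holds for every positive constant.

   Poincare inequality.  In a ball cap K = M cap B_r(x), which is convex, the mean
   oscillation of f is bounded by the double average of |f(y) - f(x)|.  For fixed
   z, splitting [x, x+z] into k equal pieces and translating bounds the integral
   of |f(x+z) - f(x)| over {x in K : x+z in K} by the integral over K of the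
   difference quotient of step z/k; letting k tend to infinity, Rademacher's
   theorem turns it into |z| times the integral of |grad f|.

   Not Reifenberg flat.  At a boundary point only half of an approximating plane
   is close to M. *)

(** * Euclidean norm *)

(** Tangent planes and tangential gradients are selected by [xget], so neither can be taken to be
    the expected one: every other plane has to be excluded before (b) can be read in R^n, whereas
    (c) only needs the selection to be the same at all interior points. H^n is handled through
    covers. On R^n it serves as the volume, so that the isometric embedding transports integrals
    with factor 1. Of its normalisation only 0 < H^n(unit ball) < oo matters; for a cube the lower
    bound comes from counting grid points and the upper one from self-similarity. Rademacher's
    theorem rests on translation invariance: differentiability along lines, a discrete integration
    by parts for the additivity of directional derivatives, and approximation by integral
    directions, which leaves countably many null sets. Convexity of the caps gives (b) with lambda =
    1. Since (b) concerns every r > 0 while the disc bounds the caps, diameter and volume of a cap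
    are measured by min(r, 1); their comparison produces CP = 4 * 16^n. CM and CP depend on n only,
    hence are fixed before eps0 is evaluated at them. *)

Section EuclideanNorm.
Context {R : realType} {m : nat}.
Implicit Types (x y z u v : 'rV[R]_m) (c : R).

Lemma dotE u v : dot u v = \sum_j u 0 j * v 0 j.
Proof. by rewrite /dot mxE; apply: eq_bigr => j _; rewrite mxE. Qed.

Lemma enormE x : enorm x = Num.sqrt (\sum_j x 0 j ^+ 2).
Proof. by rewrite /enorm big_ord1. Qed.

Lemma enorm_ge0 x : 0 <= enorm x. Proof. exact: sqrtr_ge0. Qed.
Hint Resolve enorm_ge0 : core.

Lemma sqr_enorm x : enorm x ^+ 2 = \sum_j x 0 j ^+ 2.
Proof. by rewrite enormE sqr_sqrtr// sumr_ge0// => i _; exact: sqr_ge0. Qed.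

Lemma enorm0 : enorm (0 : 'rV[R]_m) = 0.
Proof. by rewrite enormE big1 ?sqrtr0// => j _; rewrite mxE expr0n. Qed.

Lemma enormZ c x : enorm (c *: x) = `|c| * enorm x.
Proof.
rewrite !enormE -sqrtr_sqr -sqrtrM ?sqr_ge0//; congr Num.sqrt.
by rewrite mulr_sumr; apply: eq_bigr => j _; rewrite mxE exprMn.
Qed.

Lemma enormN x : enorm (- x) = enorm x.
Proof. by rewrite -scaleN1r enormZ normrN1 mul1r. Qed.

Lemma enormB x y : enorm (x - y) = enorm (y - x).
Proof. by rewrite -enormN opprB. Qed.

Lemma enorm0_eq0 x : enorm x = 0 -> x = 0.
Proof.
move=> x0; have: \sum_j x 0 j ^+ 2 = 0 by rewrite -sqr_enorm x0 expr0n.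
move=> /psumr_eq0P h; apply/rowP => j; rewrite mxE.
by apply/eqP; rewrite -sqrf_eq0; apply/eqP/h => // i _; exact: sqr_ge0.
Qed.

Lemma coord_le_enorm x j : `|x 0 j| <= enorm x.
Proof.
rewrite enormE -sqrtr_sqr ler_wsqrtr// (bigD1 j)//= lerDl.
by rewrite sumr_ge0// => i _; exact: sqr_ge0.
Qed.

(** Cauchy-Schwarz, from the nonnegativity of |b x - (x . y) y|^2 with b = |y|^2. *)
Lemma dot_le x y : `|dot x y| <= enorm x * enorm y.
Proof.
rewrite -ler_sqr ?nnegrE ?mulr_ge0// exprMn !sqr_enorm real_normK ?num_real//.
have [y0|y0] := eqVneq (enorm y) 0.
  rewrite {1}(enorm0_eq0 y0) dotE big1 => [|j _]; last by rewrite mxE mulr0.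
  rewrite expr0n mulr_ge0 ?sumr_ge0//.
  - by move=> j _; exact: sqr_ge0.
  - by move=> j _; exact: sqr_ge0.
set a := \sum_j x 0 j ^+ 2; set b := \sum_j y 0 j ^+ 2.
have b0 : 0 < b by rewrite /b -sqr_enorm exprn_gt0// lt_neqAle eq_sym y0/=.
have : 0 <= \sum_j (b * x 0 j - dot x y * y 0 j) ^+ 2.
  by apply: sumr_ge0 => j _; exact: sqr_ge0.
have -> : \sum_j (b * x 0 j - dot x y * y 0 j) ^+ 2 = b * (a * b - dot x y ^+ 2).
  rewrite (eq_bigr (fun j => b ^+ 2 * x 0 j ^+ 2
     - 2 * b * dot x y * (x 0 j * y 0 j) + dot x y ^+ 2 * y 0 j ^+ 2)) => [|j _].
    rewrite big_split/= sumrB -!mulr_sumr -(dotE x y) -/a -/b; ring.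
  by ring.
by rewrite pmulr_rge0// subr_ge0.
Qed.

Lemma ler_enormD x y : enorm (x + y) <= enorm x + enorm y.
Proof.
rewrite -ler_sqr ?nnegrE ?addr_ge0// sqr_enorm sqrrD !sqr_enorm.
have -> : \sum_j (x + y) 0 j ^+ 2 =
    \sum_j x 0 j ^+ 2 + dot x y *+ 2 + \sum_j y 0 j ^+ 2.
  rewrite dotE -sumrMnl -!big_split/=; apply: eq_bigr => j _.
  by rewrite mxE; ring.
by rewrite lerD2r lerD2l lerMn2r/= (le_trans (ler_norm _) (dot_le _ _)).
Qed.

Lemma ler_enormB x y z : enorm (x - z) <= enorm (x - y) + enorm (y - z).
Proof. by rewrite (le_trans _ (ler_enormD _ _))// addrA subrK. Qed.

Lemma enorm_dist x y : `|enorm x - enorm y| <= enorm (x - y).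
Proof.
have h u v : enorm u <= enorm v + enorm (u - v).
  by rewrite (le_trans _ (ler_enormD _ _))// addrC subrK.
by rewrite ler_norml lerBlDl h andbT lerNl opprB lerBlDl enormB h.
Qed.

Lemma enorm_le_sum x : enorm x <= \sum_j `|x 0 j|.
Proof.
rewrite {1}(row_sum_delta x).
elim/big_ind2 : _ => [|a b c' d' ac bd|j _]; first by rewrite enorm0.
  exact: le_trans (ler_enormD _ _) (lerD _ _).
rewrite enormZ ler_piMr// enormE (bigD1 j)//= big1 => [|i ij].
  by rewrite mxE !eqxx expr1n addr0 sqrtr1.
by rewrite mxE (negPf ij) andbF expr0n.
Qed.

Lemma enorm_le_max x e : 0 <= e -> (forall j, `|x 0 j| <= e) -> enorm x <= m%:R * e.
Proof.
move=> e0 h; rewrite (le_trans (enorm_le_sum x))//.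
rewrite (le_trans (ler_sum _ (fun j _ => h j)))//.
by rewrite sumr_const card_ord mulr_natl.
Qed.

End EuclideanNorm.
#[global] Hint Resolve enorm_ge0 : core.

Section EuclideanTopology.
Context {R : realType} {m : nat}.
Implicit Types (x y z u v : 'rV[R]_m).

Lemma nbhs_eball x (r : R) : 0 < r -> nbhs x (eball x r).
Proof.
(* The Euclidean norm is at most m times the sup norm; dividing by m + 1 covers m = 0 and makes the
   final inequality strict. *)
move=> r0; apply/nbhs_ballP; exists (r / m.+1%:R); first by rewrite /= divr_gt0.
move=> y [_ xy]; rewrite /eball/=.
have h j : `|(y - x) 0 j| <= r / m.+1%:R.
  by have := xy 0 j; rewrite /ball/= distrC !mxE => /ltW.
have := enorm_le_max (divr_ge0 (ltW r0) (ler0n _ _)) h.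
move=> /le_lt_trans; apply.
by rewrite mulrC mulrAC ltr_pdivrMr// ltr_pM2l// ltr_nat.
Qed.

Lemma nbhs_eballP x (A : set 'rV[R]_m) :
  nbhs x A <-> exists2 r : R, 0 < r & eball x r `<=` A.
Proof.
split=> [/nbhs_ballP[r /= r0 rA]|[r r0 rA]]; last exact: filterS rA (nbhs_eball _ r0).
exists r => // y xy; apply: rA; split=> // i j; rewrite (ord1 i)/ball/= distrC.
by rewrite (le_lt_trans _ xy)//; have := coord_le_enorm (y - x) j; rewrite !mxE.
Qed.

Lemma open_eball x (r : R) : open (eball x r).
Proof.
rewrite openE => y; rewrite /eball/= => xy; apply/nbhs_eballP.
exists (r - enorm (y - x)); first by rewrite subr_gt0.
move=> z; rewrite /eball/= ltrBrDr => h.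
by rewrite (le_lt_trans (ler_enormB _ y _)).
Qed.

Lemma lipschitz_continuous (f : 'rV[R]_m -> R) (L : R) :
  (forall x y, `|f x - f y| <= L * enorm (x - y)) -> continuous f.
Proof.
move=> fL x; apply/(@cvgrPdist_lt _ _ _ _ (nbhs_filter x)) => e e0.
have L0 : 0 < `|L| + 1 by rewrite ltr_wpDl.
apply/nbhs_eballP; exists (e / (`|L| + 1)); first exact: divr_gt0.
move=> y; rewrite /eball/= => xy.
rewrite (le_lt_trans (fL _ _))// enormB.
rewrite (@le_lt_trans _ _ ((`|L| + 1) * enorm (y - x)))//.
  by rewrite ler_wpM2r ?enorm_ge0//; have := ler_norm L; lra.
by rewrite mulrC -ltr_pdivlMr.
Qed.

End EuclideanTopology.

(** * Hausdorff measure under Lipschitz maps *)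

Section EReal.
Context {R : realType}.
Local Open Scope ereal_scope.

(** Lets the two premeasures in [hausdorff_separated] be taken at different scales. When X is finite
    so are all the terms, and each can be subtracted in turn. *)
Lemma lee_add_ereal_sup (S S' : set (\bar R)) (X : \bar R) :
  S !=set0 -> S' !=set0 -> (forall x, S x -> 0 <= x) -> (forall y, S' y -> 0 <= y) ->
  (forall x y, S x -> S' y -> x + y <= X) -> ereal_sup S + ereal_sup S' <= X.
Proof.
move=> [x0 Sx0] [y0 Sy0] S0 S'0 h.
have [->|Xoo] := eqVneq X +oo; first exact: leey.
have Xfin : X \is a fin_num.
  have X0 : 0 <= X.
    apply: le_trans (h _ _ Sx0 Sy0).
    by apply: adde_ge0; [exact: S0|exact: S'0].
  by rewrite ge0_fin_numE// ltey.
have finS x : S x -> x \is a fin_num.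
  move=> Sx; rewrite ge0_fin_numE ?S0// (@le_lt_trans _ _ X) ?ltey_eq ?Xfin//.
  by rewrite (le_trans _ (h _ _ Sx Sy0))// leeDl// S'0.
have supS' x : S x -> ereal_sup S' <= X - x.
  by move=> Sx; apply: ge_ereal_sup => y Sy; rewrite leeBrDl ?finS// h.
have supS'fin : ereal_sup S' \is a fin_num.
  rewrite ge0_fin_numE; last exact: le_trans (S'0 _ Sy0) (ereal_sup_ubound Sy0).
  by rewrite (le_lt_trans (supS' _ Sx0))// ltey_eq fin_numB Xfin finS.
rewrite -leeBrDr//; apply: ge_ereal_sup => x Sx.
by rewrite leeBrDr// -leeBrDl ?finS// supS'.
Qed.

Lemma lee_expe2r (k : nat) (x y : \bar R) : 0 <= x -> x <= y -> x ^+ k <= y ^+ k.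
Proof.
move=> x0 xy; elim: k => [//|k IH]; rewrite !expeS.
by rewrite lee_pmul// expe_ge0.
Qed.

Lemma EFin_expe (k : nat) (c : R) : (c ^+ k)%:E = c%:E ^+ k.
Proof. by elim: k => [//|k IH]; rewrite expeS exprS EFinM IH. Qed.

Lemma expeMl (k : nat) (x y : \bar R) : (x * y) ^+ k = x ^+ k * y ^+ k.
Proof. by elim: k => [|k IH]; rewrite ?mule1// !expeS IH muleACA. Qed.

End EReal.

Section HausdorffMaps.
Context {R : realType}.
Local Open Scope ereal_scope.

Lemma enorm_le_ediam m (U : set 'rV[R]_m) x y :
  U x -> U y -> (enorm (x - y))%:E <= ediam U.
Proof. by move=> Ux Uy; apply: ereal_sup_ubound; left; exists x => //; exists y. Qed.

Lemma ediam_le m (U : set 'rV[R]_m) (D : \bar R) : 0 <= D ->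
  (forall x y, U x -> U y -> (enorm (x - y))%:E <= D) -> ediam U <= D.
Proof.
by move=> D0 h; apply: ge_ereal_sup => _ [[x Ux [y Uy <-]]|->//]; exact: h.
Qed.

Lemma hausdorff_delta_le_hausdorff m k delta (A : set 'rV[R]_m) : (0 < delta)%R ->
  hausdorff_delta k delta A <= hausdorff k A.
Proof. by move=> d0; apply: ereal_sup_ubound; exists delta. Qed.

Lemma hausdorff_delta_anti m k d1 d2 (A : set 'rV[R]_m) : (d1 <= d2)%R ->
  hausdorff_delta k d2 A <= hausdorff_delta k d1 A.
Proof.
move=> d12; apply: ereal_inf_le_tmp => _ [U [AU dU] <-]; exists U => //; split=> // j.
by rewrite (le_trans (dU j))// lee_fin.
Qed.

Section LipschitzImage.
Variables (p q k : nat) (A : set 'rV[R]_p) (f : 'rV[R]_p -> 'rV[R]_q) (c : R).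
Hypotheses (c0 : (0 < c)%R)
  (fc : forall x y, A x -> A y -> (enorm (f x - f y) <= c * enorm (x - y))%R).

(** Covering sets are cut down to A before being mapped, because the Lipschitz bound holds on A
    only. *)
Lemma ediam_image U : ediam (f @` (U `&` A)) <= c%:E * ediam U.
Proof.
apply: ediam_le; first by rewrite mule_ge0 ?ediam_ge0// lee_fin ltW.
move=> _ _ [x [Ux Ax] <-] [y [Uy Ay] <-].
rewrite (@le_trans _ _ (c * enorm (x - y))%:E)//; first by rewrite lee_fin fc.
by rewrite EFinM lee_pmul2l// enorm_le_ediam.
Qed.

Lemma hausdorff_gauge_image U :
  hausdorff_gauge k (f @` (U `&` A)) <= (c ^+ k)%:E * hausdorff_gauge k U.
Proof.
have g0 := hausdorff_gauge_ge0 k U.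
have ck0 : (0 <= c ^+ k)%R by rewrite exprn_ge0// ltW.
rewrite {1}/hausdorff_gauge; case: ifPn => [_|]; first by rewrite mule_ge0.
move=> /set0P[_ [x [Ux Ax] _]]; rewrite /hausdorff_gauge ifN; last first.
  by apply/set0P; exists x.
rewrite muleCA EFin_expe -expeMl lee_pmul//.
- by rewrite lee_fin divr_ge0 ?exprn_ge0// ltW// unit_ball_volume_gt0.
- by rewrite expe_ge0// ediam_ge0.
- by rewrite lee_expe2r ?ediam_ge0// ediam_image.
Qed.

Lemma hausdorff_delta_image delta : hausdorff_delta k (c * delta) (f @` A) <=
  (c ^+ k)%:E * hausdorff_delta k delta A.
Proof.
have ck0 : (0 < c ^+ k)%R by rewrite exprn_gt0.
rewrite -lee_pdivrMl//; apply: le_ereal_inf_tmp => _ [U [AU dU] <-].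
rewrite lee_pdivrMl// -nneseriesZl; last by move=> *; exact: hausdorff_gauge_ge0.
apply: (@le_trans _ _ (\sum_(j <oo) hausdorff_gauge k (f @` (U j `&` A)))); last first.
  apply: lee_nneseries => [j _ _|j _]; first exact: hausdorff_gauge_ge0.
  exact: hausdorff_gauge_image.
apply: ereal_inf_lbound; exists (fun j => f @` (U j `&` A)) => //; split.
  by move=> _ [x Ax <-]; have [j _ Ujx] := AU _ Ax; exists j => //; exists x.
move=> j; rewrite (le_trans (ediam_image _))// EFinM lee_pmul2l//.
Qed.

Lemma hausdorff_image : hausdorff k (f @` A) <= (c ^+ k)%:E * hausdorff k A.
Proof.
apply: ge_ereal_sup => _ [delta /= d0 <-].
rewrite -(divfK (lt0r_neq0 c0) delta) mulrC.
apply: (le_trans (hausdorff_delta_image _)).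
apply: lee_wpmul2l; first by rewrite lee_fin exprn_ge0// ltW.
by rewrite hausdorff_delta_le_hausdorff// divr_gt0.
Qed.

End LipschitzImage.

(** The reverse inequality is the Lipschitz bound for the inverse map, which makes sense on the
    range; [xget] extends it arbitrarily. *)
Lemma hausdorff_similarity p q k (f : 'rV[R]_p -> 'rV[R]_q) (c : R) :
  (0 < c)%R -> (forall x y, enorm (f x - f y) = c * enorm (x - y))%R ->
  forall A, hausdorff k (f @` A) = (c ^+ k)%:E * hausdorff k A.
Proof.
move=> c0 fc A; apply/eqP; rewrite eq_le; apply/andP; split.
  by apply: hausdorff_image => // x y _ _; rewrite fc.
have finj : injective f.
  move=> x y fxy; apply/eqP; rewrite -subr_eq0; apply/eqP/enorm0_eq0/eqP.
  by rewrite -(mulrI_eq0 _ (lregP (lt0r_neq0 c0))) -fc fxy subrr enorm0.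
have ck0 : (0 < c ^+ k)%R by rewrite exprn_gt0.
rewrite -lee_pdivlMl// -exprVn.
pose g y := xget (0%R : 'rV[R]_p) [set x | f x = y].
have gf x : g (f x) = x.
  rewrite /g; case: xgetP => [y _ /= /finj//|/(_ x) []//].
have {1}-> : A = g @` (f @` A).
  apply/seteqP; split=> [x Ax|_ [_ [x Ax <-] <-]]; last by rewrite gf.
  by exists (f x) => //; exists x.
apply: hausdorff_image; first by rewrite invr_gt0.
move=> _ _ [x Ax <-] [y Ay <-].
by rewrite !gf fc mulKf// lt0r_neq0.
Qed.

End HausdorffMaps.

(** * Measurability of Borel sets *)

Section MetricOuter.
Context {R : realType} {m : nat} (k : nat).
Local Open Scope ereal_scope.
Notation H := (@hausdorff R m k).

Lemma hausdorffU2 A B : H (A `|` B) <= H A + H B.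
Proof. exact: (outer_measureU2 (hausdorff_outer k)). Qed.

(** A covering set of diameter at most delta < e cannot meet both A and B, so a cover of the union
    splits into a cover of each, the other sets being replaced by the empty set. *)
Lemma hausdorff_delta_separated (e delta : R) (A B : set 'rV[R]_m) :
  (delta < e)%R -> (forall a b, A a -> B b -> (e <= enorm (a - b))%R) ->
  hausdorff_delta k delta A + hausdorff_delta k delta B <=
  hausdorff_delta k delta (A `|` B).
Proof.
move=> de AB; apply: le_ereal_inf_tmp => _ [U [ABU dU] <-].
pose V (C : set 'rV[R]_m) j := if U j `&` C == set0 then set0 else U j.
have VC C : C `<=` A `|` B ->
    hausdorff_delta k delta C <= \sum_(j <oo) hausdorff_gauge k (V C j).
  move=> CAB; apply: ereal_inf_lbound; exists (V C) => //; split.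
    move=> x Cx; have [j _ Ujx] := ABU _ (CAB _ Cx); exists j => //.
    rewrite /V ifN//; apply/set0P; by exists x.
  move=> j; rewrite /V; case: ifPn => // _; rewrite ediam0.
  by rewrite (le_trans (ediam_ge0 (U j))).
apply: (le_trans (leeD (VC A _) (VC B _))) => //.
rewrite -nneseriesD; try by move=> *; exact: hausdorff_gauge_ge0.
apply: lee_nneseries => [j _ _|j _].
  by rewrite adde_ge0 ?hausdorff_gauge_ge0.
rewrite /V; case: ifPn => [_|/set0P[x [Ux Ax]]].
  by rewrite hausdorff_gauge0 add0e; case: ifPn => //; rewrite hausdorff_gauge0 hausdorff_gauge_ge0.
rewrite ifT ?hausdorff_gauge0 ?adde0//; apply/negPn/negP => /set0P[y [Uy By]].
have := le_trans (enorm_le_ediam Ux Uy) (dU j).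
by rewrite lee_fin leNgt (lt_le_trans de)// AB.
Qed.

Lemma hausdorff_separated (e : R) (A B : set 'rV[R]_m) : (0 < e)%R ->
  (forall a b, A a -> B b -> (e <= enorm (a - b))%R) ->
  H A + H B <= H (A `|` B).
Proof.
move=> e0 AB; apply: lee_add_ereal_sup.
- by exists (hausdorff_delta k 1 A); exists 1%R => //=.
- by exists (hausdorff_delta k 1 B); exists 1%R => //=.
- by move=> _ [d _ <-]; exact: hausdorff_delta_ge0.
- by move=> _ [d _ <-]; exact: hausdorff_delta_ge0.
move=> _ _ [d1 /= d10 <-] [d2 /= d20 <-].
pose d := (Num.min (Num.min d1 d2) (e / 2))%R.
have d0 : (0 < d)%R by rewrite !lt_min d10 d20 divr_gt0.
apply: le_trans (hausdorff_delta_le_hausdorff _ _ d0).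
have de : (d < e)%R.
  by rewrite (@le_lt_trans _ _ (e / 2)%R) ?ge_min ?lexx ?orbT//; lra.
apply: le_trans (hausdorff_delta_separated de AB).
by apply: leeD; apply: hausdorff_delta_anti; rewrite /d !ge_min lexx ?orbT.
Qed.

End MetricOuter.

Section LipschitzMeasurable.
Context {R : realType} {m : nat} (k : nat).
Local Open Scope ereal_scope.
Notation H := (@hausdorff R m k).
Variable (g : 'rV[R]_m -> R).
Hypothesis g1 : forall x y, (`|g x - g y| <= enorm (x - y))%R.

Let a (i : nat) : R := i.+1%:R^-1%R.
Let a_lt i : (a i.+1 < a i)%R.
Proof. by rewrite /a ltf_pV2 ?posrE ?ltr0n// ltr_nat. Qed.

(** As g is 1-Lipschitz, the gap between the levels s and t keeps A and B at distance at least t -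
    s. *)
Lemma hausdorff_level_split (X A B : set 'rV[R]_m) (s t : R) : (s < t)%R ->
  A `<=` X -> B `<=` X -> (forall x, A x -> g x <= s)%R -> (forall x, B x -> t <= g x)%R ->
  H A + H B <= H X.
Proof.
move=> st AX BX As Bt.
apply: (@le_trans _ _ (H (A `|` B))).
  apply: (@hausdorff_separated _ _ _ (t - s)%R); first by rewrite subr_gt0.
  move=> x y /As xs /Bt yt; apply: le_trans (g1 _ _).
  by rewrite distrC (le_trans _ (ler_norm _))// lerB.
by apply: le_hausdorff => x [/AX|/BX].
Qed.

(* Caratheodory's criterion: the rings a_(i+1) < g <= a_i of the same parity are at
   positive distance from each other, so the series of their measures converges
   and the part of X with 0 < g <= a_N contributes little. *)
Lemma caratheodory_le0 : (hausdorff_outer k).-caratheodory [set x | g x <= 0]%R.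
Proof.
apply: le_caratheodory_measurable => X; rewrite /hausdorff_outer/=.
set C := [set x | g x <= 0]%R.
have [->|Xoo] := eqVneq (H X) +oo; first exact: leey.
have Xfin : H X \is a fin_num by rewrite ge0_fin_numE ?hausdorff_ge0// ltey.
pose S i := X `&` [set x | a i < g x]%R.
pose ring i := X `&` [set x | a i.+1 < g x <= a i]%R.
(* The bit b selects the parity. The ring added by the induction is separated from the superlevel
   set S (2 N + b) by the skipped ring of index 2 N + b. *)
have Hring b N : \sum_(0 <= i < N) H (ring (i.*2.+1 + b)%N) <= H (S (N.*2 + b)%N).
  elim: N => [|N IH]; first by rewrite big_nil hausdorff_ge0.
  rewrite big_nat_recr//=; apply: (le_trans (leeD IH (lexx _))).
  rewrite addeC doubleS.
  apply: (@hausdorff_level_split _ _ _ _ _ (a_lt (N.*2 + b)%N)).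
  - by move=> x [Xx /andP[+ _]]; rewrite !addSn.
  - move=> x [Xx]; rewrite /= => h; split => //=; rewrite !addSn.
    exact: lt_trans (lt_trans (a_lt _) (a_lt _)) h.
  - by move=> x [_ /andP[_]]; rewrite addSn.
  - by move=> x [_ /ltW].
have Hrings N : \sum_(0 <= i < N) H (ring i.+1) <= H X + H X.
  have SX i : H (S i) <= H X by apply: le_hausdorff => x [].
  apply: (@le_trans _ _ (\sum_(0 <= i < N.*2) H (ring i.+1))).
    apply: lee_sum_nneg_natr; last by rewrite -addnn leq_addl.
    by move=> *; exact: hausdorff_ge0.
  apply: (@le_trans _ _ (\sum_(0 <= i < N) H (ring (i.*2.+1 + 0)%N) +
      \sum_(0 <= i < N) H (ring (i.*2.+1 + 1)%N))); last first.
    by apply: leeD; apply: (le_trans (Hring _ _)).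
  rewrite le_eqVlt; apply/orP; left; apply/eqP.
  elim: N => [|N IH]; first by rewrite !big_nil adde0.
  rewrite doubleS !big_nat_recr//= IH !addn0 !addn1 -!addeA; congr (_ + _).
  by rewrite addeCA.
have tail0 : \sum_(N <= i <oo) H (ring i.+1) @[N --> \oo] --> 0.
  apply: nneseries_tail_cvg; last by move=> *; exact: hausdorff_ge0.
  apply: (@le_lt_trans _ _ (H X + H X)); last by rewrite ltey_eq fin_numD Xfin.
  apply: lime_le; first by apply: is_cvg_nneseries => *; exact: hausdorff_ge0.
  by apply: nearW => N; exact: Hrings.
apply/lee_addgt0Pr => e e0.
have [N _ /(_ _ (leqnn N)) tailN] :
    \forall N \near \oo, \sum_(N <= i <oo) H (ring i.+1) < e%:E.
  by apply: (tail0 [set u | u < e%:E]); apply: open_ereal_lt'; rewrite lte_fin.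
have TS : X `&` ~` C `<=` S N.+1 `|` \bigcup_(i in ~` `I_N) ring i.+1.
  move=> x [Xx /negP]; rewrite -ltNge => gx0.
  have [gxN|gxN] := ltP (a N.+1) (g x); [by left|right].
  have gx : exists i, (a i < g x)%R.
    by have [i] := ltr_add_invr gx0; rewrite add0r; exists i.
  (* With i0 least, x lies in the ring of index i0 - 1; as the union is over [ring i.+1], the
     witness is i0 - 2. *)
  case: (ex_minnP gx) => i0 Hi0 mini0.
  have a_le i j : (i <= j)%N -> (a j <= a i)%R.
    by move=> ij; rewrite /a lef_pV2 ?posrE ?ltr0n// ler_nat.
  have i0N : (N.+1 < i0)%N.
    by rewrite ltnNge; apply/negP => /a_le; rewrite leNgt (lt_le_trans Hi0).
  case: i0 => [//|[//|i]] in Hi0 mini0 i0N *.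
  exists i => /=; first by apply/negP; rewrite -leqNgt.
  split => //=; rewrite Hi0/= leNgt; apply/negP => /mini0.
  by rewrite ltnn.
rewrite (le_trans (leeD (lexx _) (le_hausdorff _ TS)))//.
rewrite (le_trans (leeD (lexx _) (hausdorffU2 _ _ _)))//.
rewrite addeA leeD//.
  apply: (@hausdorff_level_split _ _ _ 0%R (a N.+1)).
  - by rewrite /a invr_gt0.
  - by move=> x [].
  - by move=> x [].
  - by move=> x [_].
  - by move=> x [_ /ltW].
rewrite (le_trans _ (ltW tailN))//.
exact: (outer_measure_sigma_subadditive_tail (hausdorff_outer k)).
Qed.
End LipschitzMeasurable.

Section CoordMeasurable.
Context {R : realType} {m : nat}.

Lemma measurable_lipschitz1 k (g : 'rV[R]_m -> R) :
  (forall x y, `|g x - g y| <= enorm (x - y)) ->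
  measurable_fun setT (g : caratheodory_type (@hausdorff_outer R m k) -> R).
Proof.
move=> g1 _; apply: (measurability _ (RGenOInfty.measurableE R)) => //.
move=> _ [_ [c ->] <-]; rewrite setTI.
have -> : g @^-1` `]c, +oo[ = ~` [set x | g x - c <= 0].
  by apply/seteqP; split=> x /=; rewrite in_itv/= andbT subr_le0 ltNge => /negP.
apply: measurableC; apply: caratheodory_le0 => x y.
by rewrite opprB addrA subrK.
Qed.

Lemma measurable_coord k i :
  measurable_fun setT (fun x : caratheodory_type (@hausdorff_outer R m k) => x 0 i : R).
Proof.
apply: measurable_lipschitz1 => x y.
by have := coord_le_enorm (x - y) i; rewrite !mxE.
Qed.

(** An open set is a countable union of cubes with rational centres, so measurable coordinates
    suffice. The source is arbitrary in order to include product spaces and maps such as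
    addition. *)
Lemma measurable_preimage_open d (S : measurableType d) (psi : S -> 'rV[R]_m)
    (U : set 'rV[R]_m) :
  (forall i, measurable_fun setT (fun s => psi s 0 i)) -> open U ->
  measurable (psi @^-1` U).
Proof.
move=> mpsi oU.
pose box (p : 'rV[rat]_m * nat) : set 'rV[R]_m :=
  [set y | forall i, `|y 0 i - ratr (p.1 0 i)| < p.2.+1%:R^-1].
have -> : psi @^-1` U = \bigcup_(p in [set p | box p `<=` U]) (psi @^-1` box p).
  rewrite -preimage_bigcup; congr (_ @^-1` _); apply/seteqP; split; last first.
    by move=> x [p pU] /pU.
  move=> x Ux.
  have /nbhs_ballP[e /= e0 eU] : nbhs x U by apply: open_nbhs_nbhs.
  have [N] := ltr_add_invr (divr_gt0 e0 (ltr0n R 2)); rewrite add0r => Ne.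
  have q_ex i : exists q : rat, `|x 0 i - ratr q| < N.+1%:R^-1.
    have : x 0 i - N.+1%:R^-1 < x 0 i + N.+1%:R^-1.
      by rewrite ltrD2l gtrN// invr_gt0.
    move=> /rat_in_itvoo[q]; rewrite in_itv/= => /andP[q1 q2]; exists q.
    by rewrite distrC ltr_distl q1 q2.
  pose q : 'rV[rat]_m := \row_i projT1 (cid (q_ex i)).
  have xq i : `|x 0 i - ratr (q 0 i)| < N.+1%:R^-1 by rewrite mxE; case: cid.
  exists (q, N) => // y yq; apply: eU; split => // i j; rewrite (ord1 i) /ball/=.
  rewrite (le_lt_trans (ler_distD (ratr (q 0 j)) _ _))//.
  rewrite (splitr e) ltrD//; apply: lt_trans Ne; first exact: xq.
  by rewrite distrC; exact: yq.
rewrite bigcup_mkcond.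
apply: countable_bigcupT_measurable => [|p]; first exact: countableP.
case: ifPn => // _.
have -> : psi @^-1` box p = \bigcap_(i in [set: 'I_m])
    [set s | `|psi s 0 i - ratr (p.1 0 i)| < p.2.+1%:R^-1].
  by apply/seteqP; split=> s /= h i *; exact: h.
apply: fin_bigcap_measurable => // i _.
rewrite -[X in measurable X]setTI.
have : measurable_fun setT (fun s => `|psi s 0 i - ratr (p.1 0 i)|).
  apply: measurableT_comp => //; apply: measurable_funB => //; exact: mpsi.
move=> /(_ measurableT `]-oo, p.2.+1%:R^-1[%classic (measurable_itv _)).
by rewrite (_ : _ @^-1` _ = [set s | `|psi s 0 i - ratr (p.1 0 i)| < p.2.+1%:R^-1])//;
  apply/seteqP; split=> s /=; rewrite in_itv.
Qed.

Lemma measurable_continuous_comp d (S : measurableType d) (psi : S -> 'rV[R]_m)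
    (f : 'rV[R]_m -> R) :
  (forall i, measurable_fun setT (fun s => psi s 0 i)) -> continuous f ->
  measurable_fun setT (f \o psi).
Proof.
move=> mpsi /continuousP cf _; apply: (measurability _ (RGenOInfty.measurableE R)) => //.
move=> _ [_ [c ->] <-]; rewrite setTI comp_preimage.
apply: measurable_preimage_open => //; apply: cf; exact: rray_open.
Qed.

Lemma measurable_open k (U : set 'rV[R]_m) : open U ->
  measurable (U : set (caratheodory_type (@hausdorff_outer R m k))).
Proof.
exact: (@measurable_preimage_open _ (caratheodory_type (@hausdorff_outer R m k)) id U
  (@measurable_coord k)).
Qed.

Lemma measurable_closed k (U : set 'rV[R]_m) : closed U ->
  measurable (U : set (caratheodory_type (@hausdorff_outer R m k))).
Proof.
by move=> cU; rewrite -[U]setCK; apply/measurableC/measurable_open; exact: closed_openC.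
Qed.

Lemma measurable_continuous k (f : 'rV[R]_m -> R) : continuous f ->
  measurable_fun setT (f : caratheodory_type (@hausdorff_outer R m k) -> R).
Proof.
exact: (@measurable_continuous_comp _ (caratheodory_type (@hausdorff_outer R m k)) id f
  (@measurable_coord k)).
Qed.

End CoordMeasurable.

(** * Hausdorff measure of cubes and balls *)

(** The extreme indices i0 <= i1 of the set satisfy i1 - i0 <= 2 r N. *)
Lemma card_near_leq (R : realType) N (a r : R) : 0 < r ->
  (#|[set j : 'I_N | `|j%:R / N%:R - a| < r]%SET|%:R <= 2 * r * N%:R + 1 :> R).
Proof.
move=> r0; set B := [set j | _]%SET.
have [->|[j0 Bj0]] := set_0Vmem B.
  by rewrite cards0 addr_ge0// !mulr_ge0// ltW.
have [i0 Bi0 mini0] := @arg_minnP _ j0 [in B] val Bj0.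
have [i1 Bi1 maxi1] := @arg_maxnP _ j0 [in B] val Bj0.
have N0 : 0 < N%:R :> R by rewrite ltr0n (leq_ltn_trans _ (ltn_ord j0)).
have cB : (#|B| <= i1.+1 - i0)%N.
  rewrite cardE -(size_map val) -(size_iota i0 (i1.+1 - i0)).
  apply: uniq_leq_size; first by rewrite (map_inj_uniq val_inj) enum_uniq.
  move=> _ /mapP[j + ->]; rewrite mem_enum => Bj.
  rewrite mem_iota subnKC; first by rewrite mini0//= ltnS; exact: maxi1.
  by rewrite ltnW// ltnS; apply: mini0.
have i01 : (i0 <= i1)%N by exact: mini0.
rewrite (@le_trans _ _ (i1.+1 - i0)%:R)// ?ler_nat//.
rewrite subSn// -natr1 lerD2r natrB// -ler_pdivrMr// mulrBl.
move: Bi0 Bi1; rewrite !inE !ltr_distl => /andP[? ?] /andP[? ?]; lra.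
Qed.

Section CubeCover.
Variables (R : realType) (n' : nat).
Let n := n'.+1.

(* Each box of half-side r k contains at most a proportion (3 r k)^n of the points
   of a fine enough grid of mesh 1/N. *)
Lemma cube_cover_count (D : seq nat) (x : nat -> 'rV[R]_n) (r : nat -> R) :
  (forall k, 0 < r k) ->
  (forall u : 'rV[R]_n, (forall i, 0 <= u 0 i <= 1) ->
     exists2 k, k \in D & forall i, `|u 0 i - x k 0 i| < r k) ->
  1 <= \sum_(k <- D) (3 * r k) ^+ n.
Proof.
move=> r0 cov.
(* A mesh finer than every r k turns the count 2 r M + 1 of grid points per coordinate into at most
   3 r M. *)
have [N rN] : exists N : nat, forall k, k \in D -> N.+1%:R^-1 < r k.
  elim: D {cov} => [|k D [N IH]]; first by exists 0%N.
  have [M] := ltr_add_invr (r0 k); rewrite add0r => Mk.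
  exists (maxn N M) => l; rewrite inE => /orP[/eqP->|/IH h].
    by apply: le_lt_trans Mk; rewrite lef_pV2 ?posrE// ler_nat ltnS leq_maxr.
  by apply: le_lt_trans h; rewrite lef_pV2 ?posrE// ler_nat ltnS leq_maxl.
set M := N.+1 in rN.
pose Ai k i := [set j : 'I_M | `|j%:R / M%:R - x k 0 i| < r k]%SET.
have M0 : 0 < M%:R :> R by rewrite ltr0n.
have cnt : (M ^ n <= \sum_(k <- D) #|family (Ai k)|)%N.
  have -> : (M ^ n = \sum_(g : {ffun 'I_n -> 'I_M}) 1)%N.
    by rewrite sum1_card card_ffun !card_ord.
  have -> : (\sum_(k <- D) #|family (Ai k)| =
      \sum_(g : {ffun 'I_n -> 'I_M}) \sum_(k <- D) (g \in family (Ai k)))%N.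
    rewrite exchange_big/=; apply: eq_bigr => k _.
    by rewrite -sum1_card [RHS]big_mkcond/= big_mkcond/=; apply: eq_bigr => g _; case: ifP.
  apply: leq_sum => g _.
  have [i|k kD gk] := cov (\row_i ((g i)%:R / M%:R)).
    by rewrite mxE divr_ge0//= ler_pdivrMr// mul1r ler_nat ltnW.
  rewrite (big_rem k)//= (_ : g \in _); first by [].
  by apply/familyP => i; rewrite inE; have := gk i; rewrite mxE.
rewrite -(@ler_pM2r _ (M%:R ^+ n)) ?exprn_gt0// mul1r -natrX.
apply: le_trans (_ : (\sum_(k <- D) #|family (Ai k)|)%:R <= _); first by rewrite ler_nat.
rewrite natr_sum mulr_suml big_seq [leRHS]big_seq; apply: ler_sum => k kD.
rewrite natrX -exprMn card_family foldrE big_map big_enum/= natr_prod.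
apply: le_trans (_ : \prod_(i < n) (3 * r k * M%:R) <= _); last first.
  by rewrite prodr_const card_ord.
apply: ler_prod => i _; rewrite ler0n/=.
apply: le_trans (card_near_leq _ _ (r0 k)) _.
have := rN _ kD; rewrite -[_^-1]mul1r ltr_pdivrMr//; lra.
Qed.

End CubeCover.

Section CubeMeasure.
Context {R : realType}.

Definition unit_cube n : set 'rV[R]_n := [set u | forall i, 0 <= u 0 i <= 1].
Arguments unit_cube n _ : clear implicits.

Lemma compact_unit_cube n : compact (unit_cube n).
Proof.
have := @rV_compact R n (fun=> `[0, 1]%classic) (fun=> @segment_compact R 0 1).
by congr compact; apply/seteqP; split=> u /= h i; have := h i; rewrite in_itv.
Qed.

Lemma sum_half_pow K : \sum_(0 <= k < K) (2 ^+ k.+1)^-1 <= 1 :> R.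
Proof.
suff -> : \sum_(0 <= k < K) (2 ^+ k.+1)^-1 = 1 - (2 ^+ K)^-1 :> R.
  by rewrite gerBl invr_ge0 exprn_ge0.
elim: K => [|K IH]; first by rewrite big_nil expr0 invr1 subrr.
by rewrite big_nat_recr//= IH exprS invfM; field; rewrite expf_neq0.
Qed.

(** Each set of a cover is enlarged to an open ball; compactness leaves finitely many of them and
    the grid count applies. The radius is twice the diameter, whence the factor 6^n = (3 * 2)^n, or
    the small number [eta k] when that is larger. The premeasure at scale 1 is enough and makes all
    diameters finite. *)
Lemma hausdorff_unit_cube_gt0 n' : (0 < hausdorff n'.+1 (unit_cube n'.+1))%E.
Proof.
set n := n'.+1; pose v : R := unit_ball_volume R n / 2 ^+ n.
have v0 : 0 < v by rewrite divr_gt0 ?exprn_gt0// unit_ball_volume_gt0.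
have c0 : 0 < v / (2 * 6 ^+ n) by rewrite divr_gt0// mulr_gt0// exprn_gt0.
apply: (@lt_le_trans _ _ (v / (2 * 6 ^+ n))%:E); first by rewrite lte_fin.
apply: (le_trans _ (hausdorff_delta_le_hausdorff _ _ (ltr01))).
apply: le_ereal_inf_tmp => _ [U [QU dU] <-].
pose d k := fine (ediam (U k)).
have dE k : ediam (U k) = (d k)%:E.
  by rewrite fineK// ge0_fin_numE ?ediam_ge0// (le_lt_trans (dU k))// ltry.
have d0 k : 0 <= d k by rewrite -lee_fin -dE ediam_ge0.
(* Chosen so that (3 eta k)^n <= 3^n eta k = 2^-(k+1) / 2: these terms add up to at most 1/2, half
   of the lower bound 1 of the grid count. *)
pose eta k : R := (2 * 3 ^+ n * 2 ^+ k.+1)^-1.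
have eta0 k : 0 < eta k by rewrite invr_gt0 !mulr_gt0// exprn_gt0.
have eta1 k : eta k <= 1.
  rewrite invf_le1 ?mulr_gt0 ?exprn_gt0// !mulr_ege1 ?exprn_ege1//; lra.
pose r k := Num.max (2 * d k) (eta k).
have r0 k : 0 < r k by rewrite lt_max eta0 orbT.
pose x k := xget (0 : 'rV[R]_n) (U k).
pose f k := eball (x k) (r k).
have Uf k : U k `<=` f k.
  move=> u Uu; have Ux : U k (x k) by rewrite /x; case: xgetP => // /(_ u).
  have := enorm_le_ediam Uu Ux; rewrite dE lee_fin => h.
  apply: (le_lt_trans h); rewrite lt_max.
  have [->|dk] := eqVneq (d k) 0; first by rewrite eta0 orbT.
  by rewrite ltr_pMl ?ltr1n// lt_neqAle eq_sym dk d0.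
have [D' _ QD] : finite_subset_cover [set: nat] f (unit_cube n).
  have := @compact_unit_cube n; rewrite compact_cover; apply => //.
    by move=> k _; exact: open_eball.
  by move=> u /QU[k _ /Uf fu]; exists k.
pose K := (\max_(k <- finmap.enum_fset D') k).+1.
have /(cube_cover_count r0) : forall u : 'rV[R]_n, (forall i, 0 <= u 0 i <= 1) ->
     exists2 k, k \in iota 0 K & forall i, `|u 0 i - x k 0 i| < r k.
  move=> u /QD[k kD fu]; exists k.
    by rewrite mem_iota leq0n add0n ltnS; exact: leq_bigmax_seq.
  by move=> i; apply: le_lt_trans fu; have := coord_le_enorm (u - x k) i; rewrite !mxE.
move=> cnt; have rn k : (3 * r k) ^+ n <= 6 ^+ n * d k ^+ n + (2 ^+ k.+1)^-1 / 2.
  have [rE|rE] : r k = 2 * d k \/ r k = eta k.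
    by rewrite /r /Num.max; case: ifP; [right|left].
  - by rewrite rE mulrA exprMn (_ : 3 * 2 = 6) ?lerDl ?divr_ge0 ?invr_ge0 ?exprn_ge0//; lra.
  - rewrite rE exprMn -[leLHS]add0r lerD// ?mulr_ge0 ?exprn_ge0//.
    apply: (@le_trans _ _ (3 ^+ n * eta k)).
      rewrite ler_wpM2l ?exprn_ge0// -[leRHS]expr1 ler_wiXn2l//; exact: ltW.
    by rewrite /eta le_eqVlt; apply/orP; left; apply/eqP; field; rewrite !expf_neq0.
have dsum : 1 / 2 <= 6 ^+ n * \sum_(0 <= k < K) d k ^+ n.
  have := le_trans cnt (ler_sum _ (fun k _ => rn k)).
  rewrite big_split/= -mulr_suml -mulr_sumr.
  have := sum_half_pow K; rewrite /index_iota subn0; lra.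
apply: (@le_trans _ _ (\sum_(0 <= k < K) (v * d k ^+ n)%:E)%E); last first.
  apply: le_trans (nneseries_lim_ge K _); last by move=> *; exact: hausdorff_gauge_ge0.
  apply: lee_sum => k _; rewrite /hausdorff_gauge; case: ifPn => [/eqP Uk0|_].
    suff -> : d k = 0 by rewrite expr0n/= mulr0.
    by rewrite /d Uk0 ediam0.
  by rewrite dE -EFin_expe.
rewrite sumEFin lee_fin -mulr_sumr ler_wpM2l ?(ltW v0)//.
by rewrite invfM -[2^-1]mul1r ler_pdivrMr ?exprn_gt0// [leRHS]mulrC.
Qed.

End CubeMeasure.
Arguments unit_cube {R} n _.

Section CubeFinite.
Context {R : realType}.
Local Open Scope ereal_scope.

(** The premeasure at a fixed scale is itself an outer measure, and is packed as one to inherit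
    subadditivity for two sets. *)
Lemma hausdorff_delta_fin_subadditive m k (delta : R) (I : finType)
    (F : I -> set 'rV[R]_m) : (0 < delta)%R ->
  hausdorff_delta k delta (\big[setU/set0]_i F i) <= \sum_i hausdorff_delta k delta (F i).
Proof.
move=> d0.
pose mu : {outer_measure set 'rV[R]_m -> \bar R} :=
  HB.pack_for {outer_measure set 'rV[R]_m -> \bar R} (hausdorff_delta k delta)
  (isOuterMeasure.Build R 'rV[R]_m (hausdorff_delta k delta)
    (hausdorff_delta0 k d0) (hausdorff_delta_ge0 k delta)
    (@le_hausdorff_delta _ _ k delta) (@hausdorff_delta_sigma_subadditive _ _ k delta)).
apply: (big_ind2 (fun A x => mu A <= x)) => [|A x B y Ax By|//].
- by rewrite outer_measure0.
- by apply: le_trans (outer_measureU2 mu A B) _; exact: leeD.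
Qed.

Lemma unit_cube_halves n :
  unit_cube n `<=` \big[setU/set0]_(b : {ffun 'I_n -> bool})
    ((fun u => 2^-1 *: (u + \row_i (b i)%:R) : 'rV[R]_n)%R @` unit_cube n).
Proof.
move=> u Qu; pose b := [ffun i => (2^-1 < u 0 i)%R].
rewrite (bigD1 b)//=; left.
exists (2 *: u - \row_i (b i)%:R)%R; last by rewrite subrK scalerA mulVf ?scale1r.
move=> i; rewrite !mxE ffunE; have := Qu i.
by case: ltP => h /andP[? ?]; apply/andP; split; rewrite /=; lra.
Qed.

(* The cube is covered by 2^n copies of itself scaled by 1/2, and this scaling
   multiplies the n-dimensional premeasure by 2^-n. *)
Lemma hausdorff_delta_cube_double n delta : (0 < delta)%R ->
  hausdorff_delta n delta (@unit_cube R n) <= hausdorff_delta n (2 * delta) (@unit_cube R n).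
Proof.
move=> d0.
apply: (le_trans (le_hausdorff_delta _ _ (@unit_cube_halves n))).
apply: (le_trans (hausdorff_delta_fin_subadditive _ _ d0)).
apply: (@le_trans _ _ (\sum_(b : {ffun 'I_n -> bool})
   ((2^-1) ^+ n)%:E * hausdorff_delta n (2 * delta) (@unit_cube R n))).
  apply: lee_sum => b _; rewrite -{1}(mulKf (@lt0r_neq0 _ 2%R (ltr0n R 2)) delta).
  apply: hausdorff_delta_image; first by rewrite invr_gt0.
  move=> x y _ _; rewrite -scalerBr enormZ ger0_norm ?invr_ge0//.
  by rewrite opprD addrACA subrr addr0.
rewrite -ge0_sume_distrl => [|b _]; last by rewrite lee_fin exprn_ge0// invr_ge0.
rewrite sumEFin sumr_const card_ffun card_bool card_ord -[X in X%:E]mulr_natl natrX.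
by rewrite exprVn mulfV ?expf_neq0// mul1e.
Qed.

(** By iterated doubling the premeasure at any scale is at most the one at a scale 2^j delta >= n,
    where the cube is a cover of itself. *)
Lemma hausdorff_unit_cube_lty n : hausdorff n (@unit_cube R n) < +oo.
Proof.
have diamQ : ediam (@unit_cube R n) <= n%:R%:E.
  apply: ediam_le => // x y Qx Qy; rewrite lee_fin -[leRHS]mulr1.
  apply: enorm_le_max => // j; rewrite !mxE ler_norml.
  by have := Qx j; have := Qy j; lra.
have gQ : hausdorff_gauge n (@unit_cube R n) < +oo.
  rewrite /hausdorff_gauge; case: ifP => // _.
  apply: lte_mul_pinfty => //; first by rewrite lee_fin divr_ge0 ?exprn_ge0// ltW// unit_ball_volume_gt0.
  apply: le_lt_trans (lee_expe2r _ (ediam_ge0 _) diamQ) _.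
  by rewrite -EFin_expe ltry.
apply: le_lt_trans gQ; apply: ge_ereal_sup => _ [delta /= d0 <-].
have h j : hausdorff_delta n delta (@unit_cube R n) <=
    hausdorff_delta n (2 ^+ j * delta) (@unit_cube R n).
  elim: j => [|j IH]; first by rewrite expr0 mul1r.
  apply: (le_trans IH); rewrite exprS -mulrA.
  by apply: hausdorff_delta_cube_double; rewrite mulr_gt0 ?exprn_gt0.
have [j nj] : exists j, (n%:R <= 2 ^+ j * delta)%R.
  exists (Num.truncn (n%:R / delta)).+1; rewrite -ler_pdivrMr//.
  apply: (le_trans (ltW (truncnS_gt _))); rewrite -natrX ler_nat ltnW// ltn_expl//.
apply: (le_trans (h j)); apply: ereal_inf_lbound.
exists (fun i => if i == 0%N then @unit_cube R n else set0).
  split; first by move=> u Qu; exists 0%N.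
  move=> i; case: ifP => _; last by rewrite ediam0 lee_fin mulr_ge0 ?exprn_ge0// ltW.
  by rewrite (le_trans diamQ)// lee_fin.
rewrite (@nneseries_split _ _ 0 1); last by move=> *; exact: hausdorff_gauge_ge0.
rewrite big_nat1 /= eseries0 ?adde0// => i + _.
by case: i => // i _; rewrite hausdorff_gauge0.
Qed.
End CubeFinite.

(** * Change of variables under similarities *)

Section Similarity.
Context {R : realType} {p q k : nat} (phi : 'rV[R]_p -> 'rV[R]_q) (c : R).
Hypotheses (c0 : 0 < c) (phiE : forall x y, enorm (phi x - phi y) = c * enorm (x - y)).
Notation Tp := (caratheodory_type (@hausdorff_outer R p k)).
Notation Tq := (caratheodory_type (@hausdorff_outer R q k)).
Notation Hp := (@hausdorff_measure R p k).
Notation Hq := (@hausdorff_measure R q k).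
Local Open Scope ereal_scope.

Let ck0 : (0 < c ^+ k)%R. Proof. by rewrite exprn_gt0. Qed.

(** Up to the factor c^k, Caratheodory's criterion for the preimage of B tested on X is the
    criterion for B tested on the image of X. *)
Lemma measurable_similarity : measurable_fun setT (phi : Tp -> Tq).
Proof.
move=> _ B mB; rewrite setTI; apply: le_caratheodory_measurable => X.
rewrite /hausdorff_outer/= -(@lee_pmul2l _ (c ^+ k)%:E)// muleDr//; last first.
  by rewrite ge0_adde_def// inE hausdorff_ge0.
rewrite -!(hausdorff_similarity k c0 phiE).
have := mB (phi @` X); rewrite /hausdorff_outer/= => ->.
apply: leeD; apply: le_hausdorff.
- by move=> _ [x [Xx Bx] <-]; split => //; exists x.
- by move=> _ [x [Xx Bx] <-]; split => //; exists x.
Qed.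

Lemma hausdorff_preimage (B : set 'rV[R]_q) : B `<=` range phi ->
  hausdorff k B = (c ^+ k)%:E * hausdorff k (phi @^-1` B).
Proof.
move=> Bphi; rewrite -(hausdorff_similarity k c0 phiE); congr hausdorff.
apply/seteqP; split=> [y By|_ [x Bx <-]//].
by have [x _ xy] := Bphi _ By; exists x => //=; rewrite xy.
Qed.

(** On subsets of the range, H^k is c^k times the pushforward of H^k under phi. *)
Lemma ge0_integral_similarity (D : set Tq) (F : Tq -> \bar R) :
  measurable D -> D `<=` range phi -> measurable_fun D F ->
  (forall y, D y -> 0 <= F y) ->
  \int[Hq]_(y in D) F y = (c ^+ k)%:E * \int[Hp]_(x in phi @^-1` D) F (phi x).
Proof.
move=> mD Dphi mF F0.
pose psi : Tp -> Tq := phi.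
have mpsi : measurable_fun setT psi := measurable_similarity.
pose t : {nonneg R} := NngNum (ltW ck0).
have F0' : {in D, forall y, 0 <= F y} by move=> y; rewrite inE; exact: F0.
rewrite -[X in _ * X](ge0_integral_pushforward mpsi Hp mD mF F0').
rewrite -[_%:E]/(t%:num%:E) -ge0_integral_mscale//.
apply: eq_measure_integral => A mA AD; rewrite /mscale/= /pushforward.
by apply: hausdorff_preimage; exact: subset_trans AD Dphi.
Qed.

(** Positive and negative parts are transformed separately. Multiplication by the positive number
    c^k distributes over their difference even when both are infinite, so the identity holds for
    every measurable F. *)
Lemma Rintegral_similarity (D : set Tq) (F : Tq -> R) :
  measurable D -> D `<=` range phi -> measurable_fun D F ->
  (\int[Hq]_(y in D) F y = c ^+ k * \int[Hp]_(x in phi @^-1` D) F (phi x))%R.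
Proof.
move=> mD Dphi mF.
have fineZ (t : R) (x : \bar R) : (0 < t)%R -> fine (t%:E * x) = (t * fine x)%R.
  case: x => [x||] t0 //=; first by rewrite gt0_muley ?lte_fin//= mulr0.
  by rewrite gt0_muleNy ?lte_fin//= mulr0.
have mulB (t : R) (x y : \bar R) : (0 < t)%R -> t%:E * x - t%:E * y = t%:E * (x - y).
  case: x => [x||]; case: y => [y||] t0 //=;
    rewrite ?gt0_muley ?gt0_muleNy ?lte_fin//= ?gt0_muley ?gt0_muleNy ?lte_fin//.
  by congr (_%:E); rewrite mulrBr.
rewrite /Rintegral integralE [in RHS]integralE -fineZ// -mulB//.
have mEF : measurable_fun D (EFin \o F) by exact/measurable_EFinP.
have Hpos := @ge0_integral_similarity D _ mD Dphi (measurable_funepos mEF)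
  (fun y _ => funepos_ge0 _ y).
have Hneg := @ge0_integral_similarity D _ mD Dphi (measurable_funeneg mEF)
  (fun y _ => funeneg_ge0 _ y).
congr fine; congr (_ - _).
- etransitivity; first exact: Hpos.
  congr (_ * _); apply: eq_integral => x _.
  exact: esym (congr1 (fun h => h x) (funepos_comp (EFin \o F) phi)).
- etransitivity; first exact: Hneg.
  congr (_ * _); apply: eq_integral => x _.
  exact: esym (congr1 (fun h => h x) (funeneg_comp (EFin \o F) phi)).
Qed.

End Similarity.

(** * Hausdorff measure of Euclidean balls *)

Section BallMeasure.
Context {R : realType}.

Lemma hausdorff_eball n (x : 'rV[R]_n) (r : R) : 0 < r ->
  hausdorff n (eball x r) = ((r ^+ n)%:E * hausdorff n (@eball R n 0 1))%E.
Proof.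
move=> r0; rewrite -(@hausdorff_similarity _ _ _ n (fun u => x + r *: u) r)//; last first.
  by move=> u v; rewrite opprD addrACA subrr add0r -scalerBr enormZ gtr0_norm.
congr hausdorff; apply/seteqP; split => [y|_ [u + <-]]; rewrite /eball/= => h.
  exists (r^-1 *: (y - x)); last by rewrite scalerA mulfV ?gt_eqF// scale1r addrC subrK.
  by rewrite /= subr0 enormZ gtr0_norm ?invr_gt0// mulrC ltr_pdivrMr// mul1r.
by rewrite addrC addKr enormZ gtr0_norm// -ltr_pdivlMl// mulVf ?gt_eqF//; rewrite subr0 in h.
Qed.

Lemma hausdorff_unit_ball_lty n : (hausdorff n (@eball R n 0 1) < +oo)%E.
Proof.
have sub : @eball R n 0 1 `<=` (fun u => 2 *: u - const_mx 1) @` unit_cube n.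
  move=> u; rewrite /eball/= subr0 => u1.
  exists (2^-1 *: (u + const_mx 1)); last by rewrite scalerA mulfV// scale1r addrK.
  move=> i; have := le_lt_trans (coord_le_enorm u i) u1.
  rewrite ltr_norml !mxE => /andP[? ?]; apply/andP; split; lra.
apply: le_lt_trans (le_hausdorff _ sub) _.
rewrite (@hausdorff_similarity _ _ _ n _ 2)//; last first.
  by move=> u v; rewrite opprB addrA subrK -scalerBr enormZ ger0_norm.
by rewrite lte_mul_pinfty ?lee_fin ?exprn_ge0// hausdorff_unit_cube_lty.
Qed.

(** Kept as an abstract constant: its finiteness, its positivity and the scaling of balls are what
    the estimates use. *)
Definition ball_volume n : R := fine (hausdorff n (@eball R n 0 1)).

Lemma ball_volumeE n : hausdorff n (@eball R n 0 1) = (ball_volume n)%:E.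
Proof. by rewrite fineK// ge0_fin_numE ?hausdorff_ge0// hausdorff_unit_ball_lty. Qed.

Lemma hausdorff_eballE n (x : 'rV[R]_n) (r : R) : 0 < r ->
  hausdorff n (eball x r) = (r ^+ n * ball_volume n)%:E.
Proof. by move=> r0; rewrite hausdorff_eball// ball_volumeE. Qed.

Lemma ball_volume_gt0 n' : 0 < ball_volume n'.+1.
Proof.
set n := n'.+1; rewrite -lte_fin -ball_volumeE.
have n1 : 0 < (n.+1%:R : R) by [].
have : (0 < hausdorff n (eball (0 : 'rV[R]_n) n.+1%:R))%E.
  apply: lt_le_trans (hausdorff_unit_cube_gt0 n') (le_hausdorff _ _) => u Qu.
  rewrite /eball/= subr0; apply: (@le_lt_trans _ _ (n%:R * 1)); last by rewrite mulr1 ltr_nat.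
  apply: enorm_le_max => // j; rewrite ler_norml; have := Qu j.
  by move=> /andP[? ?]; apply/andP; split; lra.
by rewrite hausdorff_eball// pmule_rgt0// lte_fin exprn_gt0.
Qed.

Definition eclball m (x : 'rV[R]_m) (r : R) : set 'rV[R]_m := [set y | enorm (y - x) <= r].

Lemma closed_eclball m (x : 'rV[R]_m) r : closed (eclball x r).
Proof.
rewrite -[eclball _ _]setCK; apply: open_closedC.
rewrite openE => y /=; rewrite /eclball/= => /negP; rewrite -ltNge => xy; apply/nbhs_eballP.
exists (enorm (y - x) - r); first by rewrite subr_gt0.
move=> z; rewrite /eball/= => zy; apply/negP; rewrite -ltNge.
by have := ler_enormB y z x; rewrite (enormB y z); lra.
Qed.

(** Comparison with the open balls of radius r > 1 as r decreases to 1. Together with [ball_volumeE]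
    it makes the bounding sphere negligible. *)
Lemma hausdorff_eclball n : hausdorff n (@eclball n 0 1) = (ball_volume n)%:E.
Proof.
apply/eqP; rewrite eq_le; apply/andP; split; last first.
  by rewrite -ball_volumeE; apply: le_hausdorff => u /ltW.
have h (r : R) : 1 < r -> (hausdorff n (@eclball n 0 1) <= (r ^+ n * ball_volume n)%:E)%E.
  move=> r1; rewrite -(@hausdorff_eballE n 0) ?(lt_trans _ r1)//.
  apply: le_hausdorff => u; rewrite /eclball /eball/= => u1.
  exact: le_lt_trans r1.
have fin : hausdorff n (@eclball n 0 1) \is a fin_num.
  by rewrite ge0_fin_numE ?hausdorff_ge0// (le_lt_trans (h 2 _)) ?ltry// ltr1n.
rewrite -(fineK fin) lee_fin.
have cvg : (fun r : R => r ^+ n * ball_volume n) @ 1^'+ --> 1 ^+ n * ball_volume n.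
  apply: cvg_at_right_filter; apply: cvgM; last exact: cvg_cst.
  exact: exprn_continuous.
rewrite expr1n mul1r in cvg.
apply: (closed_cvg (fun y => fine (hausdorff n (@eclball n 0 1)) <= y)) cvg.
- exact: closed_ge.
- near=> r; rewrite -lee_fin fineK//; apply: h; near: r; exact: nbhs_right_gt.
Unshelve. all: by end_near. Qed.

Lemma hausdorff_bounded n (A : set 'rV[R]_n) (r : R) :
  A `<=` eball 0 r -> (hausdorff n A < +oo)%E.
Proof.
move=> Ar; have r0 : 0 < `|r| + 1 by rewrite ltr_wpDl.
apply: (@le_lt_trans _ _ (hausdorff n (@eball R n 0 (`|r| + 1)))).
  apply: le_hausdorff => x /Ar; rewrite /eball/= => h; apply: (lt_le_trans h).
  by have := ler_norm r; lra.
by rewrite hausdorff_eballE// ltry.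
Qed.

Lemma hausdorff_sigma_finite n :
  sigma_finite setT (@hausdorff_measure R n n : set (caratheodory_type (@hausdorff_outer R n n)) -> \bar R).
Proof.
exists (fun j => @eball R n 0 j%:R).
  apply/seteqP; split => // x _; exists (Num.truncn (enorm x)).+1 => //.
  by rewrite /eball/= subr0 truncnS_gt.
move=> j; split; first exact/measurable_open/open_eball.
exact: (@hausdorff_bounded _ _ j%:R).
Qed.

End BallMeasure.

(** H^n itself, packaged as a sigma-finite measure for Tonelli's theorem. *)
Definition volume {R : realType} (n : nat) :
  {sigma_finite_measure set (caratheodory_type (@hausdorff_outer R n n)) -> \bar R} :=
  HB.pack_for {sigma_finite_measure set (caratheodory_type (@hausdorff_outer R n n)) -> \bar R}
    (Measure.sort (@hausdorff_measure R n n))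
    (Measure_isSigmaFinite.Build _ (caratheodory_type (@hausdorff_outer R n n)) R
       (Measure.sort (@hausdorff_measure R n n)) (hausdorff_sigma_finite n)).

(** * Rademacher's theorem *)

Section LipschitzLine.
Context {R : realType} (g : R -> R) (L : R).
Hypothesis gL : forall s t, `|g s - g t| <= L * `|s - t|.

Let F t := g t + L * t.

Let F_nd : nondecreasing F.
Proof.
move=> s t st; rewrite /F -subr_ge0 opprD addrACA -mulrBr.
have := gL t s; rewrite (@ger0_norm _ (t - s)) ?subr_ge0//.
rewrite ler_norml => /andP[+ _]; lra.
Qed.

Let F_diff s t : s <= t -> F t - F s <= 2 * L * (t - s).
Proof.
move=> st; rewrite /F opprD addrACA -mulrBr.
have := gL t s; rewrite (@ger0_norm _ (t - s)) ?subr_ge0//.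
rewrite ler_norml => /andP[_ +]; lra.
Qed.

Let L0 : 0 <= L.
Proof.
by have := le_trans (normr_ge0 _) (gL 1 0); rewrite subr0 normr1 mulr1.
Qed.

Let F_continuous : continuous F.
Proof.
move=> t; apply/cvgrPdist_le => e e0.
have d0 : 0 < e / (2 * L + 1) by rewrite divr_gt0//; have := L0; lra.
near=> s.
have st : `|t - s| <= e / (2 * L + 1) by near: s; apply/nbhs_ballP; exists (e / (2 * L + 1)) => // y /ltW.
have h u v : u <= v -> `|F v - F u| <= (2 * L + 1) * `|v - u|.
  move=> uv; rewrite !ger0_norm ?subr_ge0 ?F_nd//.
  by rewrite (le_trans (F_diff uv))// ler_wpM2r ?subr_ge0//; have := L0; lra.
have {}h : `|F t - F s| <= (2 * L + 1) * `|t - s|.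
  by case: (leP s t) => [/h//|/ltW/h]; rewrite distrC (distrC t).
rewrite (le_trans h)// -ler_pdivlMl ?(mulrC _ e)//; have := L0; lra.
Unshelve. all: by end_near. Qed.

Let F_rc : right_continuous F. Proof. exact: right_continuousW. Qed.

HB.instance Definition _ := isCumulative.Build R _ R F F_nd F_rc.

Let Fc : cumulative R R := F.
Let nu : {measure set (measurableTypeR R) -> \bar R} := lebesgue_stieltjes_measure Fc.

(** Both sides are infima over covers by half-open intervals, on which the increment of F is at most
    2 L times the length. The constant 2 L + 1 stays invertible when L = 0. *)
Let nu_le A : (nu A <= (2 * L + 1)%:E * lebesgue_measure A)%E.
Proof.
have c0 : 0 < 2 * L + 1 by have := L0; lra.
rewrite -lee_pdivrMl//; apply: le_ereal_inf_tmp => _ [I [mI AI] <-].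
rewrite lee_pdivrMl// -nneseriesZl//.
apply: (@le_trans _ _ (\sum_(k <oo) wlength Fc (I k))%E).
  by apply: ereal_inf_lbound; exists I.
apply: lee_nneseries => [k _ _|k _]; first exact: wlength_ge0.
have := mI k => -[[a b] _ <-] /=.
rewrite !wlength_itv/= lte_fin; case: ifPn => [/ltW ab|_]; last by rewrite mule0.
by rewrite -!EFinB -EFinM lee_fin (le_trans (F_diff ab))// ler_wpM2r ?subr_ge0// lerDl.
Qed.

(* [F t = g t + L * t] is nondecreasing and Lipschitz, so its Stieltjes measure has
   a density, and F is a.e. differentiable by the Lebesgue differentiation theorem. *)
Lemma lipschitz_quotient_ae : exists N : set R, [/\ measurable N, lebesgue_measure N = 0%E &
  forall t, 0 < t < 1 -> ~ N t ->
    cvgn (fun k => k.+1%:R * (g (t + k.+1%:R^-1) - g t))].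
Proof.
have mD : measurable (`]0, 1]%classic : set (measurableTypeR R)) by exact: measurable_itv.
have nu_itv a b : a <= b -> nu `]a, b]%classic = (F b - F a)%:E.
  move=> ab; rewrite /nu/= /lebesgue_stieltjes_measure /measure_extension/=.
  by rewrite measurable_mu_extE/= ?wlength_itv_bnd//; exact: is_ocitv.
have nuD : (nu `]0%R, 1%R]%classic < +oo)%E by rewrite nu_itv// ltry.
(* Restriction to ]0, 1] gives a finite measure, hence an integrable density, whose integral over
   ]-oo, s] is F s - F 0 for 0 <= s <= 1. *)
pose m : {finite_measure set (measurableTypeR R) -> \bar R} := mfrestr mD nuD.
have mdom : m `<< lebesgue_measure.
  apply/null_content_dominatesP => A mA A0.
  apply/eqP; rewrite eq_le measure_ge0 andbT.
  rewrite (le_trans (measureIl _ _ _))//.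
  by rewrite (le_trans (nu_le A))// A0 mule0.
have [f [f0 ffin fint fE]] := radon_nikodym_sigma_finite mdom.
have mf : measurable_fun setT (fine \o f).
  by apply: measurableT_comp => //; have /integrableP[] := fint.
have fintR : lebesgue_measure.-integrable setT (EFin \o (fine \o f)).
  by apply: eq_integrable fint => // x _ /=; rewrite fineK.
have fx y : lebesgue_measure.-integrable `]-oo, y] (EFin \o (fine \o f)).
  by apply: integrableS fintR.
have [N [mN N0 FN]] := FTC1Ny fx (open_integrable_locally openT fintR).
exists N; split => // t /andP[t0 t1] Nt.
pose h (k : nat) : R := k.+1%:R^-1.
have FE s : 0 <= s <= 1 -> (\int[lebesgue_measure]_(t in `]-oo, s]) (fine \o f) t)%R = F s - F 0.
  move=> /andP[s0 s1]; rewrite /Rintegral.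
  under eq_integral do rewrite /= fineK//.
  rewrite -fE// /m/= /mfrestr /mrestr.
  rewrite (_ : _ `&` _ = `]0, s]%classic) ?nu_itv//.
  apply/seteqP; split => x/=; rewrite !in_itv/=; first by move=> [-> /andP[->]].
  by move=> /andP[-> xs]; rewrite xs (le_trans xs).
have /contrapT/= [/cvg_ex[/= l Phil] _] := fun h => Nt (FN t h).
have h0 : h @ \oo --> (0 : R) by exact: cvg_harmonic.
have /cvg_at_rightP/(_ h) := cvg_dnbhs_at_right Phil.
have hpos k : 0 < h k by rewrite invr_gt0.
move=> /(_ (conj hpos h0)) hl.
apply/cvg_ex; exists (l - L); apply: cvg_trans (cvgB hl (cvg_cst L)).
apply: near_eq_cvg; near=> k.
(* True eventually because t < 1; beyond 1 the primitive of the density is no longer F. *)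
have hk : t + h k <= 1.
  rewrite -lerBrDl; near: k; apply: (cvgr_le _ h0); by rewrite subr_gt0.
have FEk : \int[lebesgue_measure]_(x in `]-oo, (h k)%:A + t]) (fine \o f) x = F (t + h k) - F 0.
  by rewrite [_%:A]mulr1 (addrC (h k)) FE// hk andbT addr_ge0 ?(ltW t0) ?(ltW (hpos k)).
have FEt := FE t; rewrite (ltW t0) (ltW t1) in FEt.
transitivity ((h k)^-1 * ((F (t + h k) - F 0) - (F t - F 0)) - L).
  by rewrite -FEk -FEt.
rewrite /F /h invrK; have : k.+1%:R != 0 :> R by rewrite pnatr_eq0.
by move=> k0; field; rewrite addrC natr1.
Unshelve. all: by end_near. Qed.

End LipschitzLine.

(** The Cauchy criterion expresses convergence by countable unions and intersections. *)
Lemma measurable_cvgn d (S : measurableType d) (R : realType) (h : nat -> S -> R) :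
  (forall k, measurable_fun setT (h k)) -> measurable [set s | cvgn (fun k => h k s)].
Proof.
move=> mh.
have -> : [set s | cvgn (fun k => h k s)] = \bigcap_j \bigcup_N \bigcap_p
    [set s | `|h (N + p)%N s - h N s| <= j.+1%:R^-1].
  apply/seteqP; split => s /=.
    move=> /cauchy_cvgP/cauchyP cs j _.
    have j0 : 0 < j.+1%:R^-1 / 2 :> R by rewrite divr_gt0.
    have [x [N _ xN]] := cs _ j0; exists N => // p _ /=.
    have := xN (N + p)%N (leq_addr _ _); have := xN N (leqnn _); rewrite /ball/= => h1 h2.
    rewrite (le_trans (ler_distD x _ _))// (splitr j.+1%:R^-1) lerD// ?ltW//.
    by rewrite distrC.
  move=> cs; apply/cauchy_cvgP/cauchyP => e e0.
  have [j] := ltr_add_invr e0; rewrite add0r => je.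
  have [N _ hN] := cs j I; exists (h N s); exists N => // p /= Np.
  have := hN (p - N)%N I; rewrite /= subnKC// /ball/= distrC => /le_lt_trans; exact.
apply: bigcapT_measurable => j; apply: bigcupT_measurable => N.
apply: bigcapT_measurable => p; rewrite -[X in measurable X]setTI.
apply: measurable_fun_ler => //; apply: measurableT_comp => //.
exact: measurable_funB.
Qed.

(** Difference quotient with steps 1 / (k + 1) only: a sequence keeps the set of convergence and the
    limit measurable. *)
Definition quot {R : realType} {n} (f : 'rV[R]_n -> R) (v : 'rV[R]_n) (k : nat) (x : 'rV[R]_n) : R :=
  k.+1%:R * (f (x + k.+1%:R^-1 *: v) - f x).

Section QuotientAE.
Context {R : realType} {n : nat}.
Notation T := (caratheodory_type (@hausdorff_outer R n n)).
Notation mu := (@volume R n).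

Lemma volume_shift (v : 'rV[R]_n) (A : set 'rV[R]_n) :
  mu [set x | A (x + v)] = mu A.
Proof.
rewrite /=; rewrite -[RHS]/(hausdorff n A) -[LHS]/(hausdorff n [set x | A (x + v)]).
rewrite -[LHS]mul1e -(expr1n R n) -(@hausdorff_similarity _ _ _ n (fun x => x + v) 1)//.
  congr hausdorff; apply/seteqP; split=> [_ [x Ax <-]//|x Ax].
  by exists (x - v); rewrite /= subrK.
by move=> x y; rewrite opprD addrACA subrr addr0 mul1r.
Qed.

Lemma measurable_shift (v : 'rV[R]_n) (A : set T) : measurable A ->
  measurable ([set x | A (x + v)] : set T).
Proof.
move=> mA.
have := (@measurable_similarity R n n n (fun x => x + v) 1 ltr01).
move=> /(_ _ measurableT _ mA); rewrite setTI; apply.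
by move=> x y; rewrite opprD addrACA subrr addr0 mul1r.
Qed.

Variables (f : 'rV[R]_n -> R) (L : R).
Hypothesis fL : forall x y, `|f x - f y| <= L * enorm (x - y).

Let f_cont : continuous f. Proof. exact: lipschitz_continuous fL. Qed.

Lemma quot_lip v k x y :
  `|quot f v k x - quot f v k y| <= k.+1%:R * (L + L) * enorm (x - y).
Proof.
rewrite /quot -mulrBr normrM ger0_norm// -mulrA ler_wpM2l//.
rewrite (_ : _ - _ = (f (x + k.+1%:R^-1 *: v) - f (y + k.+1%:R^-1 *: v)) + (f y - f x)); last by ring.
apply: le_trans (ler_normD _ _) _; rewrite mulrDl lerD ?fL//.
  by rewrite (le_trans (fL _ _))// opprD addrACA subrr addr0.
by rewrite (le_trans (fL _ _))// enormB.
Qed.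

Lemma continuous_quot v k : continuous (quot f v k).
Proof. exact: lipschitz_continuous (quot_lip v k). Qed.

Lemma quot_bound v k x : `|quot f v k x| <= L * enorm v.
Proof.
rewrite /quot normrM ger0_norm// -ler_pdivlMl// (le_trans (fL _ _))//.
by rewrite addrC addKr enormZ ger0_norm ?invr_ge0// mulrCA.
Qed.

(* The one-dimensional result holds on each line of direction v.  Averaging over
   the translates by t v, 0 < t < 1, instead of choosing coordinates adapted to v,
   lets Tonelli's theorem conclude by translation invariance. *)
Lemma quot_cvg_negligible v :
  mu [set x | ~ cvgn (fun k => quot f v k x)] = 0%E.
Proof.
set Bad := [set x | _].
have mBad : measurable (Bad : set T).
  apply: measurableC; apply: measurable_cvgn => k.
  exact/measurable_continuous/continuous_quot.
pose P : set (T * measurableTypeR R) := [set s | Bad (s.1 + s.2 *: v)].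
have mP : measurable P.
  suff mC : forall k, measurable_fun setT
      (fun s : T * measurableTypeR R => quot f v k (s.1 + s.2 *: v)).
    exact: measurableC (measurable_cvgn mC).
  move=> k; apply: (@measurable_continuous_comp _ _ _ _ (fun s : T * measurableTypeR R => s.1 + s.2 *: v) (quot f v k)); last exact: continuous_quot.
  move=> i.
  rewrite (_ : (fun s => _) = (fun s : T * measurableTypeR R => s.1 0 i + s.2 * v 0 i)); last first.
    by apply/funext => s; rewrite !mxE.
  apply: measurable_funD.
    exact: (measurableT_comp (@measurable_coord R n n i) measurable_fst).
  apply: measurable_funM => //; exact: measurable_snd.
have mI : measurable (`]0, 1[%classic : set (measurableTypeR R)) by exact: measurable_itv.
pose Q : set (T * measurableTypeR R) := P `&` (setT `*` `]0, 1[%classic).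
have mQ : measurable Q by apply: measurableI => //; exact: measurableX.
have := indic_fubini_tonelli mu lebesgue_measure mQ.
rewrite indic_fubini_tonelli_FE// indic_fubini_tonelli_GE//.
rewrite integral0_eq; last first.
  move=> x _ /=.
  have gL s t : `|f (x + s *: v) - f (x + t *: v)| <= (L * enorm v) * `|s - t|.
    rewrite (le_trans (fL _ _))// opprD addrACA subrr add0r -scalerBl enormZ.
    by rewrite mulrAC mulrA.
  have [N [mN N0 hN]] := lipschitz_quotient_ae gL.
  apply/eqP; rewrite eq_le measure_ge0 andbT -N0; apply: le_measure.
  - by rewrite inE; exact: measurable_xsection.
  - by rewrite inE.
  - move=> t; rewrite /xsection/= inE => -[/= bad [_]]; rewrite /= in_itv/= => t01.
    apply: contrapT => Nt; apply: bad.
    rewrite (_ : (quot f v)^~ _ = fun k => k.+1%:R * (f (x + (t + k.+1%:R^-1) *: v) - f (x + t *: v))).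
      exact: hN.
    by apply/funext => k; rewrite /quot scalerDl addrA.
rewrite (_ : mu \o ysection Q = (cst (mu Bad)) \_ (`]0, 1[%classic : set R)); last first.
  apply/funext => t /=; rewrite patchE; case: ifPn => [|] /=; rewrite ?notin_setE ?inE => t01.
    transitivity (mu [set x | Bad (x + t *: v)]); last exact: volume_shift.
    congr (mu _).
    apply/seteqP; split => x; rewrite /ysection/= inE /Q/=; first by case.
    by move=> ?; split.
  rewrite (_ : ysection _ _ = set0); first exact: hausdorff0.
  by apply/seteqP; split => x //; rewrite /ysection/= inE /Q/= => -[_ []].
rewrite -integral_mkcond integral_cst//= lebesgue_measure_itv/= lte01 oppr0 adde0 mule1.
by [].
Qed.

End QuotientAE.

(** * Integrals of bounded functions with bounded support *)

Section BoundedSupport.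
Context {R : realType} {n : nat}.
Notation T := (caratheodory_type (@hausdorff_outer R n n)).
Notation mu := (@volume R n).
Implicit Types (G : T -> R) (C r : R).

Definition supported_in r G := forall x : 'rV[R]_n, r <= enorm x -> G x = 0.

Lemma volume_eball (x : 'rV[R]_n) r : 0 < r ->
  mu (eball x r) = (r ^+ n * ball_volume n)%:E.
Proof. exact: hausdorff_eballE. Qed.

Lemma measurable_eball (x : 'rV[R]_n) r : measurable (eball x r : set T).
Proof. exact/measurable_open/open_eball. Qed.

Lemma integrable_cutoff C r : 0 < r ->
  mu.-integrable setT (fun x : T => (C * \1_(eball (0 : 'rV[R]_n) r) x)%:E).
Proof.
move=> r0; under eq_fun do rewrite EFinM.
apply: integrableZl => //; apply/integrableP; split.
  exact/measurable_EFinP/measurable_indic/measurable_eball.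
under eq_integral do rewrite gee0_abs ?lee_fin//.
rewrite integral_indic//; last exact: measurable_eball.
by rewrite setIT [X in (X < _)%E](volume_eball 0 r0) ltry.
Qed.

Lemma integrable_supported G C r : 0 < r -> measurable_fun setT G ->
  (forall x, `|G x| <= C) -> supported_in r G -> mu.-integrable setT (EFin \o G).
Proof.
move=> r0 mG GC Gr.
apply: (@le_integrable _ _ _ mu _ measurableT (EFin \o G)
  (fun x : T => (C * \1_(eball (0 : 'rV[R]_n) r) x)%:E)).
- exact/measurable_EFinP.
- move=> x _; rewrite /= lee_fin (le_trans _ (ler_norm _))// indicE.
  case: (ltP (enorm x) r) => h; last by rewrite Gr// normr0 mulr_ge0// (le_trans _ (GC x)).
  by rewrite mem_set ?mulr1// /eball/= subr0.
- exact: integrable_cutoff.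
Qed.

Lemma Rintegral_supported_le G C r : 0 < r -> measurable_fun setT G ->
  (forall x, `|G x| <= C) -> supported_in r G ->
  `|\int[mu]_x G x| <= C * (r ^+ n * ball_volume n).
Proof.
move=> r0 mG GC Gr; have iG := integrable_supported r0 mG GC Gr.
apply: (le_trans (le_normr_Rintegral measurableT iG)).
apply: (@le_trans _ _ (\int[mu]_x (C * \1_(eball (0 : 'rV[R]_n) r) x))).
  apply: le_Rintegral => //; first exact: integrable_norm.
    exact: integrable_cutoff.
  move=> x _; rewrite indicE.
  case: (ltP (enorm x) r) => h; last by rewrite Gr// normr0 mulr_ge0// (le_trans _ (GC x)).
  by rewrite mem_set ?mulr1// /eball/= subr0.
rewrite RintegralZl//; last first.
  by apply: eq_integrable (integrable_cutoff 1 r0) => // x _; rewrite mul1r.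
rewrite /Rintegral integral_indic//; last exact: measurable_eball.
by rewrite setIT [X in fine X](volume_eball 0 r0).
Qed.

Lemma Rintegral_dct (G_ : nat -> T -> R) G C r : 0 < r ->
  (forall k, measurable_fun setT (G_ k)) -> measurable_fun setT G ->
  (forall k x, `|G_ k x| <= C) -> (forall k, supported_in r (G_ k)) ->
  {ae mu, forall x, G_ k x @[k --> \oo] --> G x} ->
  (\int[mu]_x G_ k x) @[k --> \oo] --> \int[mu]_x G x.
Proof.
move=> r0 mG_ mG GC Gr GG.
have := @dominated_convergence _ _ _ mu setT measurableT (fun k x => (G_ k x)%:E)
  (fun x => (G x)%:E) (fun x : T => (C * \1_(eball (0 : 'rV[R]_n) r) x)%:E).
case.
- by move=> k; exact/measurable_EFinP.
- exact/measurable_EFinP.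
- apply: filterS GG => x Gx _.
  by apply: cvg_EFin => //; exact: nearW.
- exact: integrable_cutoff.
- apply: aeW => x k _; rewrite lee_fin indicE.
  case: (ltP (enorm x) r) => h; last by rewrite Gr// normr0 mulr_ge0// (le_trans _ (GC k x)).
  by rewrite mem_set ?mulr1// /eball/= subr0.
move=> iG _ cG.
apply: fine_cvg; rewrite fineK//.
exact: integrable_fin_num.
Qed.

Lemma Rintegral_shift (v : 'rV[R]_n) G : measurable_fun setT G ->
  \int[mu]_x G (x + v) = \int[mu]_x G x.
Proof.
move=> mG.
have := @Rintegral_similarity R n n n (fun x => x + v) 1 ltr01 _ setT G measurableT _ mG.
rewrite expr1n mul1r => -> //.
  by move=> x y; rewrite opprD addrACA subrr addr0 mul1r.
by move=> y _; exists (y - v) => //; rewrite subrK.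
Qed.

End BoundedSupport.

(** Directional derivative along the steps 1 / (k + 1). The value 0 off the set of convergence keeps
    it measurable and subject to the bound L |v|. *)
Definition dquot {R : realType} {n} (f : 'rV[R]_n -> R) (v x : 'rV[R]_n) : R :=
  if `[< cvgn (fun k => quot f v k x) >] then limn (fun k => quot f v k x) else 0.

Lemma measurable_continuous_shift {R : realType} {n : nat} (w : 'rV[R]_n) (h : 'rV[R]_n -> R) :
  continuous h ->
  measurable_fun setT (fun x : caratheodory_type (@hausdorff_outer R n n) => h (x + w)).
Proof.
move=> ch.
pose psi (x : caratheodory_type (@hausdorff_outer R n n)) : 'rV[R]_n := x + w.
have mpsi i : measurable_fun setT (fun s => psi s 0 i).
  rewrite (_ : (fun s => _) = (fun s : caratheodory_type (@hausdorff_outer R n n) => s 0 i + w 0 i)).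
    by apply: measurable_funD; [exact: measurable_coord|exact: measurable_cst].
  by apply/funext => s; rewrite mxE.
exact: (measurable_continuous_comp mpsi ch).
Qed.

(** * Additivity of directional derivatives almost everywhere *)

Section QuotientLimit.
Context {R : realType} {n : nat}.
Notation T := (caratheodory_type (@hausdorff_outer R n n)).
Notation mu := (@volume R n).
Variables (f : 'rV[R]_n -> R) (L : R).
Hypothesis fL : forall x y, `|f x - f y| <= L * enorm (x - y).

Lemma measurable_quot v k : measurable_fun setT (quot f v k : T -> R).
Proof. exact/measurable_continuous/(continuous_quot fL). Qed.

Lemma dquot_cvg v x : cvgn (fun k => quot f v k x) ->
  quot f v k x @[k --> \oo] --> dquot f v x.
Proof. by move=> cv; rewrite /dquot asboolT. Qed.

Lemma dquot_bound v x : `|dquot f v x| <= L * enorm v.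
Proof.
rewrite /dquot; case: asboolP => [cv|_]; last first.
  by rewrite normr0 (le_trans _ (quot_bound fL v 0 x)).
have : `|quot f v k x| @[k --> \oo] --> `|limn (fun k => quot f v k x)| by exact: cvg_norm.
move=> ncv; apply: (closed_cvg (fun y => y <= L * enorm v)) ncv; first exact: closed_le.
by apply: nearW => k; exact: (quot_bound fL).
Qed.

Lemma measurable_dquot v : measurable_fun setT (dquot f v : T -> R).
Proof.
pose good : set T := [set x | cvgn (fun k => quot f v k x)].
have mgood : measurable good by apply: measurable_cvgn; exact: measurable_quot.
apply: (@measurable_fun_cvg _ _ _ _ (fun k => (quot f v k : T -> R) \_ good)).
  by move=> k; apply/(measurable_restrictT _ mgood)/measurable_funTS/measurable_quot.
move=> x _; rewrite /dquot; case: asboolP => gx.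
  rewrite (_ : (fun k => _) = fun k => quot f v k x)//.
  by apply/funext => k; rewrite patchE mem_set.
rewrite (_ : (fun k => _) = fun k => 0); first exact: cvg_cst.
by apply/funext => k; rewrite patchE memNset.
Qed.

Lemma dquot_ae v : {ae mu, forall x, quot f v k x @[k --> \oo] --> dquot f v x}.
Proof.
exists [set x | ~ cvgn (fun k => quot f v k x)]; split.
- by apply: measurableC; apply: measurable_cvgn; exact: measurable_quot.
- exact: quot_cvg_negligible fL v.
- by move=> x /= h cv; apply: h; exact: dquot_cvg.
Qed.

Let FF : Filter (almost_everywhere mu) := ae_filter_ringOfSetsType mu.

Variables (u v : 'rV[R]_n).
(** The defect of additivity in the direction, for the difference quotients and then for their
    limits; C bounds both. *)
Let g_ k x := quot f (u + v) k x - quot f u k x - quot f v k x.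
Let g x := dquot f (u + v) x - dquot f u x - dquot f v x.
Let C := L * enorm (u + v) + L * enorm u + L * enorm v.

Let mg_ k : measurable_fun setT (g_ k : T -> R).
Proof. exact: (measurable_funB (measurable_funB (measurable_quot _ _) (measurable_quot _ _)) (measurable_quot _ _)). Qed.
Let mg : measurable_fun setT (g : T -> R).
Proof. exact: (measurable_funB (measurable_funB (measurable_dquot _) (measurable_dquot _)) (measurable_dquot _)). Qed.
Let g_C k x : `|g_ k x| <= C.
Proof.
rewrite (le_trans (ler_normB _ _))// lerD ?(quot_bound fL)//.
by rewrite (le_trans (ler_normB _ _))// lerD ?(quot_bound fL).
Qed.
Let gC x : `|g x| <= C.
Proof.
rewrite (le_trans (ler_normB _ _))// lerD ?dquot_bound//.
by rewrite (le_trans (ler_normB _ _))// lerD ?dquot_bound.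
Qed.
Let g_g : {ae mu, forall x, g_ k x @[k --> \oo] --> g x}.
Proof.
have := dquot_ae (u + v); have := dquot_ae u; have := dquot_ae v.
by apply: (@filterS3 _ _ FF) => x hv hu huv; apply: cvgB hv; exact: cvgB huv hu.
Qed.

Let g_lip k : forall x y, `|g_ k x - g_ k y| <= 3 * (k.+1%:R * (L + L)) * enorm (x - y).
Proof.
move=> x y; have h w := quot_lip fL w k x y.
rewrite /g_ (_ : _ - _ - _ - _ = (quot f (u + v) k x - quot f (u + v) k y)
  - (quot f u k x - quot f u k y) - (quot f v k x - quot f v k y)); last by ring.
rewrite (le_trans (ler_normB _ _))// (le_trans (lerD (ler_normB _ _) (lexx _)))//.
by rewrite -mulrA (_ : 3 * _ = (k.+1%:R * (L + L) * enorm (x - y)) + (k.+1%:R * (L + L) * enorm (x - y)) + (k.+1%:R * (L + L) * enorm (x - y))) ?lerD//; ring.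
Qed.

(* [g_ k] is the increment over u / k.+1 of the bounded function [quot f v k]; a
   change of variables moves the increment to psi, where it is O(1 / k). *)
Let g_weak (psi : 'rV[R]_n -> R) (B P r : R) : 0 < r ->
  (forall x, `|psi x| <= B) -> (forall x y, `|psi x - psi y| <= P * enorm (x - y)) ->
  supported_in r psi ->
  (\int[mu]_x (g_ k x * psi x)) @[k --> \oo] --> 0.
Proof.
move=> r0 psiB psiP psir.
(* Translations by u / (k + 1) have length at most |u|, so one enlarged ball contains the supports
   of psi and of all its translates. *)
have ru0 : 0 < r + enorm u by rewrite ltr_wpDr ?enorm_ge0.
have mpsi : measurable_fun setT (psi : T -> R).
  exact/measurable_continuous/(lipschitz_continuous psiP).
pose K := L * enorm v * (P * enorm u) * ((r + enorm u) ^+ n * ball_volume n).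
have step k : `|\int[mu]_x (g_ k x * psi x)| <= K * harmonic k.
  pose e : R := k.+1%:R^-1; have e0 : 0 < e by rewrite invr_gt0.
  have eu : enorm (e *: u) <= enorm u.
    by rewrite enormZ gtr0_norm// ler_piMl ?enorm_ge0// /e invf_le1// ler1n.
  pose F x := quot f v k x.
  have mF : measurable_fun setT (F : T -> R) := measurable_quot v k.
  have FB x : `|F x| <= L * enorm v by exact: (quot_bound fL).
  have mFu := measurable_continuous_shift (e *: u) (@continuous_quot _ _ f L fL v k).
  have mpsiu := measurable_continuous_shift (- (e *: u)) (lipschitz_continuous psiP).
  have gE x : g_ k x * psi x = F (x + e *: u) * psi x - F x * psi x.
    rewrite -mulrBl; congr (_ * _).
    by rewrite /g_ /F /quot -/e !scalerDr !addrA; ring.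
  have psir' : supported_in (r + enorm u) psi.
    by move=> x xr; apply: psir; rewrite (le_trans _ xr)// lerDl enorm_ge0.
  have psiur : supported_in (r + enorm u) (fun x : T => psi (x - e *: u)).
    move=> x xr; apply: psir; rewrite -(lerD2r (enorm u)) (le_trans xr)//.
    rewrite -{1}(subrK (e *: u) x) (le_trans (ler_enormD _ _))// lerD2l//.
  have i1 : mu.-integrable setT (EFin \o (fun x : T => F (x + e *: u) * psi x)).
    apply: (@integrable_supported _ _ _ (L * enorm v * B) _ ru0).
    - exact: measurable_funM.
    - by move=> x; rewrite normrM ler_pM// FB.
    - by move=> x xr; rewrite psir' ?mulr0.
  have i2 : mu.-integrable setT (EFin \o (fun x : T => F x * psi x)).
    apply: (@integrable_supported _ _ _ (L * enorm v * B) _ ru0).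
    - exact: measurable_funM.
    - by move=> x; rewrite normrM ler_pM// FB.
    - by move=> x xr; rewrite psir' ?mulr0.
  have i3 : mu.-integrable setT (EFin \o (fun x : T => F x * psi (x - e *: u))).
    apply: (@integrable_supported _ _ _ (L * enorm v * B) _ ru0).
    - exact: measurable_funM.
    - by move=> x; rewrite normrM ler_pM// FB.
    - by move=> x xr; rewrite psiur ?mulr0.
  have -> : \int[mu]_x (g_ k x * psi x) = \int[mu]_x (F x * (psi (x - e *: u) - psi x)).
    under eq_Rintegral do rewrite gE.
    under [RHS]eq_Rintegral do rewrite mulrBr.
    rewrite RintegralB// RintegralB//; congr (_ - _).
    rewrite -(@Rintegral_shift _ _ (e *: u) (fun x : T => F x * psi (x - e *: u))).
      by apply: eq_Rintegral => x _; rewrite addrK.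
    exact: measurable_funM.
  have -> : K * harmonic k = L * enorm v * (P * (e * enorm u)) * ((r + enorm u) ^+ n * ball_volume n).
    by rewrite /K /harmonic /= -/e; ring.
  apply: Rintegral_supported_le ru0 _ _ _.
  - exact: (measurable_funM mF (measurable_funB mpsiu mpsi)).
  - move=> x; rewrite normrM ler_pM// ?FB// (le_trans (psiP _ _))//.
    by rewrite addrC addKr enormN enormZ gtr0_norm.
  - by move=> x xr; rewrite psiur// psir'// subrr mulr0.
apply: (@squeeze_cvgr _ _ _ _ (fun k => - (K * harmonic k)) (fun k => K * harmonic k)).
- by apply: nearW => k; rewrite -ler_norml step.
- rewrite -oppr0; apply: cvgN; rewrite -(mulr0 K); apply: cvgM; [exact: cvg_cst|exact: cvg_harmonic].
- rewrite -(mulr0 K); apply: cvgM; [exact: cvg_cst|exact: cvg_harmonic].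
Qed.

(* Testing g against [g_ j * chi] and letting j tend to infinity gives that the
   integral of [g ^+ 2 * chi] is 0. *)
Lemma dquotD : {ae mu, forall x, dquot f (u + v) x = dquot f u x + dquot f v x}.
Proof.
have gchi (r : R) : 0 < r -> \int[mu]_x (g x ^+ 2 * Num.max 0 (r - enorm x)) = 0.
  move=> r0; pose chi (x : 'rV[R]_n) := Num.max 0 (r - enorm x).
  have chi0 x : 0 <= chi x by rewrite le_max lexx.
  have chi1 x y : `|chi x - chi y| <= 1 * enorm (x - y).
    rewrite mul1r (le_trans _ (enorm_dist x y))// /chi.
    have := ler_norm (enorm x - enorm y); have := ler_norm (enorm y - enorm x).
    rewrite (distrC (enorm y)) => h1 h2; rewrite ler_norml.
    by case: (leP 0 (r - enorm x)); case: (leP 0 (r - enorm y)) => *; apply/andP; split; lra.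
  have chir x : `|chi x| <= r.
    by rewrite ger0_norm// ge_max (ltW r0)/= gerBl enorm_ge0.
  have chis : supported_in r chi by move=> x xr; apply: max_l; rewrite subr_le0.
  have mchi : measurable_fun setT (chi : T -> R).
    exact/measurable_continuous/(lipschitz_continuous chi1).
  have C0 : 0 <= C by rewrite (le_trans _ (gC 0)).
  (* For fixed j the function [g_ j * chi] is Lipschitz, with a constant that grows with j; this is
     harmless because k tends to infinity while j is fixed. *)
  have gg_ j : \int[mu]_x (g x * (g_ j x * chi x)) = 0.
    have h1 : (\int[mu]_x (g_ k x * (g_ j x * chi x))) @[k --> \oo] --> 0.
      apply: (@g_weak (fun x => g_ j x * chi x) (C * r) (3 * (j.+1%:R * (L + L)) * r + C) r r0).
      - by move=> x; rewrite normrM ler_pM.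
      - move=> x y.
        have -> : g_ j x * chi x - g_ j y * chi y =
          (g_ j x - g_ j y) * chi x + g_ j y * (chi x - chi y) by ring.
        rewrite (le_trans (ler_normD _ _))// !normrM [leRHS]mulrDl lerD//.
          by rewrite mulrAC ler_pM.
        by rewrite ler_pM// -[leRHS]mul1r.
      - by move=> x xr; rewrite chis// mulr0.
    have h2 : (\int[mu]_x (g_ k x * (g_ j x * chi x))) @[k --> \oo] -->
        \int[mu]_x (g x * (g_ j x * chi x)).
      apply: (@Rintegral_dct R n (fun k x => g_ k x * (g_ j x * chi x)) _ (C * (C * r)) r r0).
      - by move=> k; exact: (measurable_funM (mg_ k) (measurable_funM (mg_ j) mchi)).
      - exact: (measurable_funM mg (measurable_funM (mg_ j) mchi)).
      - by move=> k x; rewrite !normrM !ler_pM ?mulr_ge0.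
      - by move=> k x xr; rewrite chis// !mulr0.
      - by move: g_g; apply: (@filterS _ _ FF) => x gx; apply: cvgM; [exact: gx|exact: cvg_cst].
    by rewrite -(cvg_lim (@Rhausdorff R) h2) (cvg_lim (@Rhausdorff R) h1).
  have h2 : (\int[mu]_x (g x * (g_ k x * chi x))) @[k --> \oo] -->
      \int[mu]_x (g x ^+ 2 * chi x).
    apply: (@Rintegral_dct R n (fun k x => g x * (g_ k x * chi x)) _ (C * (C * r)) r r0).
    - by move=> k; exact: (measurable_funM mg (measurable_funM (mg_ k) mchi)).
    - exact: (measurable_funM (measurable_funX _ mg) mchi).
    - by move=> k x; rewrite !normrM !ler_pM ?mulr_ge0.
    - by move=> k x xr; rewrite chis// !mulr0.
    - move: g_g; apply: (@filterS _ _ FF) => x gx; rewrite expr2 -mulrA; apply: cvgM; first exact: cvg_cst.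
      by apply: cvgM; [exact: gx|exact: cvg_cst].
  have h1 : (\int[mu]_x (g x * (g_ k x * chi x))) @[k --> \oo] --> 0.
    by under eq_fun do rewrite gg_; exact: cvg_cst.
  by rewrite -(cvg_lim (@Rhausdorff R) h2) (cvg_lim (@Rhausdorff R) h1).
have gae (N : nat) : {ae mu, forall x, g x ^+ 2 * Num.max 0 (N.+1%:R - enorm x) = 0}.
  set h := (fun x : T => g x ^+ 2 * Num.max 0 (N.+1%:R - enorm x)).
  have h0 x : 0 <= h x by rewrite mulr_ge0 ?sqr_ge0// le_max lexx.
  have mchi : measurable_fun setT (fun x : T => Num.max 0 (N.+1%:R - enorm (x : 'rV[R]_n))).
    have me : measurable_fun setT (fun x : T => enorm (x : 'rV[R]_n)).
      exact/measurable_lipschitz1/enorm_dist.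
    exact: (measurable_maxr (measurable_cst _) (measurable_funB (measurable_cst _) me)).
  have mh : measurable_fun setT h := measurable_funM (measurable_funX 2 mg) mchi.
  have ih : mu.-integrable setT (EFin \o h).
    apply: (@integrable_supported _ _ h (C ^+ 2 * N.+1%:R) N.+1%:R) => //.
    - move=> x; rewrite ger0_norm// ler_pM ?sqr_ge0 ?le_max ?lexx//.
        by rewrite -real_normK ?num_real// lerXn2r ?nnegrE// (le_trans _ (gC x)).
      by rewrite ge_max ler0n/= gerBl enorm_ge0.
    - by move=> x xN; rewrite /h max_l ?subr_le0// mulr0.
  have h00 : (\int[mu]_x `|(h x)%:E| = 0)%E.
    under eq_integral do rewrite gee0_abs ?lee_fin//.
    rewrite -(fineK (integrable_fin_num measurableT ih)); congr (_%:E).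
    exact: gchi.
  have /(ae_eq_integral_abs mu measurableT) : measurable_fun setT (EFin \o h) by exact/measurable_EFinP.
  move=> [/(_ h00) + _]; apply: (@filterS _ _ FF) => x /(_ I) /= [].
  by [].
have := ae_foralln gae.
apply: (@filterS _ _ FF) => x gx.
(* The integer radius N + 1 with N = truncn |x| exceeds |x|, so the cutoff is positive at x and g x
   must vanish. *)
have := gx (Num.truncn (enorm x)).
have xN := truncnS_gt (enorm x).
rewrite max_r ?subr_ge0 ?(ltW xN)// => /eqP.
rewrite mulf_eq0 subr_eq0 [_ == enorm x]gt_eqF// orbF sqrf_eq0 /g.
by rewrite subr_eq0 subr_eq => /eqP ->; rewrite addrC.
Qed.

End QuotientLimit.

Lemma ae_forall_count d (S : measurableType d) (R : realType)
    (mu : {measure set S -> \bar R}) (I : countType) (P : I -> S -> Prop) :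
  (forall i, {ae mu, forall x, P i x}) -> {ae mu, forall x, forall i, P i x}.
Proof.
move=> aeP.
have /ae_foralln : forall k, {ae mu, forall x, forall i, unpickle k = Some i -> P i x}.
  move=> k; case: (unpickle k) => [i|]; last by apply: aeW => x i.
  by apply: (@filterS _ _ (ae_filter_ringOfSetsType mu)) (aeP i) => x Pix j [<-].
apply: (@filterS _ _ (ae_filter_ringOfSetsType mu)) => x h i.
by apply: (h (pickle i)); rewrite pickleK.
Qed.

(** Frechet differentiability spelled out in the Euclidean norm, in the same shape as
    [is_plane_gradient]. *)
Definition is_grad {R : realType} {n} (f : 'rV[R]_n -> R) (x G : 'rV[R]_n) :=
  forall e : R, 0 < e -> exists2 delta : R, 0 < delta &
  forall v : 'rV[R]_n, enorm v < delta -> `|f (x + v) - f x - dot G v| <= e * enorm v.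

Lemma quot_cvg_grad (R : realType) n (f : 'rV[R]_n -> R) x G :
  is_grad f x G -> forall z, quot f z k x @[k --> \oo] --> dot G z.
Proof.
move=> fG z; apply/cvgrPdist_le => e e0.
have z1 : 0 < enorm z + 1 by rewrite ltr_wpDl ?enorm_ge0.
have [d d0 hd] := fG _ (divr_gt0 e0 z1).
have [N Nd] := ltr_add_invr (divr_gt0 d0 z1).
exists N => // k /= Nk; have k0 : 0 < k.+1%:R^-1 :> R by rewrite invr_gt0.
have kN : k.+1%:R^-1 < d / (enorm z + 1).
  rewrite add0r in Nd; apply: le_lt_trans Nd.
  by rewrite lef_pV2 ?posrE// ler_nat.
have kz : enorm (k.+1%:R^-1 *: z) < d.
  rewrite enormZ gtr0_norm//; move: kN; rewrite ltr_pdivlMr//.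
  by apply: le_lt_trans; rewrite ler_wpM2l ?(ltW k0)// lerDl.
have := hd _ kz; rewrite enormZ (gtr0_norm k0) => h.
rewrite distrC /quot.
have -> : k.+1%:R * (f (x + k.+1%:R^-1 *: z) - f x) - dot G z =
    k.+1%:R * (f (x + k.+1%:R^-1 *: z) - f x - dot G (k.+1%:R^-1 *: z)).
  have -> : dot G (k.+1%:R^-1 *: z) = k.+1%:R^-1 * dot G z.
    rewrite !dotE mulr_sumr; apply: eq_bigr => j _; rewrite [X in _ * X = _]mxE; ring.
  by rewrite [RHS]mulrBr mulrA mulfV// mul1r.
rewrite normrM normr_nat -ler_pdivlMl// (le_trans h)// mulrCA ler_wpM2l ?(ltW k0)//.
by rewrite mulrAC ler_pdivrMr// ler_wpM2l ?(ltW e0)// lerDl.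
Qed.

Lemma enorm_delta (R : realType) n (i : 'I_n) : enorm (delta_mx 0 i : 'rV[R]_n) = 1.
Proof.
rewrite enormE (bigD1 i)//= big1 => [|j ij]; first by rewrite mxE !eqxx expr1n addr0 sqrtr1.
by rewrite mxE (negPf ij) andbF expr0n.
Qed.

Section Gradient.
Context {R : realType} {n : nat}.
Variables (f : 'rV[R]_n -> R) (L : R).
Hypothesis L0 : 0 <= L.
Hypothesis fL : forall x y, `|f x - f y| <= L * enorm (x - y).

Definition gradient x : 'rV[R]_n := \row_i dquot f (delta_mx 0 i) x.

Let zr (w : 'rV[int]_n) : 'rV[R]_n := map_mx intr w.

(** An additive function on Z^n is determined by its values on the basis; over the integers
    additivity alone yields linearity. *)
Let dquot_int x : (forall w w', dquot f (zr w + zr w') x = dquot f (zr w) x + dquot f (zr w') x) ->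
  forall w, dquot f (zr w) x = dot (gradient x) (zr w).
Proof.
move=> fD w; pose a w := dquot f (zr w) x.
have a0 : a 0 = 0.
  have : a (0 + 0) = a 0 + a 0 by rewrite /a -fD /zr map_mxD.
  by rewrite addr0 => /eqP; rewrite -subr_eq subrr => /eqP.
have aB : zmod_morphism a.
  have aD w1 w2 : a (w1 + w2) = a w1 + a w2 by rewrite /a -fD /zr map_mxD.
  move=> w1 w2; rewrite aD; congr (_ + _); apply/eqP.
  by rewrite -addr_eq0 -aD addNr a0.
pose A : {additive 'rV[int]_n -> R} := HB.pack a (GRing.isZmodMorphism.Build _ _ a aB).
rewrite -[LHS]/(A w) {1}(row_sum_delta w) raddf_sum dotE; apply: eq_bigr => i _.
rewrite -[_ *: _](_ : delta_mx 0 i *~ w 0 i = _); last by rewrite -scaler_int intz.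
rewrite raddfMz -mulrzr !mxE; congr (_ * _).
by rewrite /A/= /a /zr map_delta_mx.
Qed.

(* A vector v is approximated by w / k with w integral and k of the order of
   K / |v|; only finitely many w, with coordinates in [-K, K], occur. *)
Let grad_of_int x :
  (forall w, quot f (zr w) k x @[k --> \oo] --> dot (gradient x) (zr w)) ->
  is_grad f x (gradient x).
Proof.
set G := gradient x => fw e e0.
(* With t = 1 / (k + 1), the errors are L t n for moving v to t w, t for the quotient, and |G| t n
   for the linear part. The factor 2 pays for K / |v| < k + 2 <= 2 (k + 1), and K >= B / e then
   makes their sum at most e |v|. *)
pose B := 2 * (L * n%:R + 1 + enorm G * n%:R).
pose K := (Num.truncn (B / e)).+1.
have KB : B <= e * K%:R by rewrite mulrC -ler_pdivrMr// ltW// truncnS_gt.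
(* The 2 K + 1 indices per coordinate, shifted by K, enumerate the integers from -K to K. *)
pose wt (b : {ffun 'I_n -> 'I_(K + K).+1}) : 'rV[int]_n := \row_i ((b i)%:Z - K%:Z).
have [N hN] : exists N, forall b k, (N <= k)%N ->
    `|quot f (zr (wt b)) k x - dot G (zr (wt b))| <= 1.
  have hb b : exists N, forall k, (N <= k)%N ->
    `|quot f (zr (wt b)) k x - dot G (zr (wt b))| <= 1.
    have /cvgrPdist_le/(_ 1 ltr01)[N _ hN] := fw (wt b).
    by exists N => k Nk; rewrite distrC; exact: hN.
  pose Nb b := projT1 (cid (hb b)).
  exists (\max_b Nb b) => b k Nk; apply: (projT2 (cid (hb b))).
  exact: leq_trans (leq_bigmax b) Nk.
exists (K%:R / N.+1%:R) => [|v vd]; first by rewrite divr_gt0.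
set s := enorm v in vd *.
have [s0|s0] := eqVneq s 0.
  have dG0 : dot G 0 = 0 by rewrite dotE big1// => j _; rewrite [X in _ * X]mxE mulr0.
  by rewrite s0 (enorm0_eq0 s0) addr0 dG0 !subrr normr0 mulr0.
have {}s0 : 0 < s by rewrite lt_neqAle eq_sym s0 enorm_ge0.
have NK : N.+1%:R < K%:R / s.
  by rewrite ltr_pdivlMr// mulrC -ltr_pdivlMr.
(* k + 1 is the integer part of K / |v|; the choice of the radius K / (N + 1) guarantees k >= N. *)
have [k Nk] : exists2 k, (N <= k)%N & k.+1%:R <= K%:R / s < k.+2%:R.
  have Ks0 : 0 <= K%:R / s by rewrite divr_ge0// ltW.
  have /andP[t1 t2] := truncn_itv Ks0.
  have mN : (N < Num.truncn (K%:R / s))%N.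
    rewrite ltnNge; apply/negP => mN; have := lt_trans NK t2.
    by rewrite ltr_nat ltnS ltnNge mN.
  exists (Num.truncn (K%:R / s)).-1; first by rewrite -ltnS prednK// (leq_trans _ mN).
  by rewrite prednK ?t1// (leq_trans _ mN).
move=> /andP[k1 k2].
pose t : R := k.+1%:R^-1.
pose w : 'rV[int]_n := \row_i Num.floor (v 0 i * k.+1%:R).
have ks : k.+1%:R * s <= K%:R by rewrite -ler_pdivlMr.
have k0 : 0 < k.+1%:R :> R by [].
have [b wb] : exists b, wt b = w.
  have wK i : - K%:Z <= w 0 i <= K%:Z.
    have := coord_le_enorm v i; rewrite -/s ler_norml mxE => /andP[v1 v2].
    apply/andP; split.
      rewrite floor_ge_int_tmp rmorphN/= lerNl -mulNr.
      by rewrite (le_trans _ ks)// mulrC ler_wpM2l ?(ltW k0)// lerNl.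
    rewrite -(ler_int R) (le_trans (floor_le _))//=.
    by rewrite (le_trans _ ks)// mulrC ler_wpM2l ?(ltW k0).
  exists [ffun i => inord (absz (w 0 i + K%:Z))].
  apply/rowP => i; have /andP[w1 w2] := wK i; rewrite mxE ffunE inordK.
    by rewrite gez0_abs ?addrK// -(opprK K%:Z) subr_ge0.
  rewrite ltnS -lez_nat gez0_abs; first by rewrite PoszD lerD2r.
  by rewrite -(opprK K%:Z) subr_ge0.
have vw : enorm (v - t *: zr w) <= t * n%:R.
  rewrite mulrC; apply: enorm_le_max => [|j]; first by rewrite invr_ge0.
  rewrite !mxE (_ : v 0 j - _ = t * (v 0 j * k.+1%:R - (Num.floor (v 0 j * k.+1%:R))%:~R)).
    rewrite normrM gtr0_norm ?invr_gt0//.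
  rewrite ger_pMr ?invr_gt0//.
  have /andP[] := floor_itv (v 0 j * k.+1%:R); rewrite intrD => f1 f2.
  by rewrite ler_norml; apply/andP; split; lra.
  by rewrite mulrBr /t mulrCA mulVf ?gt_eqF// mulr1.
have ts : t * (L * n%:R + 1 + enorm G * n%:R) <= e * s.
  rewrite /t ler_pdivrMl//; move: k2; rewrite ltr_pdivrMr// -natr1 => k2.
  have k2' : K%:R <= 2 * (k.+1%:R * s).
    apply: (le_trans (ltW k2)); rewrite mulrDl mulr2n mulrDl mul1r lerD2l.
    by rewrite ler_wpM2r ?(ltW s0)// ler1n.
  have := ler_wpM2l (ltW e0) k2'; rewrite /B in KB.
  by rewrite (mulrCA e) (mulrCA k.+1%:R); lra.
rewrite (_ : _ - _ - _ = (f (x + v) - f (x + t *: zr w)) +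
   t * (quot f (zr w) k x - dot G (zr w)) + dot G (t *: zr w - v)); last first.
  have dB : dot G (t *: zr w - v) = t * dot G (zr w) - dot G v.
    rewrite !dotE mulr_sumr -sumrB; apply: eq_bigr => j _.
    have -> : (t *: zr w - v) 0 j = t * zr w 0 j - v 0 j by rewrite !mxE.
    by ring.
  by rewrite dB /quot -/t mulrBr mulrA mulVf ?gt_eqF// mul1r; ring.
apply: le_trans (le_trans (ler_normD _ _) (lerD (ler_normD _ _) (lexx _))) _.
apply: le_trans ts; rewrite [leRHS]mulrDr [X in _ <= X + _]mulrDr mulr1.
have t0 : 0 < t by rewrite invr_gt0.
apply: lerD; first apply: lerD.
- rewrite (le_trans (fL _ _))// opprD addrACA subrr add0r mulrCA.
  by rewrite ler_wpM2l.
- by rewrite normrM gtr0_norm// ger_pMr// -wb hN.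
- rewrite (le_trans (dot_le _ _))// mulrCA ler_wpM2l ?enorm_ge0// enormB.
  exact: vw.
Qed.

Lemma measurable_gradient_comp (h : 'rV[R]_n -> R) : continuous h ->
  measurable_fun setT (fun x : caratheodory_type (@hausdorff_outer R n n) => h (gradient x)).
Proof.
apply: (@measurable_continuous_comp R n _ (caratheodory_type (@hausdorff_outer R n n))
  gradient h) => i.
under eq_fun do rewrite mxE.
exact: measurable_dquot fL _.
Qed.

Lemma measurable_gradient_norm : measurable_fun setT
  (fun x : caratheodory_type (@hausdorff_outer R n n) => enorm (gradient x)).
Proof.
apply: measurable_gradient_comp.
by apply: (@lipschitz_continuous _ _ _ 1) => x y; rewrite mul1r; exact: enorm_dist.
Qed.

Lemma measurable_gradient_dot (z : 'rV[R]_n) : measurable_fun setT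
  (fun x : caratheodory_type (@hausdorff_outer R n n) => dot (gradient x) z).
Proof.
apply: (@measurable_gradient_comp (fun u => dot u z)).
apply: (@lipschitz_continuous _ _ _ (enorm z)) => x y.
rewrite (_ : dot x z - dot y z = dot (x - y) z); first by rewrite mulrC dot_le.
by rewrite !dotE -sumrB; apply: eq_bigr => j _; rewrite !mxE mulrBl.
Qed.

Lemma gradient_bound x : enorm (gradient x) <= n%:R * L.
Proof.
by apply: enorm_le_max => // j; rewrite mxE -[leRHS]mulr1 -(enorm_delta R j) (dquot_bound fL).
Qed.

(** Countably many null sets are discarded: one for each integral direction (convergence) and one
    for each pair of them (additivity). *)
Lemma rademacher : {ae @volume R n, forall x, is_grad f x (gradient x)}.
Proof.
have FF : Filter (almost_everywhere (@volume R n)) := ae_filter_ringOfSetsType (@volume R n).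
have h1 : {ae @volume R n, forall x, forall w : 'rV[int]_n,
    quot f (zr w) k x @[k --> \oo] --> dquot f (zr w) x}.
  by apply: ae_forall_count => w; exact: dquot_ae fL _.
have h2 : {ae @volume R n, forall x, forall p : 'rV[int]_n * 'rV[int]_n,
    dquot f (zr p.1 + zr p.2) x = dquot f (zr p.1) x + dquot f (zr p.2) x}.
  by apply: ae_forall_count => p; exact: dquotD fL _ _.
move: h1 h2; apply: (@filterS2 _ _ FF) => x h1 h2; apply: grad_of_int => w.
rewrite -dquot_int//.
by move=> w1 w2; exact: (h2 (w1, w2)).
Qed.

End Gradient.

(** * Poincare inequality on convex sets *)

Lemma measurable_abs_EFin d (S : measurableType d) (R : realType) (D : set S) (g : S -> R) :
  measurable_fun D g -> measurable_fun D (fun x => (`|g x|)%:E).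
Proof. by move=> mg; apply/measurable_EFinP; exact: measurableT_comp mg. Qed.

Section PoincareConvex.
Context {R : realType} {n : nat}.
Notation T := (caratheodory_type (@hausdorff_outer R n n)).
Notation mu := (@volume R n).
Local Open Scope ereal_scope.

Lemma ge0_integral_shift (w : 'rV[R]_n) (D : set T) (F : T -> \bar R) :
  measurable D -> measurable_fun D F -> (forall y, D y -> 0 <= F y) ->
  \int[mu]_(x in [set x : T | D (x + w)%R]) F (x + w)%R = \int[mu]_(y in D) F y.
Proof.
move=> mD mF F0.
have := @ge0_integral_similarity R n n n (fun x => x + w)%R 1%R ltr01 _ D F mD _ mF F0.
rewrite expr1n mul1e => -> //.
  by move=> x y; rewrite opprD addrACA subrr addr0 mul1r.
by move=> y _; exists (y - w)%R => //; rewrite subrK.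
Qed.

Variables (f : 'rV[R]_n -> R) (L : R).
Hypothesis L0 : (0 <= L)%R.
Hypothesis fL : forall x y, (`|f x - f y| <= L * enorm (x - y))%R.

Variable K : set T.
Hypothesis mK : measurable K.
Hypothesis K_convex : forall x y (t : R), K x -> K y -> (0 <= t <= 1)%R -> K (x + t *: (y - x))%R.
Hypothesis K_fin : mu K < +oo.

Let integrable_cst_fin (c : R) : mu.-integrable K (fun=> c%:E).
Proof.
apply/integrableP; split; first exact: measurable_cst.
rewrite (eq_integral (cst `|c%:E|))// integral_cst//; exact: lte_mul_pinfty.
Qed.

Let f_cont : continuous f := lipschitz_continuous fL.

Let Kz (z : 'rV[R]_n) : set T := K `&` [set x | K (x + z)%R].

Let mKz z : measurable (Kz z).
Proof. by apply: measurableI => //; exact: measurable_shift. Qed.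

Let msub (w w' : 'rV[R]_n) (D : set T) :
  measurable_fun D (fun x : T => (`|f (x + w) - f (x + w')|)%:E).
Proof.
exact: measurable_abs_EFin (measurable_funTS (measurable_funB
  (measurable_continuous_shift w f_cont) (measurable_continuous_shift w' f_cont))).
Qed.

Lemma translate_le_quot z k :
  \int[mu]_(x in Kz z) (`|f (x + z) - f x|)%:E <= \int[mu]_(x in K) (`|quot f z k x|)%:E.
Proof.
pose e : R := k.+1%:R^-1%R.
have e0 : (0 < e)%R by rewrite invr_gt0.
pose p i : 'rV[R]_n := (i%:R * e) *: z.
pose h (x : T) : \bar R := (`|f (x + e *: z) - f x|)%:E.
have mh D : measurable_fun D h.
  rewrite (_ : h = fun x : T => (`|f (x + e *: z) - f (x + 0)|)%:E); last first.
    by apply/funext => x; rewrite /h addr0.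
  exact: msub.
apply: (@le_trans _ _ (\sum_(i < k.+1) \int[mu]_(x in Kz z) h (x + p i)%R)).
  have mhp i : measurable_fun (Kz z) (fun x : T => h (x + p i)%R).
    rewrite (_ : (fun x => _) = fun x : T => (`|f (x + (p i + e *: z)) - f (x + p i)|)%:E).
      exact: msub.
    by apply/funext => x; rewrite /h addrA.
  rewrite -ge0_integral_sum//; last by move=> i x _; rewrite lee_fin.
  apply: ge0_le_integral; first exact: mKz.
  - by move=> x _; rewrite lee_fin.
  - rewrite (_ : (fun x => _) = fun x : T => (`|f (x + z) - f (x + 0)|)%:E); first exact: msub.
    by apply/funext => x; rewrite addr0.
  - by apply: emeasurable_sum => i; exact: mhp.
  - move=> x _; rewrite sumEFin lee_fin.
    have -> : (f (x + z) - f x = \sum_(i < k.+1) (f (x + p i + e *: z) - f (x + p i)))%R.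
      have -> : (f (x + z) - f x = f (x + p k.+1) - f (x + p 0%N))%R.
        by rewrite /p mul0r scale0r addr0 mulfV// scale1r.
      rewrite -(telescope_sumr (fun i => f (x + p i)))// big_mkord.
      apply: eq_bigr => i _; congr (f _ - _)%R.
      by rewrite /p -addrA -scalerDl -natr1 mulrDl mul1r.
    exact: ler_norm_sum.
apply: (@le_trans _ _ (\sum_(i < k.+1) \int[mu]_(x in K) h x)).
  apply: lee_sum => i _.
  (* D is [Kz z] translated by p i. It lies in K by convexity: y is on the segment from y - p i to y
     - p i + z, whose ends are in K. *)
  pose D : set T := [set y | Kz z (y - p i)%R].
  have mD : measurable D by exact: (measurable_shift (- p i)%R (mKz z)).
  rewrite (_ : Kz z = [set x | D (x + p i)%R]); last first.
    by apply/seteqP; split => x; rewrite /D/= addrK.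
  rewrite (ge0_integral_shift (p i) mD (mh D)); last by move=> y _; rewrite lee_fin.
  apply: ge0_subset_integral => //.
    by move=> y _; rewrite lee_fin.
  move=> y [Ky1 Ky2].
  have -> : y = (y - p i + (i%:R * e) *: (y - p i + z - (y - p i)))%R.
    by rewrite [(_ + z - _)%R]addrC addKr subrK.
  apply: K_convex => //; rewrite mulr_ge0 ?(ltW e0)//=.
  by rewrite ler_pdivrMr// mul1r ler_nat ltnW.
have -> : \int[mu]_(x in K) (`|quot f z k x|)%:E = k.+1%:R%:E * \int[mu]_(x in K) h x.
  rewrite -ge0_integralZl//; last by move=> x _; rewrite lee_fin.
  by apply: eq_integral => x _; rewrite /quot normrM normr_nat EFinM.
rewrite (eq_bigr (fun=> 1%:E * \int[mu]_(x in K) h x)) => [|i _]; last by rewrite mul1e.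
rewrite -ge0_sume_distrl; last by move=> i _; rewrite lee_fin.
by rewrite sumEFin sumr_const card_ord.
Qed.

Lemma translate_le_gradient z :
  \int[mu]_(x in Kz z) (`|f (x + z) - f x|)%:E <=
  (enorm z)%:E * \int[mu]_(x in K) (enorm (gradient f x))%:E.
Proof.
have mq k : measurable_fun K (fun x : T => (`|quot f z k x|)%:E).
  exact: measurable_abs_EFin (measurable_funTS (measurable_quot fL z k)).
have mg : measurable_fun K (fun x : T => (enorm (gradient f x))%:E).
  by apply/measurable_EFinP; exact: measurable_funTS (measurable_gradient_norm fL).
have md : measurable_fun K (fun x : T => (`|dot (gradient f x) z|)%:E).
  exact: measurable_abs_EFin (measurable_funTS (measurable_gradient_dot fL z)).
have ez0 : 0 <= (enorm z)%:E by rewrite lee_fin enorm_ge0.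
apply: (@le_trans _ _ (\int[mu]_(x in K) (`|dot (gradient f x) z|)%:E)); last first.
  rewrite -(ge0_integralZl mu mK mg) => [|x _|]; [|by rewrite lee_fin enorm_ge0|by []].
  have mg2 : measurable_fun K (fun x : T => (enorm z)%:E * (enorm (gradient f x))%:E).
    exact: (emeasurable_funM (measurable_cst _) mg).
  apply: (ge0_le_integral mu mK _ md mg2) => x _; first by rewrite lee_fin.
  by rewrite -EFinM lee_fin mulrC; exact: dot_le.
have FF : Filter (almost_everywhere mu) := ae_filter_ringOfSetsType mu.
have cvgq : {ae mu, forall x, K x -> (fun k => (`|quot f z k x|)%:E) @ \oo --> (`|dot (gradient f x) z|)%:E}.
  have := rademacher L0 fL; apply: (@filterS _ _ FF) => x gx _.
  have c1 : ((fun k => `|quot f z k x|) @ \oo --> `|dot (gradient f x) z|)%R.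
    by apply: cvg_norm; exact: quot_cvg_grad.
  by apply: cvg_EFin; [exact: nearW|exact: c1].
have ibound : mu.-integrable K (fun=> (L * enorm z)%:E).
  exact: integrable_cst_fin.
have bound : {ae mu, forall x, forall k, K x -> `|(`|quot f z k x|)%:E| <= (L * enorm z)%:E}.
  by apply: aeW => x k _; rewrite lee_fin normr_id; exact: (quot_bound fL).
have [_ _ cvg_int] := dominated_convergence mK mq md cvgq ibound bound.
rewrite -(cvg_lim (@ereal_hausdorff R) cvg_int).
apply: lime_ge; first by apply/cvg_ex; eexists; exact: cvg_int.
by apply: nearW => k; exact: translate_le_quot.
Qed.

End PoincareConvex.

Section PoincareDouble.
Context {R : realType} {n : nat}.
Notation T := (caratheodory_type (@hausdorff_outer R n n)).
Notation mu := (@volume R n).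
Local Open Scope ereal_scope.

(** Tonelli's theorem asks for measurability in the product sigma-algebra. A ball cap reduces to
    this open case, being an open ball minus the open complement of the closed disc. *)
Lemma measurable_preimage_add (K : set 'rV[R]_n) : open K ->
  measurable [set p : T * T | K (p.1 + p.2)%R].
Proof.
apply: (@measurable_preimage_open R n _ (T * T)%type (fun p => p.1 + p.2)%R) => i.
rewrite (_ : (fun s => _) = (fun p : T * T => p.1 0 i + p.2 0 i)%R); last first.
  by apply/funext => p; rewrite mxE.
apply: measurable_funD.
- exact: (measurableT_comp (@measurable_coord R n n i) measurable_fst).
- exact: (measurableT_comp (@measurable_coord R n n i) measurable_snd).
Qed.

Variables (f : 'rV[R]_n -> R) (L : R).
Hypothesis L0 : (0 <= L)%R.
Hypothesis fL : forall x y, (`|f x - f y| <= L * enorm (x - y))%R.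

Variable K : set T.
Hypothesis mK : measurable K.
Hypothesis mKadd : measurable [set p : T * T | K (p.1 + p.2)%R].
Hypothesis K_convex : forall x y (t : R), K x -> K y -> (0 <= t <= 1)%R -> K (x + t *: (y - x))%R.
Variable rho : R.
Hypothesis rho0 : (0 < rho)%R.
Hypothesis K_rho : forall x y, K x -> K y -> (enorm (y - x) < rho)%R.
Hypothesis K_fin : mu K < +oo.

Let f_cont : continuous f := lipschitz_continuous fL.
Let g (x : T) : \bar R := (enorm (gradient f x))%:E.

(** Substituting y = x + z turns the double oscillation into the integral of Phi over pairs (x, z);
    exchanging the order of integration then replaces a fixed base point x by a fixed translation
    z. *)
Let Q : set (T * T) := (K `*` setT) `&` [set p | K (p.1 + p.2)%R].
Let Phi (p : T * T) : \bar R := (\1_Q p * `|f (p.1 + p.2) - f p.1|)%R%:E.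

Let mPhi : measurable_fun setT Phi.
Proof.
have mQ : measurable Q by apply: measurableI => //; exact: measurableX.
apply/measurable_EFinP; apply: measurable_funM; first exact: measurable_indic.
have m1 : measurable_fun setT (fun p : T * T => f (p.1 + p.2)%R).
  apply: (@measurable_continuous_comp R n _ (T * T)%type (fun p => p.1 + p.2)%R f _ f_cont) => i.
  rewrite (_ : (fun s => _) = (fun p : T * T => p.1 0 i + p.2 0 i)%R); last first.
    by apply/funext => p; rewrite mxE.
  apply: measurable_funD.
  - exact: (measurableT_comp (@measurable_coord R n n i) measurable_fst).
  - exact: (measurableT_comp (@measurable_coord R n n i) measurable_snd).
have m2 : measurable_fun setT (fun p : T * T => f p.1).
  exact: (measurableT_comp (@measurable_continuous R n n f f_cont) measurable_fst).
exact: measurableT_comp (measurable_funB m1 m2).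
Qed.

Let Phi0 p : 0 <= Phi p.
Proof. by rewrite lee_fin mulr_ge0. Qed.

Let mdiff (c : R) (D : set T) : measurable_fun D (fun y : T => (`|f y - c|)%:E).
Proof.
exact: measurable_abs_EFin (measurable_funTS (measurable_funB
  (@measurable_continuous R n n f f_cont) (measurable_cst c))).
Qed.

Let oscillation_E x : K x ->
  \int[mu]_(y in K) (`|f y - f x|)%:E = \int[mu]_z Phi (x, z).
Proof.
move=> Kx.
rewrite -(ge0_integral_shift x mK (@mdiff (f x) K)); last by move=> y _; rewrite lee_fin.
rewrite [LHS]integral_mkcond; apply: eq_integral => z _; rewrite patchE /Phi indicE.
case: ifPn => [|zK]; first by rewrite inE/= addrC => Kxz; rewrite mem_set ?mul1r.
rewrite memNset ?mul0r// => -[_ /=]; rewrite addrC => Kxz.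
by move: zK; rewrite notin_setE.
Qed.

Lemma measurable_oscillation : measurable_fun K
  (fun x : T => \int[mu]_(y in K) (`|f y - f x|)%:E).
Proof.
have mF := @measurable_fun_fubini_tonelli_F _ _ _ _ _ mu Phi mPhi Phi0.
apply: (eq_measurable_fun _ _ (measurable_funTS mF)) => x; rewrite inE => Kx.
exact/esym/oscillation_E.
Qed.

(** Only translations with |z| < rho connect two points of K, and each contributes at most rho times
    the integral of |grad f|. *)
Lemma double_oscillation_le :
  \int[mu]_(x in K) \int[mu]_(y in K) (`|f y - f x|)%:E <=
  (rho)%:E * mu (eball 0 rho) * \int[mu]_(x in K) g x.
Proof.
have g0 x : 0 <= g x by rewrite lee_fin enorm_ge0.
have F_E : \int[mu]_(x in K) \int[mu]_(y in K) (`|f y - f x|)%:E = \int[mu]_x \int[mu]_z Phi (x, z).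
  rewrite [LHS]integral_mkcond; apply: eq_integral => x _; rewrite patchE.
  case: ifPn => [|xK]; last first.
    rewrite integral0_eq// => z _; rewrite /Phi indicE memNset ?mul0r//.
    by move=> [[/= Kx _] _]; move: xK; rewrite notin_setE.
  by rewrite inE => Kx; exact: oscillation_E.
rewrite F_E (fubini_tonelli Phi mPhi Phi0).
have G_E z : \int[mu]_x Phi (x, z) = \int[mu]_(x in K `&` [set x : T | K (x + z)%R]) (`|f (x + z) - f x|)%:E.
  rewrite [RHS]integral_mkcond; apply: eq_integral => x _; rewrite patchE /Phi indicE.
  case: ifPn => [|xK]; first by rewrite inE => -[Kx Kxz]; rewrite mem_set ?mul1r.
  rewrite memNset ?mul0r// => -[[/= Kx _] Kxz].
  by move: xK; rewrite notin_setE => /(_ (conj Kx Kxz)).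
have c0 : 0 <= rho%:E * \int[mu]_(x in K) g x.
  by rewrite mule_ge0 ?integral_ge0// lee_fin ltW.
have mG := @measurable_fun_fubini_tonelli_G _ _ _ _ _ mu Phi mPhi Phi0.
apply: (@le_trans _ _ (\int[mu]_(z in eball 0%R rho) (rho%:E * \int[mu]_(x in K) g x))).
  rewrite [leRHS]integral_mkcond; apply: (ge0_le_integral mu measurableT _ mG).
  - by move=> z _; rewrite integral_ge0.
  - have me := @measurable_eball R n 0 rho.
    by apply: (measurable_restrictT _ me).1; exact: measurable_cst.
  - move=> z _; rewrite [leLHS]G_E patchE; case: ifPn => [|zr].
      rewrite inE /eball/= subr0 => zr.
      apply: (le_trans (translate_le_gradient L0 fL mK K_convex K_fin z)).
      by apply: lee_wpmul2r; [apply: integral_ge0 => x _; exact: g0|rewrite lee_fin ltW].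
    rewrite (_ : _ `&` _ = set0) ?integral_set0//.
    apply/seteqP; split => x //= -[Kx Kxz]; move: zr; rewrite notin_setE; apply.
    by have := K_rho Kx Kxz; rewrite /eball/= subr0 addrAC subrr add0r.
rewrite integral_cst; last exact: measurable_eball.
by rewrite muleAC.
Qed.

End PoincareDouble.

Section PoincareAverage.
Context {R : realType} {n : nat}.
Notation T := (caratheodory_type (@hausdorff_outer R n n)).
Notation mu := (@volume R n).

Variables (f : 'rV[R]_n -> R) (L : R).
Hypothesis L0 : 0 <= L.
Hypothesis fL : forall x y, `|f x - f y| <= L * enorm (x - y).

Variable K : set T.
Hypothesis mK : measurable K.
Hypothesis mKadd : measurable [set p : T * T | K (p.1 + p.2)].
Hypothesis K_convex : forall x y (t : R), K x -> K y -> 0 <= t <= 1 -> K (x + t *: (y - x)).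
Variable rho : R.
Hypothesis rho0 : 0 < rho.
Hypothesis K_rho : forall x y, K x -> K y -> enorm (y - x) < rho.
Variable m : R.
Hypothesis m0 : 0 < m.
Hypothesis K_m : mu K = m%:E.

Let K_fin : (mu K < +oo)%E. Proof. by rewrite K_m ltry. Qed.
Let f_cont : continuous f := lipschitz_continuous fL.

Lemma integrable_bounded_on (h : T -> R) (B : R) : measurable_fun K h ->
  (forall x, K x -> `|h x| <= B) -> mu.-integrable K (EFin \o h).
Proof.
move=> mh hB.
apply: (measurable_bounded_integrable mK K_fin mh).
exists B; split; first exact: num_real.
by move=> y By x Kx; apply: (le_trans (hB x Kx)); exact: ltW.
Qed.

Let K0 : exists x0, K x0.
Proof.
apply: contrapT => /forallNP Kn; have Ke : K = set0 by apply/seteqP; split => x // /Kn.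
by have := K_m; rewrite Ke measure0 => -[] e; move: m0; rewrite -e ltxx.
Qed.

Let c := m^-1 * \int[mu]_(x in K) f x.
Let g x := enorm (gradient f x).

Let mf : measurable_fun K (f : T -> R) := measurable_funTS (@measurable_continuous R n n f f_cont).

Let mdiff (b : R) : measurable_fun K (fun y : T => f y - b) :=
  measurable_funB mf (measurable_cst b).

Let mabs (b : R) : measurable_fun K (fun y : T => `|f y - b|).
Proof. exact: measurableT_comp (mdiff b). Qed.

Let fB x : K x -> forall y, K y -> `|f y - f x| <= L * rho.
Proof.
by move=> Kx y Ky; rewrite (le_trans (fL _ _))// ler_wpM2l// ltW// K_rho.
Qed.

Let if_ : mu.-integrable K (EFin \o f).
Proof.
have [x0 Kx0] := K0; apply: (@integrable_bounded_on _ (`|f x0| + L * rho)) => // x Kx.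
by rewrite -{1}(subrK (f x0) (f x)) (le_trans (ler_normD _ _))// addrC lerD2l fB.
Qed.

Let icst (b : R) : mu.-integrable K (EFin \o (fun=> b)).
Proof. by apply: (@integrable_bounded_on _ `|b|). Qed.

Let iabs x : K x -> mu.-integrable K (EFin \o (fun y => `|f y - f x|)).
Proof.
move=> Kx; apply: (@integrable_bounded_on _ (L * rho)) => // y Ky.
by rewrite normr_id fB.
Qed.

Lemma avg_dist_le x : K x -> `|f x - c| <= m^-1 * \int[mu]_(y in K) `|f y - f x|.
Proof.
move=> Kx.
have -> : f x - c = m^-1 * - \int[mu]_(y in K) (f y - f x).
  rewrite RintegralB// Rintegral_cst// [X in _ * fine X]K_m /= opprB mulrBr /c; congr (_ - _).
  by rewrite mulrC mulfK// gt_eqF.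
rewrite normrM gtr0_norm ?invr_gt0// ler_pM2l ?invr_gt0// normrN.
apply: le_normr_Rintegral => //.
by apply: (@integrable_bounded_on _ (L * rho)) => // y Ky; exact: fB.
Qed.

Let mg : measurable_fun K (g : T -> R) := measurable_funTS (measurable_gradient_norm fL).

Let ig : mu.-integrable K (EFin \o g).
Proof.
apply: (@integrable_bounded_on _ (n%:R * L)) => // x Kx.
by rewrite ger0_norm ?enorm_ge0// (gradient_bound L0 fL).
Qed.

Let ig2 : mu.-integrable K (EFin \o (fun x => g x ^+ 2)).
Proof.
apply: (@integrable_bounded_on _ ((n%:R * L) ^+ 2)) => [|x Kx].
  exact: measurable_funX.
by rewrite normrX ger0_norm ?enorm_ge0// lerXn2r ?nnegrE ?mulr_ge0 ?enorm_ge0// (gradient_bound L0 fL).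
Qed.

Lemma mean_oscillation_le : m^-1 * \int[mu]_(x in K) `|f x - c| <=
  m^-1 * (m^-1 * (rho * (rho ^+ n * ball_volume n) * \int[mu]_(x in K) g x)).
Proof.
rewrite ler_pM2l ?invr_gt0// -lee_fin.
have iK : mu.-integrable K (EFin \o (fun x => `|f x - c|)).
  have ifc : mu.-integrable K (EFin \o (fun x => f x - c)).
    by apply: eq_integrable (integrableB mK if_ (icst c)).
  exact: eq_integrable (integrable_abse ifc).
rewrite /Rintegral fineK ?(integrable_fin_num mK iK)//.
have m0' : (0 <= m^-1%:E)%E by rewrite lee_fin invr_ge0 ltW.
have mosc := measurable_oscillation fL mK mKadd.
apply: (@le_trans _ _ (\int[mu]_(x in K) (m^-1%:E * \int[mu]_(y in K) (`|f y - f x|)%:E))%E).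
  have mosc' : measurable_fun K (fun x => m^-1%:E * \int[mu]_(y in K) (`|f y - f x|)%:E)%E.
    exact: emeasurable_funM (measurable_cst _) mosc.
  apply: (ge0_le_integral mu mK _ _ mosc') => [x _||x Kx]; first by rewrite lee_fin.
    by apply/measurable_EFinP; exact: mabs.
  rewrite (@le_trans _ _ (m^-1 * \int[mu]_(y in K) `|f y - f x|)%:E) ?lee_fin ?avg_dist_le//.
  by rewrite EFinM /Rintegral fineK ?(integrable_fin_num mK (iabs Kx)).
rewrite (ge0_integralZl mu mK mosc _ m0'); last first.
  by move=> x _; apply: integral_ge0 => y _; rewrite lee_fin.
rewrite EFinM lee_wpmul2l//.
apply: (le_trans (double_oscillation_le L0 fL mK mKadd K_convex rho0 K_rho K_fin)).
have gE : (\int[mu]_(x in K) (g x)%:E)%E = (\int[mu]_(x in K) g x)%:E.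
  by rewrite /Rintegral fineK// (integrable_fin_num mK ig).
by rewrite gE volume_eball// -!EFinM.
Qed.

(** Expansion of the integral of (g - a)^2 >= 0, with a the mean of g. *)
Lemma jensen_sqr : m^-1 * \int[mu]_(x in K) g x <=
  Num.sqrt (m^-1 * \int[mu]_(x in K) (g x ^+ 2)).
Proof.
set a := m^-1 * \int[mu]_(x in K) g x.
have a0 : 0 <= a.
  by rewrite mulr_ge0 ?invr_ge0 ?(ltW m0)// Rintegral_ge0// => x _; exact: enorm_ge0.
rewrite -[leLHS]ger0_norm// -sqrtr_sqr ler_wsqrtr//.
have : 0 <= \int[mu]_(x in K) ((g x - a) ^+ 2).
  by apply: Rintegral_ge0 => x _; exact: sqr_ge0.
have -> : \int[mu]_(x in K) ((g x - a) ^+ 2) =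
    \int[mu]_(x in K) (g x ^+ 2) - 2 * a * \int[mu]_(x in K) g x + a ^+ 2 * m.
  have i2g : mu.-integrable K (EFin \o (fun x => 2 * a * g x)).
    exact: eq_integrable (integrableZl mK (2 * a) ig).
  have iB : mu.-integrable K (EFin \o (fun x => g x ^+ 2 - 2 * a * g x)).
    exact: eq_integrable (integrableB mK ig2 i2g).
  rewrite -RintegralZl// -RintegralB// (_ : a ^+ 2 * m = \int[mu]_(x in K) (a ^+ 2)); last first.
    by rewrite Rintegral_cst// [X in _ * fine X]K_m.
  rewrite -RintegralD//.
  by apply: eq_Rintegral => x _; ring.
have aE : \int[mu]_(x in K) g x = m * a by rewrite /a mulrA mulfV ?gt_eqF// mul1r.
rewrite aE => h; rewrite ler_pdivlMl//; lra.
Qed.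

Lemma poincare_average :
  m^-1 * \int[mu]_(x in K) `|f x - m^-1 * \int[mu]_(y in K) f y| <=
  rho * (rho ^+ n * ball_volume n / m) *
  Num.sqrt (m^-1 * \int[mu]_(x in K) (enorm (gradient f x) ^+ 2)).
Proof.
apply: le_trans mean_oscillation_le _.
have b0 : 0 <= rho * (rho ^+ n * ball_volume n / m).
  rewrite !mulr_ge0 ?invr_ge0 ?exprn_ge0 ?(ltW rho0) ?(ltW m0)//.
  by rewrite -lee_fin -ball_volumeE hausdorff_ge0.
have := ler_wpM2l b0 jensen_sqr; apply: le_trans.
by rewrite le_eqVlt; apply/orP; left; apply/eqP; ring.
Qed.

End PoincareAverage.

(** * The flat disc *)

Section SimilarityImage.
Context {R : realType} {p q k : nat} (phi : 'rV[R]_p -> 'rV[R]_q) (c : R).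
Hypotheses (c0 : 0 < c) (phiE : forall x y, enorm (phi x - phi y) = c * enorm (x - y)).
Notation Tp := (caratheodory_type (@hausdorff_outer R p k)).
Notation Tq := (caratheodory_type (@hausdorff_outer R q k)).
Hypothesis mran : measurable (range phi : set Tq).

(** A test set is first split by the measurable range. Inside the range the criterion is carried
    over from A; the part outside belongs to the complement of the image. *)
Lemma measurable_image_similarity (A : set Tp) :
  measurable A -> measurable (phi @` A : set Tq).
Proof.
move=> mA; apply: le_caratheodory_measurable => X; rewrite /hausdorff_outer/=.
pose Y := phi @^-1` X.
have XY : X `&` range phi = phi @` Y.
  apply/seteqP; split => [y [Xy [x _ xy]]|_ [x Yx <-]]; [by exists x => //; rewrite /Y/= xy|by split => //; exists x].
have HX : hausdorff k X = (hausdorff k (X `&` range phi) + hausdorff k (X `&` ~` range phi))%E.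
  exact: mran X.
have HY : hausdorff k Y = (hausdorff k (Y `&` A) + hausdorff k (Y `&` ~` A))%E.
  exact: mA Y.
rewrite HX XY (hausdorff_similarity k c0 phiE) HY muleDr//; last first.
  by rewrite ge0_adde_def// inE hausdorff_ge0.
rewrite -!(hausdorff_similarity k c0 phiE) -addeA leeD//.
  by apply: le_hausdorff => y [Xy [x Ax xy]]; exists x => //; split => //; rewrite /Y/= xy.
apply: le_trans (hausdorffU2 _ _ _); apply: le_hausdorff => y [Xy Ay].
have [[x _ xy]|] := pselect (range phi y); last by right.
left; exists x => //; split; first by rewrite /Y/= xy.
by move=> Ax; apply: Ay; exists x.
Qed.

Lemma measurable_fun_similarity (D : set Tq) (F : Tq -> R) :
  D `<=` range phi -> measurable_fun (phi @^-1` D : set Tp) (F \o phi) -> measurable_fun D F.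
Proof.
move=> Dphi mF mD B mB.
have mD' : measurable (phi @^-1` D : set Tp).
  by have := measurable_similarity c0 phiE measurableT mD; rewrite setTI.
have := measurable_image_similarity (mF mD' B mB).
congr measurable; apply/seteqP; split => [_ [x [Dx Bx] <-]//|y [Dy By]].
by have [x _ xy] := Dphi _ Dy; exists x => //; split; rewrite /= xy.
Qed.

End SimilarityImage.

Section FlatDisc.
Context {R : realType} {n d : nat}.
Implicit Types (u v w : 'rV[R]_n).

Definition embed u : 'rV[R]_(n + d) := row_mx u 0.

Lemma enorm_embed u : enorm (embed u) = enorm u.
Proof.
rewrite !enormE big_split_ord/= [X in _ + X]big1 ?addr0 => [|j _]; last first.
  by rewrite row_mxEr mxE expr0n.
by congr Num.sqrt; apply: eq_bigr => j _; rewrite row_mxEl.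
Qed.

Lemma embedB u v : embed u - embed v = embed (u - v).
Proof. by rewrite /embed opp_row_mx add_row_mx subrr. Qed.

Lemma embedD u v : embed (u + v) = embed u + embed v.
Proof. by rewrite /embed add_row_mx addr0. Qed.

Lemma embedZ (c : R) u : embed (c *: u) = c *: embed u.
Proof. by rewrite /embed scale_row_mx scaler0. Qed.

Lemma dot_embed u v : dot (embed u) (embed v) = dot u v.
Proof.
rewrite !dotE big_split_ord/= [X in _ + X]big1 ?addr0 => [|j _]; last first.
  by rewrite row_mxEr mxE mul0r.
by apply: eq_bigr => j _; rewrite !row_mxEl.
Qed.

Lemma embed_inj : injective embed.
Proof. by move=> u v /eq_row_mx[]. Qed.

Lemma embed_isometry u v : enorm (embed u - embed v) = 1 * enorm (u - v).
Proof. by rewrite embedB enorm_embed mul1r. Qed.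

Lemma enorm_rsubmx (y : 'rV[R]_(n + d)) : enorm (rsubmx y) <= enorm y.
Proof.
rewrite !enormE ler_wsqrtr// big_split_ord/=.
rewrite [X in _ <= _ + X](eq_bigr (fun j => rsubmx y 0 j ^+ 2)) => [|j _]; last by rewrite mxE.
by rewrite lerDr sumr_ge0// => j _; exact: sqr_ge0.
Qed.

Lemma range_embedE : range embed = [set y | enorm (rsubmx y) <= 0].
Proof.
apply/seteqP; split => [_ [u _ <-]|y /= y0]; first by rewrite /= row_mxKr enorm0.
exists (lsubmx y) => //; rewrite /embed -[RHS]hsubmxK; congr row_mx.
by apply/esym/enorm0_eq0/eqP; rewrite eq_le y0 enorm_ge0.
Qed.

Let rsubmx_lip (x y : 'rV[R]_(n + d)) :
  `|enorm (rsubmx x) - enorm (rsubmx y)| <= 1 * enorm (x - y).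
Proof.
rewrite mul1r (le_trans (enorm_dist _ _))//.
by rewrite (_ : _ - _ = rsubmx (x - y)) ?enorm_rsubmx// linearB.
Qed.

Lemma closed_range_embed : closed (range embed).
Proof.
rewrite range_embedE.
have := @closed_comp _ _ (fun y => enorm (rsubmx y) : R) [set x | x <= 0].
apply; last exact: closed_le.
by move=> y _; exact: (lipschitz_continuous rsubmx_lip).
Qed.

Definition flat_disc : set 'rV[R]_(n + d) := embed @` eclball 0 1.

Lemma flat_discE : flat_disc = range embed `&` eclball 0 1.
Proof.
apply/seteqP; split => [_ [u u1 <-]|_ [[u _ <-] u1]].
  by split; [exists u|move: u1; rewrite /eclball/= !subr0 enorm_embed].
by exists u => //; move: u1; rewrite /eclball/= !subr0 enorm_embed.
Qed.

Lemma closed_flat_disc : closed flat_disc.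
Proof.
by rewrite flat_discE; apply: closedI; [exact: closed_range_embed|exact: closed_eclball].
Qed.

Definition ball_cap a (r : R) : set 'rV[R]_n := eclball 0 1 `&` eball a r.

Lemma flat_disc_ball a r : flat_disc `&` eball (embed a) r = embed @` ball_cap a r.
Proof.
apply/seteqP; split => [_ [[u u1 <-] ur]|_ [u [u1 ur] <-]].
  by exists u => //; split => //; move: ur; rewrite /eball/= embedB enorm_embed.
by split; [exists u|move: ur; rewrite /eball/= embedB enorm_embed].
Qed.

Lemma hausdorff_embed A : hausdorff n (embed @` A) = hausdorff n A.
Proof. by rewrite (hausdorff_similarity n ltr01 embed_isometry) expr1n mul1e. Qed.

Notation T := (caratheodory_type (@hausdorff_outer R n n)).
Notation TN := (caratheodory_type (@hausdorff_outer R (n + d) n)).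
Notation mu := (@volume R n).

Lemma measurable_ball_cap a r : measurable (ball_cap a r : set T).
Proof.
apply: measurableI; last exact: measurable_eball.
exact/measurable_closed/closed_eclball.
Qed.

Let mran : measurable (range embed : set TN).
Proof. exact/measurable_closed/closed_range_embed. Qed.

Lemma Rintegral_embed (A : set T) (F : TN -> R) : measurable A ->
  measurable_fun A (F \o embed) ->
  \int[hausdorff_measure n]_(y in embed @` A) F y = \int[mu]_(u in A) F (embed u).
Proof.
move=> mA mF.
have preA : embed @^-1` (embed @` A) = A.
  by apply/seteqP; split => [u [v Av /embed_inj <-]//|u Au]; exists u.
have sub : embed @` A `<=` range embed by move=> _ [u _ <-]; exists u.
have mEA := measurable_image_similarity ltr01 embed_isometry mran mA.
have mFE : measurable_fun (embed @` A : set TN) F.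
  by apply: (measurable_fun_similarity ltr01 embed_isometry mran sub); rewrite preA.
rewrite (Rintegral_similarity ltr01 embed_isometry mEA sub mFE).
by rewrite expr1n mul1r preA.
Qed.

End FlatDisc.

(** * Averages over caps of the disc, and their size *)

Section BallCap.
Context {R : realType} {n d : nat}.
Implicit Types (a u v w : 'rV[R]_n).
Notation T := (caratheodory_type (@hausdorff_outer R n n)).
Notation TN := (caratheodory_type (@hausdorff_outer R (n + d) n)).
Notation mu := (@volume R n).
Notation embed := (@embed R n d).
Notation flat_disc := (@flat_disc R n d).

(** F will involve tangent planes, which are known only off the bounding sphere. A measurable G that
    agrees with it almost everywhere is enough, since Caratheodory measures are complete. *)
Lemma avg_flat_disc a (r : R) (F : TN -> R) (G : T -> R) :
  measurable_fun (ball_cap a r : set T) G ->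
  {ae mu, forall u, ball_cap a r u -> F (embed u) = G u} ->
  avg n flat_disc (embed a) r F =
  (fine (hausdorff n (ball_cap a r)))^-1 * \int[mu]_(u in ball_cap a r) G u.
Proof.
move=> mG FG; have FF : Filter (almost_everywhere mu) := ae_filter_ringOfSetsType mu.
have mF : measurable_fun (ball_cap a r : set T) (F \o embed).
  have mG' : measurable_fun (ball_cap a r : set T) (EFin \o G) by exact/measurable_EFinP.
  apply/measurable_EFinP.
  apply: (ae_measurable_fun (@measure_is_complete_caratheodory R _ (@hausdorff_outer R n n)) _ mG').
  by apply: (@filterS _ _ FF) FG => u h Ku; rewrite /= h.
rewrite /avg /ball_mass flat_disc_ball.
rewrite [X in (fine X)^-1](hausdorff_embed (d := d) (ball_cap a r)).
rewrite (Rintegral_embed (measurable_ball_cap a r) mF).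
congr (_ * _); rewrite /Rintegral; congr fine; apply: ae_eq_integral.
- exact: measurable_ball_cap.
- exact/measurable_EFinP.
- exact/measurable_EFinP.
- by apply: (@filterS _ _ FF) FG => u h Ku; rewrite /= h.
Qed.

Lemma ball_cap_convex a (r : R) u v (t : R) :
  ball_cap a r u -> ball_cap a r v -> 0 <= t <= 1 -> ball_cap a r (u + t *: (v - u)).
Proof.
rewrite /ball_cap /eclball /eball/= => -[u1 ur] [v1 vr] /andP[t0 t1].
have E x : enorm (u + t *: (v - u) - x) <= (1 - t) * enorm (u - x) + t * enorm (v - x).
  have -> : u + t *: (v - u) - x = (1 - t) *: (u - x) + t *: (v - x).
    by apply/rowP => i; rewrite !mxE; ring.
  by rewrite (le_trans (ler_enormD _ _))// !enormZ !ger0_norm// subr_ge0.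
(* At t = 1 the term (1 - t) |u - a| no longer supplies the strict inequality required by the open
   ball. *)
have [t10|t10] := leP (1 - t) 0.
  have -> : t = 1 by apply/eqP; rewrite eq_le t1/=; rewrite subr_le0 in t10.
  by rewrite scale1r [u + _]addrC subrK.
split.
- rewrite /eclball/= (le_trans (E 0))//.
  have := ler_wpM2l t0 v1; have := ler_wpM2l (ltW t10) u1; lra.
- rewrite /eball/= (le_lt_trans (E a))//.
  have := ler_wpM2l t0 (ltW vr); move: ur; rewrite -(ltr_pM2l t10) => h1 h2; lra.
Qed.

Lemma measurable_ball_cap_add a (r : R) :
  measurable [set p : T * T | ball_cap a r (p.1 + p.2)].
Proof.
rewrite (_ : mkset _ = ~` [set p : T * T | (~` eclball 0 1) (p.1 + p.2)] `&`
   [set p : T * T | eball a r (p.1 + p.2)]); last first.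
  apply/seteqP; split => p [h1 h2]; split => //.
  exact: contrapT h1.
apply: measurableI; first apply: measurableC.
- by apply: measurable_preimage_add; apply: closed_openC; exact: closed_eclball.
- by apply: measurable_preimage_add; exact: open_eball.
Qed.

(** The cap has diameter at most 2 min(r, 1); the factor 4 leaves room for strictness. *)
Lemma ball_cap_diam a (r : R) u v : 0 < r -> ball_cap a r u -> ball_cap a r v ->
  enorm (v - u) < 4 * Num.min r 1.
Proof.
move=> r0 [u1 ur] [v1 vr].
have h x : enorm (v - u) <= enorm (v - x) + enorm (u - x).
  by rewrite -(enormN (u - x)) opprB (le_trans _ (ler_enormD _ _))// addrA subrK.
have := h 0; have := h a; move: u1 v1 ur vr; rewrite /eclball/eball/=.
by case: (leP r 1) => _ *; lra.
Qed.

Lemma hausdorff_ball_cap_fin a (r : R) : hausdorff n (ball_cap a r) \is a fin_num.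
Proof.
rewrite ge0_fin_numE ?hausdorff_ge0//.
apply: (@hausdorff_bounded R n _ 2) => u [u1 _].
by move: u1; rewrite /eclball/eball/=; lra.
Qed.

Lemma hausdorff_ball_cap_le a (r : R) : 0 < r ->
  fine (hausdorff n (ball_cap a r)) <= r ^+ n * ball_volume n.
Proof.
move=> r0; rewrite -lee_fin fineK ?hausdorff_ball_cap_fin// -(hausdorff_eballE a r0).
by apply: le_hausdorff => u [].
Qed.

(** The homothety of centre a and ratio t = min(r, 1) / 4 maps the closed disc into the cap: into
    the disc by convexity, and into the ball since t |w - a| <= 2 t < r. *)
Lemma hausdorff_ball_cap_ge a (r : R) : 0 < r -> enorm a <= 1 ->
  (Num.min r 1 / 4) ^+ n * ball_volume n <= fine (hausdorff n (ball_cap a r)).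
Proof.
move=> r0 a1; set t := Num.min r 1 / 4.
have t0 : 0 < t by rewrite divr_gt0// lt_min r0 ltr01.
have tr : t < r / 2 by rewrite /t; case: (leP r 1) => ?; lra.
have t1 : t <= 1 by rewrite /t; case: (leP r 1) => ?; lra.
pose phi w := a + t *: (w - a).
have phiE x y : enorm (phi x - phi y) = t * enorm (x - y).
  rewrite (_ : _ - _ = t *: (x - y)) ?enormZ ?gtr0_norm//.
  by apply/rowP => i; rewrite /phi !mxE; ring.
rewrite -lee_fin fineK ?hausdorff_ball_cap_fin// EFinM -hausdorff_eclball.
rewrite -(hausdorff_similarity n t0 phiE); apply: le_hausdorff => _ [w w1 <-].
move: w1; rewrite /eclball/= subr0 => w1.
split.
- rewrite /eclball/= subr0.
  have -> : phi w = (1 - t) *: a + t *: w by apply/rowP => i; rewrite /phi !mxE; ring.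
  rewrite (le_trans (ler_enormD _ _))// !enormZ (gtr0_norm t0) ger0_norm ?subr_ge0//.
  have := ler_wpM2l (ltW t0) w1; have : (1 - t) * enorm a <= (1 - t) * 1.
    by rewrite ler_wpM2l ?subr_ge0.
  lra.
- rewrite /eball/= /phi addrAC subrr add0r enormZ gtr0_norm//.
  have h : enorm (w - a) <= 2 by rewrite (le_trans (ler_enormD _ _))// enormN; lra.
  have := ler_wpM2l (ltW t0) h; lra.
Qed.

End BallCap.

(** * Tangent plane of the flat disc *)

Section Gradients.
Context {R : realType} {m : nat}.
Implicit Types (f : 'rV[R]_m -> R) (x y v G : 'rV[R]_m).

Lemma enorm_le_norm x : enorm x <= m%:R * `|x|.
Proof.
apply: enorm_le_max => // j.
by rewrite [leRHS]mx_normrE; apply: (le_trans _ (le_bigmax _ _ (0, j))).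
Qed.

Lemma norm_le_enorm x : `|x| <= enorm x.
Proof.
rewrite [leLHS]mx_normrE; apply/bigmax_leP; split; first exact: enorm_ge0.
by move=> [i j] _ /=; rewrite ord1 coord_le_enorm.
Qed.

Lemma dotBr G x y : dot G (x - y) = dot G x - dot G y.
Proof. by rewrite !dotE -sumrB; apply: eq_bigr => j _; rewrite !mxE mulrBr. Qed.

Lemma dot_self x : dot x x = enorm x ^+ 2.
Proof. by rewrite sqr_enorm dotE; apply: eq_bigr => j _; rewrite expr2. Qed.

Lemma dot_lipschitz G x y : `|dot G x - dot G y| <= enorm G * enorm (x - y).
Proof. by rewrite -dotBr dot_le. Qed.

Lemma is_grad_differentiable f x G : is_grad f x G ->
  differentiable f x /\ forall v, 'D_v f x = dot G v.
Proof.
move=> fG.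
have lin : linear_for *:%R (dot G : 'rV[R]_m -> R^o).
  move=> a u v; rewrite !dotE scaler_sumr -big_split/=.
  by apply: eq_bigr => j _; rewrite !mxE /GRing.scale/=; ring.
pose df : {linear 'rV[R]_m -> R^o} :=
  HB.pack (dot G : 'rV[R]_m -> R^o) (GRing.isLinear.Build R 'rV[R]_m R^o *:%R _ lin).
have dfc : continuous df by exact: (lipschitz_continuous (dot_lipschitz G)).
have E : (f : 'rV[R]_m -> R^o) \o shift x = cst (f x) + df +o_ (0 : 'rV[R]_m) id.
  apply/eqaddoP => e e0.
  (* The little-o is relative to the sup norm, whence the division of e by m + 1. *)
  have m0 : 0 < m.+1%:R :> R by [].
  have [dl dl0 h] := fG _ (divr_gt0 e0 m0).
  apply: (@filterS _ _ (nbhs_filter (0 : 'rV[R]_m)) _ _ _ (nbhs_eball 0 dl0)) => v.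
  rewrite /eball/= subr0 => /h hv.
  rewrite [X in `|X| <= _](_ : _ = f (x + v) - f x - dot G v); last first.
    by rewrite /= -[LHS]/(f (v + x) - (f x + dot G v)) (addrC v) opprD addrA.
  rewrite (le_trans hv)// -mulrA ler_wpM2l ?(ltW e0)// mulrC ler_pdivrMr//.
  by rewrite mulrC (le_trans (enorm_le_norm _))// ler_wpM2r// ler_nat.
have dE := diff_unique dfc E.
have fd : differentiable (f : 'rV[R]_m -> R^o) x.
  by apply: (proj2 (diff_locallyP x (f : 'rV[R]_m -> R^o))); rewrite dE.
by split => // v; rewrite (deriveE _ fd) dE.
Qed.

Lemma is_grad_unique f x G H : is_grad f x G -> is_grad f x H -> G = H.
Proof.
move=> /is_grad_differentiable[_ fG] /is_grad_differentiable[_ fH].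
apply/eqP; rewrite -subr_eq0; apply/eqP/enorm0_eq0/eqP.
rewrite -sqrf_eq0 -dot_self.
have /eqP : dot G (G - H) = dot H (G - H) by rewrite -fG fH.
rewrite -subr_eq0 => /eqP <-; apply/eqP.
by rewrite !dotE -sumrB; apply: eq_bigr => j _; rewrite !mxE; ring.
Qed.

End Gradients.

(** * A test function of class C^1 with compact support *)

Section Bump.
Context {R : realType} {m : nat} (p : 'rV[R]_m) (r : R).
Implicit Types (x y v : 'rV[R]_m).

Let q x := r ^+ 2 - enorm (x - p) ^+ 2.

(** The outer square makes the positive part continuously differentiable, which is the regularity
    asked of test functions. *)
Definition smooth_bump x : R := Num.max 0 (q x) ^+ 2.

(** Second-order Taylor bound for max(0, t)^2, whose derivative is 2 max(0, t). *)
Let pos_expand (t s : R) :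
  0 <= Num.max 0 (t + s) ^+ 2 - Num.max 0 t ^+ 2 - 2 * Num.max 0 t * s <= s ^+ 2.
Proof. by case: (leP 0 (t + s)) => h1; case: (leP 0 t) => h2; apply/andP; split; nra. Qed.

Let q_expand x v : q (x + v) = q x + (- 2 * dot (x - p) v - enorm v ^+ 2).
Proof.
have -> : q (x + v) = r ^+ 2 - (enorm (x - p) ^+ 2 + 2 * dot (x - p) v + enorm v ^+ 2).
  rewrite /q !sqr_enorm dotE mulr_sumr -!big_split/=; congr (_ - _).
  by apply: eq_bigr => j _; rewrite !mxE; ring.
rewrite /q; ring.
Qed.

Let G x := (- 4 * Num.max 0 (q x)) *: (x - p).

Lemma smooth_bump_grad x : is_grad smooth_bump x (G x).
Proof.
move=> e e0; set A := enorm (x - p); set B := Num.max 0 (q x).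
have A0 : 0 <= A := enorm_ge0 _.
have B0 : 0 <= B by rewrite /B le_max lexx.
(* The error is at most s^2 + 2 B |v|^2, where s is the increment of q and |s| <= (2 A + 1) |v| when
   |v| < 1. *)
pose C := (2 * A + 1) ^+ 2 + 2 * B.
have C0 : 0 < C by rewrite ltr_wpDr ?mulr_ge0// exprn_gt0// ltr_wpDl ?mulr_ge0.
exists (Num.min 1 (e / C)) => [|v]; first by rewrite lt_min ltr01 divr_gt0.
rewrite lt_min ltr_pdivlMr// => /andP[v1 ve].
have v0 : 0 <= enorm v := enorm_ge0 v.
have GE : dot (G x) v = - 4 * B * dot (x - p) v.
  by rewrite !dotE mulr_sumr; apply: eq_bigr => j _; rewrite [X in X * _ = _]mxE -/B; ring.
have hd := dot_le (x - p) v; rewrite -/A in hd.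
set D := dot (x - p) v in hd GE.
set V := enorm v in v1 ve v0 hd *.
rewrite /smooth_bump q_expand -/B GE; set s := (- 2 * D - V ^+ 2).
have sle : s ^+ 2 <= (2 * A + 1) ^+ 2 * V ^+ 2.
  rewrite -exprMn -real_normK ?num_real// ler_sqr ?nnegrE ?mulr_ge0 ?addr_ge0 ?mulr_ge0//.
  rewrite /s (le_trans (ler_normB _ _))// normrM normrN [`|2|]gtr0_norm//.
  rewrite [`|V ^+ 2|]ger0_norm ?sqr_ge0//.
  nra.
have /andP[h1 h2] := pos_expand (q x) s; rewrite -/B in h1 h2.
apply: (@le_trans _ _ (C * V ^+ 2)).
  rewrite ler_norml /C; apply/andP; split; rewrite /s in h1 h2 sle *; nra.
by rewrite expr2 mulrA ler_wpM2r// mulrC; exact: ltW.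
Qed.

Lemma continuous_enorm_sub : continuous (fun x => enorm (x - p)).
Proof.
apply: (@lipschitz_continuous R m _ 1) => x y; rewrite mul1r.
by rewrite (le_trans (enorm_dist _ _))// opprB addrA subrK.
Qed.

Lemma smooth_bump_support x : smooth_bump x != 0 -> enorm (x - p) < `|r|.
Proof.
rewrite /smooth_bump sqrf_eq0; case: (leP 0 (q x)) => [q0 qn|_]; last by rewrite eqxx.
rewrite ltNge; apply/negP => h; move: qn; apply/negP; rewrite negbK eq_le q0 andbT.
by rewrite /q subr_le0 -(real_normK (num_real r)) ler_sqr ?nnegrE ?enorm_ge0.
Qed.

Lemma smooth_bump_C1 : C1_compact_support smooth_bump.
Proof.
split.
- by move=> x; have [] := is_grad_differentiable (smooth_bump_grad x).
- move=> v.
  rewrite (_ : (fun x => _) = (fun x => (- 4 * Num.max 0 (q x)) * dot v (x - p))); last first.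
    apply/funext => x; have [_ ->] := is_grad_differentiable (smooth_bump_grad x).
    by rewrite !dotE mulr_sumr; apply: eq_bigr => j _; rewrite [X in X * _ = _]mxE; ring.
  have qc x : {for x, continuous q}.
    apply: (@continuousB R R _ (cst (r ^+ 2)) (fun x => enorm (x - p) ^+ 2)); first exact: cst_continuous.
    by apply: continuousM; exact: continuous_enorm_sub.
  move=> x; apply: (@continuousM _ _ (fun x => - 4 * Num.max 0 (q x)) (fun x => dot v (x - p))).
    apply: (@continuousM _ _ (cst (- 4)) (fun x => Num.max 0 (q x))); first exact: cst_continuous.
    by apply: (@continuous_max R _ (cst 0) q); [exact: cst_continuous|exact: qc].
  apply: (@lipschitz_continuous R m _ (enorm v)) => y z.
  by rewrite (le_trans (dot_lipschitz _ _ _))// opprB addrA subrK.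
- apply: bounded_closed_compact; last exact: closed_closure.
  exists (`|r| + enorm p); split; first exact: num_real.
  move=> M Mr x /=.
  have sub : closure [set x | smooth_bump x != 0] `<=` eclball p `|r|.
    rewrite [X in _ `<=` X](closure_id _).1; last exact: closed_eclball.
    by apply: (@closure_subset _ _ (eclball p `|r|)) => y /= /smooth_bump_support/ltW.
  move=> /sub; rewrite /eclball/= => xr.
  rewrite (le_trans (norm_le_enorm _))//.
  have := enorm_dist x p; rewrite ler_norml => /andP[_ h]; lra.
Qed.

End Bump.

Lemma ball_volume_pos (R : realType) n : (0 < n)%N -> 0 < ball_volume n :> R.
Proof. by case: n => // n _; exact: ball_volume_gt0. Qed.

Section TangentPlane.
Context {R : realType} {n d : nat}.
Implicit Types (a u v w : 'rV[R]_n) (P : 'M[R]_(n + d)).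
Notation T := (caratheodory_type (@hausdorff_outer R n n)).
Notation mu := (@volume R n).
Notation embed := (@embed R n d).
Notation flat_disc := (@flat_disc R n d).

Lemma C1_compact_support_bounded m (f : 'rV[R]_m -> R) : C1_compact_support f ->
  continuous f /\ exists2 r : R, 0 < r & forall y, r <= enorm y -> f y = 0.
Proof.
move=> [fd _ fc]; split; first by move=> x; apply: differentiable_continuous; exact: fd.
have [M [Mr hM]] := compact_bounded fc.
pose B := Num.max M 0 + 1.
have MB : M < B by rewrite /B ltr_pwDr// le_max lexx.
have B0 : 0 < B by rewrite /B ltr_pwDr// le_max lexx orbT.
exists (m%:R * B + 1) => [|y hy]; first by rewrite ltr_pwDr// mulr_ge0// ltW.
apply/eqP/negPn/negP => fy; have /= yB := hM _ MB y (@subset_closure _ [set x | f x != 0] y fy).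
move: hy; apply/negP; rewrite -ltNge (le_lt_trans (enorm_le_norm _))//.
by rewrite (@le_lt_trans _ _ (m%:R * B))// ?ler_wpM2l// ltrDl.
Qed.

Definition flat_plane : 'M[R]_(n + d) := pid_mx n.

Lemma mulmx_flat_plane (y : 'rV[R]_(n + d)) : y *m flat_plane = embed (lsubmx y).
Proof.
rewrite /flat_plane -[pid_mx n]/(pid_mx n) pid_mx_block -{1}[y]hsubmxK mul_row_block.
by rewrite mulmx1 !mulmx0 !addr0.
Qed.

Lemma sub_flat_plane : [set y : 'rV[R]_(n + d) | (y <= flat_plane)%MS] = range embed.
Proof.
apply/seteqP; split => [y /= /submxP[D ->]|_ [u _ <-] /=].
  by rewrite mulmx_flat_plane; exists (lsubmx D).
by rewrite -[embed u](_ : embed u *m flat_plane = _) ?submxMl// mulmx_flat_plane row_mxKl.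
Qed.

Lemma rank_flat_plane : \rank flat_plane = n.
Proof. by rewrite /flat_plane rank_pid_mx ?leq_addr. Qed.

Lemma continuous_embed_comp (f : 'rV[R]_(n + d) -> R) : continuous f ->
  measurable_fun setT (f \o embed : T -> R).
Proof.
move=> fc; have := measurable_similarity (k := n) ltr01 (@embed_isometry R n d).
exact: (measurableT_comp (@measurable_continuous R (n + d) n f fc)).
Qed.

Lemma Rintegral_flat_plane (f : 'rV[R]_(n + d) -> R) : continuous f ->
  \int[hausdorff_measure n]_(y in [set y : 'rV[R]_(n + d) | (y <= flat_plane)%MS]) f y =
  \int[mu]_u f (embed u).
Proof.
by move=> fc; rewrite sub_flat_plane; exact: (Rintegral_embed measurableT (continuous_embed_comp fc)).
Qed.

(** Once h r < 1 - |a|, the rescaled test function vanishes on the plane outside the disc, so the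
    blown-up integral already equals its limit. *)
Lemma flat_disc_blowup a (f : 'rV[R]_(n + d) -> R) : enorm a < 1 -> C1_compact_support f ->
  \forall h \near 0^'+, h ^- n *
     Rintegral (hausdorff_measure n) flat_disc (fun y => f (h^-1 *: (y - embed a))) =
  \int[mu]_u f (embed u).
Proof.
move=> a1 /C1_compact_support_bounded[fc [r r0 fr]].
have e0 : 0 < (1 - enorm a) / r by rewrite divr_gt0// subr_gt0.
near=> h.
have h0 : 0 < h by near: h; exact: nbhs_right_gt.
have hr : h * r < 1 - enorm a.
  by rewrite -ltr_pdivlMr//; near: h; exact: nbhs_right_lt.
pose phi u := h^-1 *: (u - a).
have phiE x y : enorm (phi x - phi y) = h^-1 * enorm (x - y).
  rewrite (_ : _ - _ = h^-1 *: (x - y)) ?enormZ ?gtr0_norm ?invr_gt0//.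
  by apply/rowP => i; rewrite /phi !mxE; ring.
have phiK u : phi (a + h *: u) = u.
  by rewrite /phi addrAC subrr add0r scalerA mulVf ?gt_eqF// scale1r.
have hV0 : 0 < h^-1 by rewrite invr_gt0.
have mF := continuous_embed_comp fc.
have mFphi : measurable_fun setT ((f \o embed) \o phi : T -> R).
  exact: (measurableT_comp mF (measurable_similarity (k := n) hV0 phiE)).
have E u : f (h^-1 *: (embed u - embed a)) = f (embed (phi u)).
  by rewrite embedB -embedZ.
have m1 : measurable (eclball 0 1 : set T) by apply: measurable_closed; exact: closed_eclball.
rewrite /flat_disc (Rintegral_embed m1); last first.
  rewrite (_ : _ \o _ = (f \o embed) \o phi); last by apply/funext => u; exact: E.
  exact: (measurable_funTS mFphi).
have -> : \int[mu]_(u in eclball 0 1) f (h^-1 *: (embed u - embed a)) =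
    \int[mu]_u f (embed (phi u)).
  rewrite /Rintegral; congr fine; rewrite integral_mkcond; apply: eq_integral => u _.
  rewrite patchE; case: ifPn => [_|u1]; first by rewrite /= E.
  rewrite fr// enorm_embed /phi enormZ gtr0_norm// ler_pdivlMl//.
  rewrite leNgt; apply: contra u1 => u1; rewrite inE /eclball/= subr0.
  have -> : u = a + (u - a) by rewrite addrC subrK.
  rewrite (le_trans (ler_enormD _ _))//; lra.
have sub : [set: 'rV[R]_n] `<=` range phi by move=> u _; exists (a + h *: u).
have := Rintegral_similarity hV0 phiE measurableT sub mF.
by move=> ->; rewrite preimage_setT exprVn.
Unshelve. all: by end_near. Qed.

Lemma is_approx_tangent_flat_disc a P : enorm a < 1 ->
  is_approx_tangent n flat_disc (embed a) P <->
  \rank P = n /\ forall f, C1_compact_support f ->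
    Rintegral (hausdorff_measure n) [set y | (y <= P)%MS] f = \int[mu]_u f (embed u).
Proof.
move=> a1; split => -[rP fP]; split => // f fC; have hf := flat_disc_blowup a1 fC.
  apply: (cvg_unique _ (fP f fC)) => //.
  exact: cvg_near_cst.
by rewrite fP//; exact: cvg_near_cst.
Qed.

(** The blow-up condition with a eliminated: [xget] therefore selects the same plane at every
    interior point. *)
Let tangents : set 'M[R]_(n + d) := [set P | \rank P = n /\ forall f, C1_compact_support f ->
    Rintegral (hausdorff_measure n) [set y | (y <= P)%MS] f = \int[mu]_u f (embed u)].

Definition disc_tangent : 'M[R]_(n + d) := xget 0 tangents.

Lemma approx_tangent_flat_disc a : enorm a < 1 ->
  approx_tangent n flat_disc (embed a) = disc_tangent.
Proof.
move=> a1; congr xget; apply/seteqP; split => P /(is_approx_tangent_flat_disc P a1) //.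
Qed.

Lemma disc_tangentP : \rank disc_tangent = n /\ forall f, C1_compact_support f ->
    Rintegral (hausdorff_measure n) [set y | (y <= disc_tangent)%MS] f = \int[mu]_u f (embed u).
Proof.
apply: (@xgetPex _ 0 tangents); exists flat_plane; split; first exact: rank_flat_plane.
by move=> f /C1_compact_support_bounded[fc _]; exact: Rintegral_flat_plane.
Qed.

Lemma Rintegral_smooth_bump_gt0 a (r : R) : (0 < n)%N -> 0 < r ->
  0 < \int[mu]_u smooth_bump (embed a) r (embed u).
Proof.
move=> n0 r0.
have [fc [s s0 fs]] := C1_compact_support_bounded (smooth_bump_C1 (embed a) r).
have mF := continuous_embed_comp fc.
(* Within distance r / 2 of the centre, r^2 - |u - a|^2 >= 3/4 r^2. *)
pose k := (3 / 4 * r ^+ 2) ^+ 2 : R.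
have k0 : 0 < k by rewrite exprn_gt0// mulr_gt0 ?exprn_gt0.
have b0 u : 0 <= smooth_bump (embed a) r (embed u) by exact: sqr_ge0.
have bk u : eball a (r / 2) u -> k <= smooth_bump (embed a) r (embed u).
  rewrite /eball/= => ur; rewrite /smooth_bump embedB enorm_embed.
  have h : 3 / 4 * r ^+ 2 <= r ^+ 2 - enorm (u - a) ^+ 2.
    have : enorm (u - a) ^+ 2 <= (r / 2) ^+ 2.
      by rewrite ler_sqr ?nnegrE ?enorm_ge0 ?(ltW ur)// divr_ge0// ltW.
    by rewrite expr_div_n; lra.
  rewrite ler_sqr ?nnegrE ?le_max ?lexx ?h ?orbT//.
  by rewrite mulr_ge0// exprn_ge0// ltW.
have supp : supported_in s (smooth_bump (embed a) r \o embed).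
  by move=> u su; apply: fs; rewrite enorm_embed.
have bB u : `|(smooth_bump (embed a) r \o embed) u| <= (r ^+ 2) ^+ 2.
  rewrite /= ger0_norm// /smooth_bump ler_sqr ?nnegrE ?sqr_ge0 ?le_max ?lexx//.
  by rewrite ge_max sqr_ge0/= lerBlDr lerDl sqr_ge0.
have int := integrable_supported s0 mF bB supp.
have r2 : 0 < r / 2 by rewrite divr_gt0.
rewrite -lte_fin /Rintegral fineK ?(integrable_fin_num _ int)//.
have mB := measurable_eball a (r / 2).
apply: (@lt_le_trans _ _ (\int[mu]_(u in eball a (r / 2)) k%:E)%E).
  rewrite integral_cst// [X in (_ * X)%E](volume_eball a r2).
  by rewrite -EFinM lte_fin !mulr_gt0// ?exprn_gt0 ?ball_volume_pos.
apply: (@le_trans _ _ (\int[mu]_(u in eball a (r / 2)) (smooth_bump (embed a) r (embed u))%:E)%E).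
  apply: (ge0_le_integral mu mB _ (measurable_cst _)) => [u _||u /bk]; last by rewrite lee_fin.
    by rewrite lee_fin ltW.
  by apply/measurable_EFinP; exact: (measurable_funTS mF).
apply: (ge0_subset_integral mu mB measurableT) => [|u _|//]; last by rewrite lee_fin.
exact/measurable_EFinP.
Qed.

Hypothesis n_gt0 : (0 < n)%N.

(* A smooth bump around a point of the flat plane outside the tangent space has
   zero integral over the latter but not over the former. *)
Lemma sub_disc_tangent : [set y | (y <= disc_tangent)%MS] = range embed.
Proof.
have [rT fT] := disc_tangentP.
(* Both planes have rank n, so one inclusion suffices. *)
suff h : (flat_plane <= disc_tangent)%MS.
  have /eqmxP e : (flat_plane == disc_tangent)%MS.
    by rewrite -(geq_leqif (mxrank_leqif_eq h)) rT rank_flat_plane.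
  by rewrite -sub_flat_plane; apply/seteqP; split => y /=; rewrite e.
apply/row_subP => i.
have [a _ aE] : range embed (row i flat_plane) by rewrite -sub_flat_plane /= row_sub.
rewrite -aE submxE; apply/eqP/rowP => j; rewrite [RHS]mxE; apply/eqP/negPn/negP => c0.
(* v is orthogonal to the tangent plane but not to [embed a], so the number r below is positive and
   at most the distance from [embed a] to that plane: the bump of radius r vanishes on it. *)
pose v := (col j (cokermx disc_tangent))^T.
have dotv (y : 'rV[R]_(n + d)) : dot y v = (y *m cokermx disc_tangent) 0 j.
  by rewrite /dot /v trmxK !mxE; apply: eq_bigr => l _; rewrite mxE.
pose r := `|dot (embed a) v| / (enorm v + 1).
have v1 : 0 < enorm v + 1 by rewrite ltr_wpDl ?enorm_ge0.
have r0 : 0 < r by rewrite divr_gt0// normr_gt0 dotv.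
have := Rintegral_smooth_bump_gt0 a n_gt0 r0.
rewrite -(fT _ (smooth_bump_C1 (embed a) r)) /Rintegral integral0_eq ?ltxx// => y /= yT.
congr (_%:E); apply/eqP/negPn/negP => /smooth_bump_support.
rewrite gtr0_norm// /r ltr_pdivlMr// ltNge => /negP; apply.
have y0 : dot y v = 0 by rewrite dotv; move: yT; rewrite submxE => /eqP ->; rewrite mxE.
have -> : dot (embed a) v = - dot (y - embed a) v.
  rewrite -[LHS]subr0 -y0 -opprB; congr (- _).
  by rewrite !dotE -sumrB; apply: eq_bigr => l _; rewrite !mxE; ring.
rewrite normrN (le_trans (dot_le _ _))// ler_wpM2l ?enorm_ge0// lerDl ler01//.
Qed.

End TangentPlane.

(** * Conditions (a), (b) and (c) for the disc *)

Section FlatDiscHypotheses.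
Context {R : realType} {n d : nat}.
Hypothesis n_gt0 : (0 < n)%N.
Implicit Types (a u v w : 'rV[R]_n).
Notation T := (caratheodory_type (@hausdorff_outer R n n)).
Notation mu := (@volume R n).
Notation embed := (@embed R n d).
Notation flat_disc := (@flat_disc R n d).
Notation beta := (@ball_volume R n).

Let beta0 : 0 < beta := ball_volume_pos R n_gt0.

Lemma ae_interior_disc : {ae mu, forall u, eclball 0 1 u -> enorm u < 1}.
Proof.
have mc : measurable (eclball 0 1 : set T) by apply: measurable_closed; exact: closed_eclball.
have mo := @measurable_eball R n 0 1.
exists (eclball 0 1 `\` eball 0 1); split.
- exact: measurableD.
- rewrite measureD//; last first.
    by rewrite [X in (X < _)%E](@hausdorff_eclball R n) ltry.
  rewrite setIidr => [|u]; last by rewrite /eball/eclball/=; exact: ltW.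
  rewrite [X in (X - _)%E](@hausdorff_eclball R n) [X in (_ - X)%E](@ball_volumeE R n).
  by rewrite subee.
- move=> u /= /not_implyP[u1 /negP]; rewrite -leNgt => u1'; split => //.
  by rewrite /eball/= subr0 => /(le_lt_trans u1'); rewrite ltxx.
Qed.

(** Whatever plane gradient is selected lies in R^n x {0}, hence comes from a gradient of
    [f \o embed] at u, and that is unique. *)
Lemma tangential_gradient_flat_disc (f : 'rV[R]_(n + d) -> R) u G : enorm u < 1 ->
  is_grad (f \o embed) u G -> tangential_gradient n flat_disc f (embed u) = embed G.
Proof.
move=> u1 fG; rewrite /tangential_gradient approx_tangent_flat_disc//.
have subT y : (y <= @disc_tangent R n d)%MS <-> range embed y by rewrite -(sub_disc_tangent n_gt0).
have [] := @xgetPex _ 0 [set g | is_plane_gradient f (@disc_tangent R n d) (embed u) g].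
  exists (embed G); split; first by apply/subT; exists G.
  move=> e /fG[dl dl0 h]; exists dl => // _ /subT[v _ <-]; rewrite enorm_embed => /h.
  by rewrite /= embedD dot_embed.
move=> /subT[H _ HE]; rewrite -HE => fH; congr embed.
apply: is_grad_unique fG => e /fH[dl dl0 h]; exists dl => // v vd.
have := h (embed v); rewrite enorm_embed dot_embed -embedD; apply => //.
by apply/subT; exists v.
Qed.

Lemma hausdorff_ball_cap_gt0 a (r : R) : enorm a <= 1 -> 0 < r ->
  0 < fine (hausdorff n (ball_cap a r)).
Proof.
move=> a1 r0; apply: lt_le_trans (hausdorff_ball_cap_ge r0 a1).
by rewrite mulr_gt0// exprn_gt0// divr_gt0// lt_min r0 ltr01.
Qed.

Lemma poincare_flat_disc : poincare_inequality n flat_disc (4 * 16 ^+ n) 1.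
Proof.
move=> _ r f [a a1 <-] r0 [L0 fL0].
rewrite /eclball/= subr0 in a1; rewrite mul1r.
pose L := `|L0|; pose g := f \o embed; set K := ball_cap a r.
have L_ge0 : 0 <= L by exact: normr_ge0.
have gL x y : `|g x - g y| <= L * enorm (x - y).
  rewrite (le_trans (fL0 _ _))// embedB enorm_embed ler_wpM2r ?enorm_ge0//.
  exact: ler_norm.
have gc := lipschitz_continuous gL.
have mK : measurable (K : set T) := measurable_ball_cap a r.
have mg : measurable_fun (K : set T) (g : T -> R).
  exact: (measurable_funTS (@measurable_continuous R n n g gc)).
set m := fine (hausdorff n K).
have m0 : 0 < m := hausdorff_ball_cap_gt0 a1 r0.
have mE : mu K = m%:E by rewrite fineK// hausdorff_ball_cap_fin.
have avgf : avg n flat_disc (embed a) r f = m^-1 * \int[mu]_(u in K) g u.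
  by apply: avg_flat_disc => //; exact: aeW.
rewrite avgf (@avg_flat_disc _ _ _ _ _ _ (fun u => `|g u - m^-1 * \int[mu]_(v in K) g v|)).
- rewrite (@avg_flat_disc _ _ _ _ _ _ (fun u => enorm (gradient g u) ^+ 2)).
  + set rho := 4 * Num.min r 1.
    have rho0 : 0 < rho by rewrite mulr_gt0// lt_min r0 ltr01.
    have rhor : rho <= 4 * r by rewrite ler_pM2l// ge_min lexx.
    have Kr u v : K u -> K v -> enorm (v - u) < rho by exact: ball_cap_diam.
    have := poincare_average L_ge0 gL mK (measurable_ball_cap_add a r)
      (@ball_cap_convex R n a r) rho0 Kr m0 mE.
    move=> /le_trans; apply; apply: ler_wpM2r; first exact: sqrtr_ge0.
    (* CP splits as 4 and 16^n: rho <= 4 r, and rho = 16 (min(r, 1) / 4), so the lower volume bound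
       of the cap gives rho^n beta / m <= 16^n. *)
    rewrite [leRHS]mulrAC; apply: ler_pM; [exact: ltW| |exact: rhor|].
      by rewrite mulr_ge0// ?mulr_ge0 ?exprn_ge0 ?invr_ge0 ?(ltW m0) ?(ltW beta0) ?(ltW rho0).
    rewrite ler_pdivrMr//.
    have := hausdorff_ball_cap_ge r0 a1; rewrite -/K -/m => h.
    rewrite (_ : rho = 16 * (Num.min r 1 / 4)); last by rewrite /rho; field.
    by rewrite exprMn -mulrA ler_wpM2l// exprn_ge0.
  + exact: (measurable_funTS (measurable_funX 2 (measurable_gradient_norm gL))).
  + have FF : Filter (almost_everywhere mu) := ae_filter_ringOfSetsType mu.
    apply: (@filterS2 _ _ FF) ae_interior_disc (rademacher L_ge0 gL) => u u1 gu [/u1 u1' _].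
    by rewrite (tangential_gradient_flat_disc u1' gu) enorm_embed.
- exact: (measurableT_comp (@normr_measurable R setT) (measurable_funB mg (measurable_cst _))).
- exact: aeW.
Qed.

Lemma carleson_flat_disc (eps : R) : 0 < eps -> carleson_condition n flat_disc eps.
Proof.
move=> eps0 _ [a a1 <-] _; rewrite integral0_eq ?lte_fin ?exprn_gt0// => r /=.
rewrite in_itv/= => /andP[r0 _]; rewrite /eclball/= subr0 in a1.
set K := ball_cap a r; have mK : measurable (K : set T) := measurable_ball_cap a r.
have FF : Filter (almost_everywhere mu) := ae_filter_ringOfSetsType mu.
have tE : {ae mu, forall u, K u ->
    tangent_proj n flat_disc (embed u) = orth_proj (@disc_tangent R n d)}.
  apply: (@filterS _ _ FF) ae_interior_disc => u u1 [/u1 u1' _].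
  by rewrite /tangent_proj approx_tangent_flat_disc.
have m0 := hausdorff_ball_cap_gt0 a1 r0.
have -> : avg_tangent_proj n flat_disc (embed a) r = orth_proj (@disc_tangent R n d).
  apply/matrixP => i j; rewrite mxE.
  rewrite (@avg_flat_disc _ _ _ _ _ _ (cst (orth_proj (@disc_tangent R n d) i j))).
  + rewrite Rintegral_cst// mulrCA [X in _^-1 * fine X](_ : _ = hausdorff n (ball_cap a r))//.
    by rewrite mulVf ?mulr1// gt_eqF.
  + exact: measurable_cst.
  + by apply: (@filterS _ _ FF) tE => u h Ku; rewrite h.
rewrite (@avg_flat_disc _ _ _ _ _ _ (cst 0)).
- by rewrite Rintegral_cst// mul0r mulr0 mul0r.
- exact: measurable_cst.
- apply: (@filterS _ _ FF) tE => u h Ku; rewrite h// subrr /enorm big1 ?sqrtr0 ?expr0n// => i _.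
  by rewrite big1// => j _; rewrite mxE expr0n.
Qed.

(** The constant dominates the upper density beta and the inverse 4^n / beta of the lower one; the
    summand 1 ensures that it is at least 1. *)
Lemma ahlfors_flat_disc : ahlfors_regular n flat_disc (1 + beta + 4 ^+ n / beta).
Proof.
split; first exact: closed_flat_disc.
move=> _ r [a a1 <-] /andP[r0 r1]; rewrite /eclball/= subr0 in a1.
rewrite /ball_mass flat_disc_ball [X in (_ <= X <= _)%E](hausdorff_embed (d := d) (ball_cap a r)).
rewrite -(fineK (hausdorff_ball_cap_fin a r)) !lee_fin.
have rn0 : 0 < r ^+ n by rewrite exprn_gt0.
have b4 : 0 < 4 ^+ n / beta by rewrite divr_gt0// exprn_gt0.
apply/andP; split.
- apply: le_trans (hausdorff_ball_cap_ge r0 a1).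
  rewrite (min_idPl r1) expr_div_n mulrC -mulrA ler_wpM2l ?(ltW rn0)//.
  rewrite -[leRHS]invrK lef_pV2 ?posrE ?invr_gt0 ?mulr_gt0 ?invr_gt0 ?exprn_gt0//; last first.
    by rewrite !addr_gt0.
  by rewrite invfM invrK lerDr addr_ge0// ltW.
- rewrite (le_trans (hausdorff_ball_cap_le a r0))// mulrC ler_wpM2r ?(ltW rn0)//.
  by rewrite -addrA addrCA lerDl addr_ge0// ltW.
Qed.

Lemma rectifiable_flat_disc : rectifiable n flat_disc.
Proof.
split; first exact: (measurable_closed n (@closed_flat_disc R n d)).
exists set0, (fun=> setT), (fun=> embed); split; first exact: hausdorff0.
- by move=> _; exists 1 => u v _ _; rewrite embed_isometry.
- by move=> _ [u _ <-]; right; exists 0%N => //; exists u.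
Qed.

Lemma flat_disc_hypotheses (eps : R) : 0 < eps ->
  parameterization_hypotheses n flat_disc (1 + beta + 4 ^+ n / beta) (4 * 16 ^+ n) 1 eps.
Proof.
move=> eps0; split; split.
- move=> _ [u u1 <-]; move: u1; rewrite /eball/eclball/= !subr0 enorm_embed => u1.
  by rewrite (le_lt_trans u1)// ltr1n.
- by exists 0; rewrite /eclball/= ?subr0 ?enorm0 ?ler01// /embed row_mx0.
- exact: rectifiable_flat_disc.
- exact: ahlfors_flat_disc.
- exact: poincare_flat_disc.
- exact: carleson_flat_disc.
Qed.

End FlatDiscHypotheses.

(** * Failure of Reifenberg flatness at the boundary *)

Lemma dist_set_lt (R : realType) m (x : 'rV[R]_m) (E : set 'rV[R]_m) (c : R) :
  E !=set0 -> dist_set x E < c -> exists2 y, E y & enorm (x - y) < c.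
Proof.
move=> [y0 Ey0] xc.
have hE : has_inf [set enorm (x - y) | y in E].
  split; first by exists (enorm (x - y0)), y0.
  by exists 0 => _ [y _ <-]; exact: enorm_ge0.
have cd : 0 < c - dist_set x E by rewrite subr_gt0.
have [_ [y Ey <-] h] := inf_adherent cd hE.
by exists y => //; rewrite (lt_le_trans h)// -/(dist_set x E) addrCA subrr addr0.
Qed.

(* At a boundary point x of the disc an approximating plane would contain the
   reflection through x of a point close to the disc, which is far from the disc. *)
Lemma flat_disc_not_reifenberg (R : realType) n d : (0 < n)%N ->
  not_reifenberg_flat n (@flat_disc R n d).
Proof.
(* With y at depth r / 2 and eps <= 1/10, a point p of the plane lies within r / 5 of y. Its
   reflection has first coordinate above 1 + r / 2 - r / 5, yet lies within r / 5 of the disc, whose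
   first coordinates are at most 1; this is impossible because 1/2 > 2/5. *)
move=> n_gt0; exists 10^-1; first by rewrite invr_gt0.
move=> eps /andP[eps0 eps1] [_ flat].
pose i0 : 'I_n := Ordinal n_gt0; pose e : 'rV[R]_n := delta_mx 0 i0.
have e1 : enorm e = 1 := enorm_delta R i0.
pose x : 'rV[R]_(n + d) := @embed R n d e; pose r : R := 10%:R ^- 4.
have r0 : 0 < r by rewrite invr_gt0 exprn_gt0.
have Mx : flat_disc x by exists e => //; rewrite /eclball/= subr0 e1.
have rle : 0 < r <= 10%:R ^- 4 by rewrite r0 lexx.
have [P [_ hP hE]] := flat x r Mx rle.
have er0 : 0 < eps * r by rewrite mulr_gt0.
have er1 : eps * r <= r / 10 by rewrite mulrC ler_wpM2l// ltW.
have half : `|1 - 1 / 2 * r| <= 1.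
  have : r <= 1 by rewrite invf_le1 ?exprn_gt0// exprn_ege1// ler1n.
  by rewrite ler_norml => r1; apply/andP; split; lra.
pose y : 'rV[R]_(n + d) := @embed R n d ((1 - 1 / 2 * r) *: e).
have My : flat_disc y.
  by exists ((1 - 1 / 2 * r) *: e) => //; rewrite /eclball/= subr0 enormZ e1 mulr1.
have yx : enorm (y - x) = r / 2.
  rewrite /y /x embedB enorm_embed -[X in _ - X]scale1r -scalerBl enormZ e1 mulr1.
  by rewrite addrAC subrr add0r normrN gtr0_norm ?mulr_gt0 ?divr_gt0//; lra.
have ryx : eball x r y by rewrite /eball/= yx; lra.
(* The infimum defining the distance is only approached; doubling eps * r provides an actual point
   with a strict bound. *)
have [||p xp yp] := @dist_set_lt _ _ y (affine_plane x P) (2 * (eps * r)).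
- by exists x; rewrite /affine_plane/= subrr sub0mx.
- by apply: le_lt_trans (hP y My ryx) _; lra.
have xq : affine_plane x P (x - (p - x)).
  by rewrite /affine_plane/= addrAC subrr add0r -scaleN1r scalemx_sub.
have rq : eball x r (x - (p - x)).
  rewrite /eball/= addrAC subrr add0r enormN.
  by rewrite (le_lt_trans (ler_enormB _ y _))// yx enormB; lra.
have [||_ [u u1 <-] qu] := @dist_set_lt _ _ (x - (p - x)) (@flat_disc R n d) (2 * (eps * r)).
- by exists x.
- by apply: le_lt_trans (hE _ xq rq) _; lra.
rewrite /eclball/= subr0 in u1.
have u01 : u 0 i0 <= 1 by rewrite (le_trans (ler_norm _))// (le_trans (coord_le_enorm _ _)).
have := le_lt_trans (coord_le_enorm _ (lshift d i0)) yp.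
have := le_lt_trans (coord_le_enorm _ (lshift d i0)) qu.
have coordB (a b : 'rV[R]_(n + d)) j : (a - b) 0 j = a 0 j - b 0 j by rewrite !mxE.
have xj : x 0 (lshift d i0) = 1 by rewrite row_mxEl mxE !eqxx.
have yj : y 0 (lshift d i0) = 1 - 1 / 2 * r by rewrite row_mxEl !mxE !eqxx mulr1.
have uj : @embed R n d u 0 (lshift d i0) = u 0 i0 by rewrite row_mxEl.
rewrite !coordB xj yj uj !ltr_norml => /andP[h1 h2] /andP[h3 h4]; lra.
Qed.

Theorem theorem1p8 (R : realType) (n d : nat) (hn : (2 <= n)%N) (hd : (1 <= d)%N)
    (eps0 : R -> R -> R) (heps0 : parameterization_constant n d eps0) :
  exists (M : set 'rV[R]_(n + d)) (CM CP lambda : R),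
    [/\ 1 <= CM, 0 < CP, 1 <= lambda,
        parameterization_hypotheses n M CM CP lambda (eps0 CM CP) &
        not_reifenberg_flat n M].
Proof.
have n_gt0 : (0 < n)%N by exact: ltnW.
have b0 := ball_volume_pos R n_gt0.
have CM1 : 1 <= 1 + ball_volume n + 4 ^+ n / ball_volume n :> R.
  by rewrite -addrA lerDl addr_ge0 ?divr_ge0 ?exprn_ge0// ltW.
have CP0 : 0 < 4 * 16 ^+ n :> R by rewrite mulr_gt0// exprn_gt0.
(* The constants are chosen independently of eps0, so evaluating eps0 at them involves no
   circularity. *)
exists (@flat_disc R n d), (1 + ball_volume n + 4 ^+ n / ball_volume n), (4 * 16 ^+ n), 1.
split => //; last exact: flat_disc_not_reifenberg.
apply: flat_disc_hypotheses n_gt0 _ _; exact: heps0.1.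
Qed.
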